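(* Let $C_n$ be the cycle graph on the vertex set $[n]=\{1,\dots,n\}$ with edges $\overline{12},\overline{23},\dots,\overline{(n-1)\,n}$ and $\overline{1n}$. The elements $s_{i,j}$, $\overline{ij}\in E(C_n)$ (with $i<j$), together with $\psi(a)$ and $\psi(b)$, with the following three families of relations, give a presentation of the crossing-changeable braid group $B(C_n)=B(\mathbb{C},C_n)$: $R_1$: the elements $s_{i,j}$, $\overline{ij}\in E(C_n)$, are pairwise commutative. $R_2$: $\psi(a)^{-1}s_{i,j}\psi(a)=\begin{cases} s_{a(i),a(j)} & \text{if } 1\le i<n-1 \text{ and } j=i+1,\\ s_{a(j),a(i)} & \text{if } i=1 \text{ and } j=n,\\ s_{a(j),a(i)} & \text{if } i=n-1\text{ and } j=n;\end{cases}$ $\psi(b)^{-1}s_{i,j}\psi(b)=\begin{cases} s_{b(j),b(i)} & \text{if } 1<i\le n-1 \text{ and } j=i+1,\\ s_{b(i),b(j)} & \text{if } i=1\text{ and } j=2,\\ s_{b(i),b(j)} & \text{if } i=1\text{ and } j=n.\end{cases}$ $R_3$: $\psi(a)^n=s_{1,n}s_{n-1,n}s_{n-2,n-1}\cdots s_{1,2}$; $\psi(b)^2=\begin{cases} e & \text{if } n \text{ is even},\\ s_{\frac{n+1}{2},\frac{n+3}{2}} & \text{if } n\text{ is odd};\end{cases}$ $\psi(b)\psi(a)\psi(b)\psi(a)=\begin{cases} s_{1,2}\,s_{\frac{n+2}{2},\frac{n+4}{2}} & \text{if } n\text{ is even},\\ s_{1,2}\,s_{\frac{n+1}{2},\frac{n+3}{2}}\,s_{\frac{n+3}{2},\frac{n+5}{2}}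 & \text{if } n\text{ is odd}.\end{cases}$
   Context: For a simple graph $\Gamma$ on $[n]$ with edge set $E(\Gamma)$, $F(\mathbb{C},\Gamma)=\{(x_1,\dots,x_n)\in\mathbb{C}^n\mid x_j\ne x_k\text{ for }\overline{jk}\in E(\Gamma)\}$, and $F(\mathbb{C},n)\subset F(\mathbb{C},\Gamma)$ is the classical configuration space of $n$ distinct points. Fix a base point ${\bf x}=(x_1,\dots,x_n)\in F(\mathbb{C},n)$ (for the pictures, $x_1<\dots<x_n$ real). $\mathrm{Aut}(\Gamma)\subset\Sigma_n$ is the graph automorphism group, acting by ${\bf x}\mapsto{\bf x}_\sigma=(x_{\sigma(1)},\dots,x_{\sigma(n)})$. For a path $\alpha=(\alpha_1,\dots,\alpha_n)$ write $\alpha_\sigma=(\alpha_{\sigma(1)},\dots,\alpha_{\sigma(n)})$. The crossing-changeable braid group $B(\Gamma)=B(\mathbb{C},\Gamma)$ consists of the equivalence classes of braids $c(\alpha)=\{c(\alpha_1),\dots,c(\alpha_n)\}$, $c(\alpha_i)=\{(\alpha_i(s),s)\mid s\in[0,1]\}$, for paths $\alpha$ in $F(\mathbb{C},\Gamma)$ with $\alpha(0)={\bf x}$, $\alpha(1)={\bf x}_\sigma$ for some $\sigma\in\mathrm{Aut}(\Gamma)$, where $c(\alpha)\sim c(\beta)$ if there are continuous $h_i:[0,1]^2\to\mathbb{C}$ with $h_i(s,0)=\alpha_i(s)$, $h_i(s,1)=\beta_i(s)$, $h_i(0,t)=\alpha_i(0)=\beta_i(0)$, $h_i(1,t)=\alpha_i(1)=\beta_i(1)$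 and $h_j(s,t)\neq h_k(s,t)$ for all $(s,t)$ whenever $\overline{jk}\in E(\Gamma)$. The product is $[c(\alpha)]\star[c(\beta)]=[c(\alpha\circ\beta_\sigma)]$ with $\alpha(1)={\bf x}_\sigma$ and $\circ$ concatenation (first $\alpha$). Let $B_n$ be the Artin braid group with standard generators $\sigma_1,\dots,\sigma_{n-1}$ ($\sigma_i$ has a single crossing, between the strings at positions $i$ and $i+1$, with the same crossing sign for all $i$; products are concatenations read from left to right). Let $B_n|_{\mathrm{Aut}(C_n)}\subset B_n$ be the subgroup of braids whose permutation lies in $\mathrm{Aut}(C_n)$, and $i_*:B_n|_{\mathrm{Aut}(C_n)}\to B(C_n)$ the homomorphism induced by $F(\mathbb{C},n)\hookrightarrow F(\mathbb{C},C_n)$ (a braid is regarded as a crossing-changeable braid). In $B_n$ put $s_{i,j}=\sigma_{j-1}\cdots\sigma_{i+1}\sigma_i^2\sigma_{i+1}^{-1}\cdots\sigma_{j-1}^{-1}$ for $1\le i<j\le n$; $a_{i,j}=\sigma_{j-1}\cdots\sigma_i$ for $i<j$, with $a_{i,i}=1$; $e_{k,l}=a_{k,l}a_{k+1,l}^{-1}$ for $k<l$. The symbol $s_{i,j}$ also denotes $i_*(s_{i,j})\in B(C_n)$. $\mathrm{Aut}(C_n)$ is the dihedral group $\langle a,b\mid a^n=b^2=e,\ bab=a^{-1}\rangle$, with $a=(1\,2\,\cdots\,n)$ and $b=(2\ n)(3\ n-1)\cdots(r(n)\ s(n))$, where $r(n)=\frac n2$, $s(n)=\frac{n+4}2$ if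 $n$ is even and $r(n)=\frac{n+1}2$, $s(n)=\frac{n+3}2$ if $n$ is odd. The lifts are $\psi(a)=i_*(a_{1,n})$ and $\psi(b)=i_*(e_{2,n}e_{3,n-1}\cdots e_{r(n),s(n)})$ in $B(C_n)$. $e$ denotes the identity.
   Formalization: The formal theorem assumes n ≥ 4; for n = 3 the English fails: s_{3,4} in R_3 is not an edge of C_3, and B(C_3) = B_3, where s_{1,2} and s_{2,3} do not commute, contrary to R_1. *)

(* Defs.v *)
From HB Require Import structures.
From mathcomp Require Import all_boot all_order all_algebra all_fingroup.
From mathcomp Require Import generic_quotient complex.
From mathcomp Require Import boolp classical_sets functions reals topology.
From mathcomp Require Import normedtype trigo.
From mathcomp Require Import zify ring lra.

Set Implicit Arguments.
Unset Strict Implicit.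
Unset Printing Implicit Defensive.

Import Order.TTheory GRing.Theory Num.Theory numFieldNormedType.Exports.

Local Open Scope classical_set_scope.
Local Open Scope ring_scope.

(* R[i] seen as a numClosedFieldType, so that it inherits the topology of the
   norm. *)
Definition Cplx (R : realType) : numClosedFieldType := R[i].

Definition embC (R : realType) (r : R) : Cplx R := r%:C%C.

Definition cis (R : realType) (t : R) : Cplx R := (cos t +i* sin t)%C.

Definition square (R : realType) : set (R * R) := `[0, 1] `*` `[0, 1].
Arguments square R : clear implicits.

Section UnitInterval.
Variable R : realType.
Implicit Types (t s : R).

Definition clamp t : R := Num.max 0 (Num.min 1 t).

Lemma clamp_ge0 t : 0 <= clamp t.
Proof. by rewrite /clamp le_max lexx. Qed.

Lemma clamp_le1 t : clamp t <= 1.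
Proof. by rewrite /clamp ge_max ler01 ge_min lexx. Qed.

Lemma clamp_in t : `[0, 1]%classic (clamp t).
Proof. by rewrite /= in_itv /= clamp_ge0 clamp_le1. Qed.

Lemma clamp_id t : 0 <= t <= 1 -> clamp t = t.
Proof.
by case/andP=> t0 t1; rewrite /clamp (min_idPr t1) (max_idPr t0).
Qed.

Lemma clamp_le0 t : t <= 0 -> clamp t = 0.
Proof. by move=> t0; rewrite /clamp min_r ?max_l //; lra. Qed.

Lemma clamp_ge1 t : 1 <= t -> clamp t = 1.
Proof. by move=> t0; rewrite /clamp min_l ?max_r //; lra. Qed.

Lemma continuous_minf (f g : R -> R) :
  continuous f -> continuous g -> continuous (fun s => Num.min (f s) (g s)).
Proof. by move=> cf cg s; exact: (continuous_min (cf s) (cg s)). Qed.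

Lemma continuous_maxf (f g : R -> R) :
  continuous f -> continuous g -> continuous (fun s => Num.max (f s) (g s)).
Proof. by move=> cf cg s; exact: (continuous_max (cf s) (cg s)). Qed.

Lemma continuous_clamp : continuous clamp.
Proof.
move=> t; apply: continuous_max; first exact: cst_continuous.
by apply: continuous_min; [exact: cst_continuous | exact: cvg_id].
Qed.

Lemma within_retractP (T U : topologicalType) (A : set T) (r : T -> T)
    (f : T -> U) :
  continuous r -> (forall x, A (r x)) -> (forall x, A x -> r x = x) ->
  {within A, continuous f} <-> continuous (f \o r).
Proof.
move=> cr rA rid; split=> [|cf].
  move=> /subspace_continuousP cf x.
  apply: cvg_trans (cf (r x) (rA x)).
  move=> B /= HB.
  have := cr x _ HB; rewrite /nbhs /=; apply: filterS => y /= h.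
  exact: h.
apply: (@subspace_eq_continuous _ _ _ (f \o r)); last first.
  exact: continuous_subspaceT.
by move=> x /set_mem Ax /=; rewrite rid.
Qed.

Lemma within_itvP (U : topologicalType) (f : R -> U) :
  {within `[0, 1], continuous f} <-> continuous (f \o clamp).
Proof.
apply: within_retractP; [exact: continuous_clamp|exact: clamp_in|].
by move=> x; rewrite /= in_itv /=; exact: clamp_id.
Qed.

Definition clamp2 (st : R * R) : R * R := (clamp st.1, clamp st.2).

Lemma continuous_pair (S T U : topologicalType) (f : S -> T) (g : S -> U) :
  continuous f -> continuous g -> continuous (fun x => (f x, g x)).
Proof. by move=> cf cg x; exact: (cvg_pair (cf x) (cg x)). Qed.

Lemma continuous_fst (T U : topologicalType) : continuous (@fst T U).
Proof. by move=> x; exact: cvg_fst. Qed.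

Lemma continuous_snd (T U : topologicalType) : continuous (@snd T U).
Proof. by move=> x; exact: cvg_snd. Qed.

Lemma continuous_comp_fun (S T U : topologicalType) (f : S -> T) (g : T -> U) :
  continuous f -> continuous g -> continuous (g \o f).
Proof. by move=> cf cg x; apply: continuous_comp; [exact: cf|exact: cg]. Qed.

Lemma continuous_id (T : topologicalType) : continuous (fun x : T => x).
Proof. by move=> x; exact: cvg_id. Qed.

Lemma continuous_affine (a b : R) : continuous (fun s : R => a * s + b).
Proof.
move=> s; apply: continuousD; last exact: cst_continuous.
by apply: continuousM; [exact: cst_continuous|exact: cvg_id].
Qed.

Lemma continuous_clamp2 : continuous clamp2.
Proof.
apply: continuous_pair; apply: continuous_comp_fun (@continuous_clamp).
  exact: continuous_fst.
exact: continuous_snd.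
Qed.

Lemma within_squareP (U : topologicalType) (f : R * R -> U) :
  {within square R, continuous f} <-> continuous (f \o clamp2).
Proof.
apply: within_retractP; [exact: continuous_clamp2| |].
  by move=> st; split; exact: clamp_in.
by case=> s t [/= ]; rewrite !in_itv /= => hs ht; rewrite /clamp2 /= !clamp_id.
Qed.

Lemma continuous_add (K : numFieldType) (T : topologicalType) (f g : T -> K) :
  continuous f -> continuous g -> continuous (fun x => f x + g x).
Proof. by move=> cf cg x; exact: (cvgD (cf x) (cg x)). Qed.

Lemma continuous_opp (K : numFieldType) (T : topologicalType) (f : T -> K) :
  continuous f -> continuous (fun x => - f x).
Proof. by move=> cf x; exact: (cvgN (cf x)). Qed.

Lemma continuous_mul (K : numFieldType) (T : topologicalType) (f g : T -> K) :
  continuous f -> continuous g -> continuous (fun x => f x * g x).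
Proof. by move=> cf cg x; exact: (cvgM (cf x) (cg x)). Qed.

Lemma continuous_glue (T : topologicalType) (F G : R * T -> Cplx R) :
  continuous (fun p => F (clamp p.1, p.2)) ->
  continuous (fun p => G (clamp p.1, p.2)) ->
  (forall t : T, F (1, t) = G (0, t)) ->
  continuous (fun p => if clamp p.1 <= 2^-1 then F (2 * clamp p.1, p.2)
                       else G (2 * clamp p.1 - 1, p.2)).
Proof.
move=> cF cG FG.
rewrite (_ : (fun p => _) =
  (fun p => F (clamp (2 * p.1 + 0), p.2) + G (clamp (2 * p.1 + -1), p.2)
            - G (clamp 0, p.2))).
  have cA (a b : R) : continuous (fun p : R * T => (a * p.1 + b, p.2)).
    apply: continuous_pair; last exact: continuous_snd.
    apply: (@continuous_comp_fun _ _ _ fst (fun s => a * s + b)).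
      exact: continuous_fst.
    exact: continuous_affine.
  apply: continuous_add; last apply: continuous_opp.
  apply: continuous_add.
  - exact: (continuous_comp_fun (cA 2 0) cF).
  - exact: (continuous_comp_fun (cA 2 (-1)) cG).
  - have := continuous_comp_fun (cA 0 0) cG.
    by rewrite /comp /=; under eq_fun do rewrite mul0r addr0.
apply/funext => -[s t] /=; rewrite addr0 (clamp_le0 (lexx 0)).
case: (lerP s 0) => s0.
  rewrite !clamp_le0 ?mulr0 ?ifT; [|lra..].
  by rewrite addrK.
case: (lerP 1 s) => s1.
  rewrite !clamp_ge1 ?ifF; [|lra..].
  rewrite FG [RHS]addrAC subrr add0r; congr (G (_, _)); lra.
rewrite (@clamp_id s); last by lra.
case: (lerP s 2^-1) => s2.
  by rewrite clamp_id ?clamp_le0 ?addrK //; lra.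
rewrite (@clamp_ge1 (2 * s)) ?FG ?clamp_id; [|lra..].
by rewrite [RHS]addrAC subrr add0r.
Qed.

Lemma continuous_embC : continuous (@embC R).
Proof.
move=> x; apply/(@cvgrPdist_lt _ (Cplx R)) => e e0.
have [e' ee' e'0] : exists2 e' : R, e = embC e' & 0 < e'.
  move: e0; rewrite ltcE /= => /andP[/eqP ie re]; exists (complex.Re e) => //.
  by rewrite /embC; case: e ie re => a b /= ->.
near=> t.
rewrite /embC -(raddfB (real_complex R)) ee' normc_def /= expr0n addr0 sqrtr_sqr.
rewrite ltcR; near: t.
by apply: (@cvgr_dist_lt _ _ _ _ _ _ x) => //; exact: cvg_id.
Unshelve. all: by end_near.
Qed.

Lemma cisE (t : R) : cis t = embC (cos t) + ('i%C : Cplx R) * embC (sin t).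
Proof. by rewrite /cis /embC [LHS]complexE. Qed.

Lemma continuous_cis : continuous (@cis R).
Proof.
rewrite (funext cisE); apply: continuous_add.
  exact: (continuous_comp_fun (@continuous_cos R) continuous_embC).
apply: continuous_mul; first exact: cst_continuous.
exact: (continuous_comp_fun (@continuous_sin R) continuous_embC).
Qed.

End UnitInterval.

Record sgraph (n : nat) := SGraph {
  adj :> rel 'I_n;
  adj_sym : symmetric adj;
  adj_irr : irreflexive adj }.

Lemma neq_sym n : symmetric (fun i j : 'I_n => i != j).
Proof. by move=> i j; rewrite eq_sym. Qed.

Lemma neq_irr n : irreflexive (fun i j : 'I_n => i != j).
Proof. by move=> i; rewrite eqxx. Qed.

Definition complete_graph n : sgraph n := SGraph (@neq_sym n) (@neq_irr n).

(* F(C, G); the classical configuration space F(C, n) is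
   conf_space R (complete_graph n). *)
Definition conf_space (R : realType) n (G : sgraph n) : set ('I_n -> Cplx R) :=
  [set z | forall j k, G j k -> z j != z k].
Arguments conf_space R {n} G.

Definition graph_aut n (G : sgraph n) : {set 'S_n} :=
  [set s : 'S_n | [forall j, forall k, G (s j) (s k) == G j k]].

Lemma graph_autP n (G : sgraph n) (s : 'S_n) :
  reflect (forall j k, G (s j) (s k) = G j k) (s \in graph_aut G).
Proof.
rewrite inE; apply: (iffP forallP) => h j; last by apply/forallP => k; rewrite h.
by move=> k; have /forallP/(_ k)/eqP := h j.
Qed.

Lemma graph_aut_group_set n (G : sgraph n) : group_set (graph_aut G).
Proof.
apply/group_setP; split=> [|s t /graph_autP hs /graph_autP ht].
  by apply/graph_autP => j k; rewrite !perm1.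
by apply/graph_autP => j k; rewrite !permM ht hs.
Qed.
Canonical graph_aut_group n (G : sgraph n) := Group (graph_aut_group_set G).

Record base_point (R : realType) n := BasePoint {
  pt :> 'I_n -> Cplx R;
  pt_conf : conf_space R (complete_graph n) pt }.

Lemma pt_inj (R : realType) n (x : base_point R n) : injective x.
Proof.
move=> i j eij; apply/eqP; apply: contraT => /(@pt_conf _ _ x).
by rewrite eij eqxx.
Qed.

(* A crossing-changeable braid c(a) is stored as the path a itself: its strings
   c(a_i) start at the distinct points x_i, so the set c(a) determines a on
   [0, 1].  The values of the strands outside [0, 1] are irrelevant. *)
Record braid_path (R : realType) n (G : sgraph n) (x : base_point R n) := BraidPath {
  strand : 'I_n -> R -> Cplx R;
  end_perm : 'S_n;
  end_perm_aut : end_perm \in graph_aut G;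
  strand_cont : forall i, {within `[0, 1], continuous (strand i)};
  strand_conf : forall s : R, 0 <= s <= 1 -> conf_space R G (fun i => strand i s);
  strand0 : forall i, strand i 0 = x i;
  strand1 : forall i, strand i 1 = x (end_perm i) }.

Arguments end_perm_aut {R n G x} b.
Arguments strand_cont {R n G x} b i.
Arguments strand_conf {R n G x} b [s].
Arguments strand0 {R n G x} b i.
Arguments strand1 {R n G x} b i.

HB.instance Definition _ (R : realType) n (G : sgraph n) (x : base_point R n) :=
  gen_eqMixin (braid_path G x).
HB.instance Definition _ (R : realType) n (G : sgraph n) (x : base_point R n) :=
  gen_choiceMixin (braid_path G x).

Section BraidGroup.
Variables (R : realType) (n : nat) (G : sgraph n) (x : base_point R n).
Implicit Types (a b c : braid_path G x) (s t : R) (i j k : 'I_n).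

Definition homotopic a b : Prop :=
  exists h : 'I_n -> R * R -> Cplx R,
  [/\ forall i, {within square R, continuous (h i)},
      forall i s, 0 <= s <= 1 -> h i (s, 0) = strand a i s /\ h i (s, 1) = strand b i s,
      forall i t, 0 <= t <= 1 ->
        [/\ h i (0, t) = strand a i 0, h i (0, t) = strand b i 0,
            h i (1, t) = strand a i 1 & h i (1, t) = strand b i 1]
    & forall s t, 0 <= s <= 1 -> 0 <= t <= 1 -> conf_space R G (fun i => h i (s, t))].

Lemma homotopic_perm a b : homotopic a b -> end_perm a = end_perm b.
Proof.
case=> h [_ _ he _]; apply/permP => i; apply: (@pt_inj _ _ x).
rewrite -!strand1; have [] := he i 0; last by move=> _ _ <-.
by rewrite lexx ler01.
Qed.

Lemma homotopic_mk a b (h : 'I_n -> R * R -> Cplx R) :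
    (forall i, {within square R, continuous (h i)}) ->
    (forall i s, 0 <= s <= 1 -> h i (s, 0) = strand a i s) ->
    (forall i s, 0 <= s <= 1 -> h i (s, 1) = strand b i s) ->
    (forall i t, 0 <= t <= 1 -> h i (0, t) = x i) ->
    (forall i t, 0 <= t <= 1 -> h i (1, t) = h i (1, 0)) ->
    (forall s t, 0 <= s <= 1 -> 0 <= t <= 1 -> conf_space R G (fun i => h i (s, t))) ->
  homotopic a b.
Proof.
move=> hc ha hb h0 h1 hF; exists h; split=> // [i s s01|i t t01].
  by split; [exact: ha|exact: hb].
rewrite !strand0 h0 // h1 //; split=> //; first by rewrite ha // ler01 lexx.
by rewrite -hb ?ler01 ?lexx // [RHS]h1 // lexx ler01.
Qed.

(* Two reparametrisations of the same path with the same end parameters. *)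
Lemma homotopic_reparam c (r : 'S_n) (f g : R -> R) a b :
    r \in graph_aut G -> continuous f -> continuous g ->
    (forall s, 0 <= s <= 1 -> 0 <= f s <= 1) ->
    (forall s, 0 <= s <= 1 -> 0 <= g s <= 1) ->
    f 0 = g 0 -> f 1 = g 1 ->
    (forall i s, 0 <= s <= 1 -> strand a i s = strand c (r i) (f s)) ->
    (forall i s, 0 <= s <= 1 -> strand b i s = strand c (r i) (g s)) ->
  homotopic a b.
Proof.
move=> /graph_autP rG cf cg f01 g01 e0 e1 ha hb.
pose m (p : R * R) := (1 - p.2) * f p.1 + p.2 * g p.1.
have m01 s t : 0 <= s <= 1 -> 0 <= t <= 1 -> 0 <= m (s, t) <= 1.
  move=> /[dup] /f01 /andP[f0 f1] /g01 /andP[g0 g1] /andP[t0 t1].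
  rewrite /m /=; nra.
apply: (@homotopic_mk _ _ (fun i p => strand c (r i) (m p))).
- move=> i; apply/within_squareP.
  rewrite (_ : _ \o _ = (strand c (r i) \o @clamp R) \o (m \o @clamp2 R)); last first.
    apply/funext=> -[s t] /=; rewrite clamp_id //.
    by apply: m01; rewrite ?clamp_ge0 ?clamp_le1.
  apply: continuous_comp_fun; last exact/within_itvP/strand_cont.
  apply: continuous_comp_fun; first exact: continuous_clamp2.
  apply: continuous_add; apply: continuous_mul.
  + apply: (@continuous_comp_fun _ _ _ snd (fun t : R => 1 - t)).
      exact: continuous_snd.
    by apply: continuous_add; [exact: cst_continuous|exact/continuous_opp/continuous_id].
  + by apply: continuous_comp_fun cf; exact: continuous_fst.
  + exact: continuous_snd.
  + by apply: continuous_comp_fun cg; exact: continuous_fst.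
- by move=> i s s01; rewrite ha // /m /= subr0 mul1r mul0r addr0.
- by move=> i s s01; rewrite hb // /m /= subrr mul0r mul1r add0r.
- move=> i t t01; rewrite /m /= -e0 -mulrDl subrK mul1r -ha ?strand0 //.
  by rewrite lexx ler01.
- by move=> i t t01; rewrite /m /= -e1 -!mulrDl !subrK.
- move=> s t s01 t01 j k jk; apply: (strand_conf c (m01 _ _ s01 t01)).
  by rewrite rG.
Qed.

Lemma homotopic_eq a b :
  (forall i s, 0 <= s <= 1 -> strand a i s = strand b i s) -> homotopic a b.
Proof.
move=> ab; apply: (@homotopic_reparam b 1%g id id) => //.
- exact: continuous_id.
- exact: continuous_id.
- by move=> i s s01; rewrite ab // perm1.
- by move=> i s s01; rewrite perm1.
Qed.

Lemma homotopic_refl a : homotopic a a. Proof. exact: homotopic_eq. Qed.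

Lemma homotopic_sym a b : homotopic a b -> homotopic b a.
Proof.
case=> h [hc h01 he hF].
have ft t : 0 <= t <= 1 -> 0 <= 1 - t <= 1 by lra.
have i0 : 0 <= (0 : R) <= 1 by rewrite lexx ler01.
have i1 : 0 <= (1 : R) <= 1 by rewrite lexx ler01.
apply: (@homotopic_mk _ _ (fun i p => h i (p.1, 1 - p.2))) => /=.
- move=> i; apply/within_squareP.
  rewrite (_ : _ \o _ = (h i \o @clamp2 R) \o (fun p : R * R => (p.1, 1 - p.2))).
    apply: continuous_comp_fun; last exact/within_squareP.
    apply: continuous_pair; first exact: continuous_fst.
    apply: continuous_add; first exact: cst_continuous.
    by apply: continuous_opp; exact: continuous_snd.
  apply/funext => -[s t]; rewrite /= /clamp2 /=; congr (h i (_, _)).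
  case: (lerP t 0) => t0; first by rewrite clamp_le0 // clamp_ge1 ?subr0 //; lra.
  case: (lerP 1 t) => t1; first by rewrite clamp_ge1 // clamp_le0 ?subrr //; lra.
  by rewrite !clamp_id //; lra.
- by move=> i s s01; rewrite subr0; have [] := h01 i s s01.
- by move=> i s s01; rewrite subrr; have [] := h01 i s s01.
- by move=> i t /ft t01; have [-> _ _ _] := he i _ t01; rewrite strand0.
- by move=> i t /ft t01; have [_ _ -> _] := he i _ t01; have [_ _ ->] := he i _ (ft _ i0).
- by move=> s t s01 /ft t01; exact: hF.
Qed.

Lemma homotopic_trans a b c : homotopic a b -> homotopic b c -> homotopic a c.
Proof.
case=> h [hc h01 he hF] [g [gc g01 ge gF]].
have i0 : 0 <= (0 : R) <= 1 by rewrite lexx ler01.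
have i1 : 0 <= (1 : R) <= 1 by rewrite lexx ler01.
pose w i (p : R * R) :=
  if p.2 <= 2^-1 then h i (p.1, 2 * p.2) else g i (p.1, 2 * p.2 - 1).
have wP i (Q : Cplx R -> Prop) s t : 0 <= t <= 1 ->
    (forall t', 0 <= t' <= 1 -> Q (h i (s, t'))) ->
    (forall t', 0 <= t' <= 1 -> Q (g i (s, t'))) -> Q (w i (s, t)).
  move=> t01 Qh Qg; rewrite /w /=; case: ifPn => t2; first by apply: Qh; lra.
  by apply: Qg; lra.
apply: (@homotopic_mk _ _ w).
- move=> i; apply/within_squareP.
  pose sw (U : R * R -> Cplx R) (p : R * R) := U (clamp p.2, p.1).
  have cs (U : R * R -> Cplx R) : {within square R, continuous U} ->
      continuous (fun p : R * R => sw U (clamp p.1, p.2)).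
    move=> /within_squareP cU.
    have csw : continuous (fun p : R * R => (p.2, p.1)).
      by apply: continuous_pair; [exact: continuous_snd|exact: continuous_fst].
    exact: (continuous_comp_fun csw cU).
  have := continuous_glue (cs _ (hc i)) (cs _ (gc i)).
  have hg (t : R) : sw (h i) (1, t) = sw (g i) (0, t).
    rewrite /sw /=; have t01 : 0 <= clamp t <= 1 by rewrite clamp_ge0 clamp_le1.
    by have [_ ->] := h01 i _ t01; have [-> _] := g01 i _ t01.
  move=> /(_ hg) cgl.
  have csw : continuous (fun p : R * R => (p.2, p.1)).
    by apply: continuous_pair; [exact: continuous_snd|exact: continuous_fst].
  exact: (continuous_comp_fun csw cgl).
- move=> i s s01; rewrite /w /= ifT ?mulr0; last by lra.
  by have [] := h01 i s s01.
- move=> i s s01; rewrite /w /= ifF; last by apply/negP; lra.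
  by rewrite (_ : 2 * 1 - 1 = 1 :> R); [have [] := g01 i s s01 | lra].
- move=> i t t01; apply: (wP i (fun z => z = x i)) => // u u01.
    by have [-> _ _ _] := he i _ u01; rewrite strand0.
  by have [-> _ _ _] := ge i _ u01; rewrite strand0.
- move=> i t t01; suff w1 u : 0 <= u <= 1 -> w i (1, u) = strand b i 1.
    by rewrite !w1.
  move=> u01; apply: (wP i (fun z => z = strand b i 1)) => // v v01.
    by have [] := he i _ v01.
  by have [] := ge i _ v01.
- move=> s t s01 t01 j k jk; rewrite /w /=; case: ifPn => t2.
    by apply: hF; rewrite ?s01 //; lra.
  by apply: gF; rewrite ?s01 //; lra.
Qed.

(* The concatenation of a and b_sigma, where a ends at x_sigma. *)
Definition mul_strand a b i s : Cplx R :=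
  if s <= 2^-1 then strand a i (2 * s) else strand b (end_perm a i) (2 * s - 1).

Lemma mul_strand_cont a b i : {within `[0, 1], continuous (mul_strand a b i)}.
Proof.
apply/within_itvP.
have cl (f : R -> Cplx R) : {within `[0, 1], continuous f} ->
    continuous (fun p : R * R => f (clamp p.1)).
  by move=> /within_itvP; apply: continuous_comp_fun; exact: continuous_fst.
have := @continuous_glue R _ (fun p => strand a i p.1)
  (fun p => strand b (end_perm a i) p.1) (cl _ (strand_cont a i)) (cl _ (strand_cont b _)).
move=> /(_ (fun _ => etrans (strand1 a i) (esym (strand0 b _)))).
apply: (@continuous_comp_fun _ _ _ (fun s : R => (s, 0 : R))).
by apply: continuous_pair; [exact: continuous_id|exact: cst_continuous].
Qed.
Arguments mul_strand_cont : clear implicits.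

Lemma mul_strand_conf a b s : 0 <= s <= 1 -> conf_space R G (fun i => mul_strand a b i s).
Proof.
move=> s01 j k jk; rewrite /mul_strand; case: ifPn => s2.
  by apply: strand_conf => //; lra.
apply: (strand_conf b); first by lra.
by have /graph_autP -> := end_perm_aut a.
Qed.

Lemma mul_strand0 a b i : mul_strand a b i 0 = x i.
Proof. by rewrite /mul_strand ifT ?mulr0 ?strand0 //; lra. Qed.

Lemma mul_strand1 a b i : mul_strand a b i 1 = x ((end_perm a * end_perm b)%g i).
Proof.
rewrite /mul_strand ifF; last by apply/negP; lra.
by rewrite permM -strand1; congr strand; lra.
Qed.

Definition mul_path a b : braid_path G x :=
  BraidPath (groupM (end_perm_aut a) (end_perm_aut b)) (mul_strand_cont a b)
    (mul_strand_conf a b) (mul_strand0 a b) (mul_strand1 a b).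

Lemma cst_strand_conf (s : R) : 0 <= s <= 1 -> conf_space R G (fun i => x i).
Proof.
move=> _ j k jk; apply: pt_conf => /=; apply: contraTneq jk => ->.
by rewrite adj_irr.
Qed.

Lemma cst_strand1 i : x i = x ((1%g : 'S_n) i). Proof. by rewrite perm1. Qed.

Definition one_path : braid_path G x :=
  @BraidPath R n G x (fun i _ => x i) 1%g (group1 _)
    (fun i => continuous_subspaceT (@cst_continuous R (Cplx R) (x i)))
    cst_strand_conf (fun i => erefl) cst_strand1.

Definition inv_strand a i s : Cplx R := strand a ((end_perm a)^-1%g i) (1 - s).

Lemma inv_strand_cont a i : {within `[0, 1], continuous (inv_strand a i)}.
Proof.
apply/within_itvP.
rewrite (_ : _ \o _ = (strand a ((end_perm a)^-1%g i) \o @clamp R) \o (fun s : R => 1 - s)).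
  apply: continuous_comp_fun; last exact/within_itvP/strand_cont.
  by apply: continuous_add; [exact: cst_continuous|exact/continuous_opp/continuous_id].
apply/funext => t; rewrite /= /inv_strand; congr strand.
case: (lerP t 0) => t0; first by rewrite clamp_le0 // clamp_ge1 ?subr0 //; lra.
case: (lerP 1 t) => t1; first by rewrite clamp_ge1 // clamp_le0 ?subrr //; lra.
by rewrite !clamp_id //; lra.
Qed.
Arguments inv_strand_cont : clear implicits.

Lemma inv_strand_conf a s : 0 <= s <= 1 -> conf_space R G (fun i => inv_strand a i s).
Proof.
move=> s01 j k jk; apply: (strand_conf a); first by lra.
by have /graph_autP -> := groupVr (end_perm_aut a).
Qed.

Lemma inv_strand0 a i : inv_strand a i 0 = x i.
Proof. by rewrite /inv_strand subr0 strand1 permKV. Qed.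

Lemma inv_strand1 a i : inv_strand a i 1 = x ((end_perm a)^-1%g i).
Proof. by rewrite /inv_strand subrr strand0. Qed.

Definition inv_path a : braid_path G x :=
  BraidPath (groupVr (end_perm_aut a)) (inv_strand_cont a) (inv_strand_conf a)
    (inv_strand0 a) (inv_strand1 a).

Lemma homotopic_mul a a' b b' :
  homotopic a a' -> homotopic b b' -> homotopic (mul_path a b) (mul_path a' b').
Proof.
move=> aa' bb'; have pa := homotopic_perm aa'.
case: aa' bb' => h [hc h01 he hF] [g [gc g01 ge gF]].
have i0 : 0 <= (0 : R) <= 1 by rewrite lexx ler01.
have i1 : 0 <= (1 : R) <= 1 by rewrite lexx ler01.
pose w i (p : R * R) :=
  if p.1 <= 2^-1 then h i (2 * p.1, p.2) else g (end_perm a i) (2 * p.1 - 1, p.2).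
apply: (@homotopic_mk _ _ w).
- move=> i; apply/within_squareP.
  pose cl (U : R * R -> Cplx R) (p : R * R) := U (p.1, clamp p.2).
  have cs (U : R * R -> Cplx R) : {within square R, continuous U} ->
      continuous (fun p : R * R => cl U (clamp p.1, p.2)).
    by move=> /within_squareP.
  apply: (continuous_glue (cs _ (hc i)) (cs _ (gc (end_perm a i)))) => t.
  rewrite /cl /=; have t01 : 0 <= clamp t <= 1 by rewrite clamp_ge0 clamp_le1.
  have [_ _ -> _] := he i _ t01; have [-> _ _ _] := ge (end_perm a i) _ t01.
  by rewrite strand0 strand1.
- move=> i s s01; rewrite /w /= /mul_strand; case: ifPn => s2.
    by have [->] := h01 i (2 * s) ltac:(lra).
  by have [->] := g01 (end_perm a i) (2 * s - 1) ltac:(lra).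
- move=> i s s01; rewrite /w /= /mul_strand -pa; case: ifPn => s2.
    by have [_ ->] := h01 i (2 * s) ltac:(lra).
  by have [_ ->] := g01 (end_perm a i) (2 * s - 1) ltac:(lra).
- move=> i t t01; rewrite /w /= ifT ?mulr0; last by lra.
  by have [-> _ _ _] := he i _ t01; rewrite strand0.
- move=> i t t01; rewrite /w /= !ifF; try by apply/negP; lra.
  rewrite (_ : 2 * 1 - 1 = 1 :> R); last by lra.
  have [_ _ -> _] := ge (end_perm a i) _ t01.
  by have [_ _ -> _] := ge (end_perm a i) _ i0.
- move=> s t s01 t01 j k jk; rewrite /w /=; case: ifPn => s2.
    by apply: hF; rewrite ?t01 //; lra.
  apply: gF => //; first by lra.
  by have /graph_autP -> := end_perm_aut a.
Qed.

Lemma homotopic_inv a a' : homotopic a a' -> homotopic (inv_path a) (inv_path a').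
Proof.
move=> aa'; have pa := homotopic_perm aa'; case: aa' => h [hc h01 he hF].
have ft t : 0 <= t <= 1 -> 0 <= 1 - t <= 1 by lra.
have i0 : 0 <= (0 : R) <= 1 by rewrite lexx ler01.
have i1 : 0 <= (1 : R) <= 1 by rewrite lexx ler01.
apply: (@homotopic_mk _ _ (fun i p => h ((end_perm a)^-1%g i) (1 - p.1, p.2))) => /=.
- move=> i; set i' := _ i; apply/within_squareP.
  rewrite (_ : _ \o _ = (h i' \o @clamp2 R) \o (fun p : R * R => (1 - p.1, p.2))).
    apply: continuous_comp_fun; last exact/within_squareP.
    apply: continuous_pair; last exact: continuous_snd.
    apply: continuous_add; first exact: cst_continuous.
    by apply: continuous_opp; exact: continuous_fst.
  apply/funext => -[t s]; rewrite /= /clamp2 /=; congr (h i' (_, _)).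
  case: (lerP t 0) => t0; first by rewrite clamp_le0 // clamp_ge1 ?subr0 //; lra.
  case: (lerP 1 t) => t1; first by rewrite clamp_ge1 // clamp_le0 ?subrr //; lra.
  by rewrite !clamp_id //; lra.
- by move=> i s /ft s01; have [-> _] := h01 ((end_perm a)^-1%g i) _ s01.
- by move=> i s /ft s01; rewrite /inv_strand -pa; have [_ ->] := h01 ((end_perm a)^-1%g i) _ s01.
- by move=> i t t01; rewrite subr0; have [_ _ -> _] := he ((end_perm a)^-1%g i) _ t01; rewrite strand1 permKV.
- move=> i t t01; rewrite subrr; have [-> _ _ _] := he ((end_perm a)^-1%g i) _ t01.
  by have [-> _ _ _] := he ((end_perm a)^-1%g i) _ i0.
- move=> s t /ft s01 t01 j k jk; apply: hF => //.
  by have /graph_autP -> := groupVr (end_perm_aut a).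
Qed.

Lemma mul_pathA a b c :
  homotopic (mul_path a (mul_path b c)) (mul_path (mul_path a b) c).
Proof.
pose f (s : R) : R := Num.min (2 * s + 0) (Num.min (1 * s + 4^-1) (2^-1 * s + 2^-1)).
have fE1 (s : R) : s <= 4^-1 -> f s = 2 * s.
  by move=> ?; rewrite /f !min_l ?addr0 // ?le_min; lra.
have fE2 (s : R) : 4^-1 <= s <= 2^-1 -> f s = s + 4^-1.
  by move=> ?; rewrite /f min_r ?min_l ?mul1r // ?ge_min; lra.
have fE3 (s : R) : 2^-1 <= s -> f s = 2^-1 * s + 2^-1.
  by move=> ?; rewrite /f [X in Num.min _ X]min_r ?min_r //; lra.
apply: homotopic_sym.
apply: (@homotopic_reparam (mul_path a (mul_path b c)) 1%g f id); rewrite ?group1 //.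
- apply: continuous_minf; first exact: continuous_affine.
  by apply: continuous_minf; exact: continuous_affine.
- exact: continuous_id.
- move=> s s01; case: (lerP s 4^-1) => s4; first by rewrite fE1 //; lra.
  case: (lerP s 2^-1) => s2; first by rewrite fE2; lra.
  by rewrite fE3; lra.
- by rewrite fE1; lra.
- by rewrite fE3; lra.
- move=> i s s01; rewrite perm1 /= /mul_strand /=.
  case: (lerP s 4^-1) => s4.
    rewrite fE1 // ifT; last by lra.
    rewrite /mul_strand ifT; last by lra.
    by rewrite ifT //; lra.
  case: (lerP s 2^-1) => s2.
    rewrite fE2; last by lra.
    rewrite /mul_strand ifF; last by apply/negP; lra.
    rewrite ifF; last by apply/negP; lra.
    by rewrite ifT; [congr strand|]; lra.
  rewrite fE3; last by lra.
  rewrite ifF; last by apply/negP; lra.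
  rewrite /mul_strand ifF; last by apply/negP; lra.
  by rewrite permM; congr strand; lra.
- by move=> i s s01; rewrite perm1.
Qed.

Lemma mul_1path a : homotopic (mul_path one_path a) a.
Proof.
pose f (s : R) : R := Num.max 0 (2 * s + -1).
have fE1 (s : R) : s <= 2^-1 -> f s = 0 by move=> ?; rewrite /f max_l //; lra.
have fE2 (s : R) : 2^-1 <= s -> f s = 2 * s - 1 by move=> ?; rewrite /f max_r //; lra.
apply: (@homotopic_reparam a 1%g f id); rewrite ?group1 //.
- apply: continuous_maxf; first exact: cst_continuous.
  exact: continuous_affine.
- exact: continuous_id.
- move=> s s01; case: (lerP s 2^-1) => s2; first by rewrite fE1 //; lra.
  by rewrite fE2; lra.
- by rewrite fE1; lra.
- by rewrite fE2; lra.
- move=> i s s01; rewrite perm1 /= /mul_strand /=.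
  case: ifPn => s2; first by rewrite fE1 // strand0.
  by rewrite perm1 fE2 //; lra.
- by move=> i s s01; rewrite perm1.
Qed.

Lemma mul_path1 a : homotopic (mul_path a one_path) a.
Proof.
pose f (s : R) : R := Num.min 1 (2 * s + 0).
have fE1 (s : R) : s <= 2^-1 -> f s = 2 * s by move=> ?; rewrite /f min_r ?addr0 //; lra.
have fE2 (s : R) : 2^-1 <= s -> f s = 1 by move=> ?; rewrite /f min_l //; lra.
apply: (@homotopic_reparam a 1%g f id); rewrite ?group1 //.
- apply: continuous_minf; first exact: cst_continuous.
  exact: continuous_affine.
- exact: continuous_id.
- move=> s s01; case: (lerP s 2^-1) => s2; first by rewrite fE1 //; lra.
  by rewrite fE2; lra.
- by rewrite fE1; lra.
- by rewrite fE2; lra.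
- move=> i s s01; rewrite perm1 /= /mul_strand /=.
  case: ifPn => s2; first by rewrite fE1.
  by rewrite fE2 ?strand1 //; lra.
- by move=> i s s01; rewrite perm1.
Qed.

Lemma mul_pathV a : homotopic (mul_path a (inv_path a)) one_path.
Proof.
pose f (s : R) : R := Num.min (2 * s + 0) (-2 * s + 2).
have fE1 (s : R) : s <= 2^-1 -> f s = 2 * s by move=> ?; rewrite /f min_l ?addr0 //; lra.
have fE2 (s : R) : 2^-1 <= s -> f s = 2 - 2 * s by move=> ?; rewrite /f min_r //; lra.
apply: (@homotopic_reparam a 1%g f (fun _ => 0)); rewrite ?group1 //.
- by apply: continuous_minf; exact: continuous_affine.
- by move=> s; exact: cst_continuous.
- move=> s s01; case: (lerP s 2^-1) => s2; first by rewrite fE1 //; lra.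
  by rewrite fE2; lra.
- by move=> s s01; rewrite lexx ler01.
- by rewrite fE1; lra.
- by rewrite fE2; lra.
- move=> i s s01; rewrite perm1 /= /mul_strand /=.
  case: ifPn => s2; first by rewrite fE1.
  rewrite fE2; last by lra.
  by rewrite /inv_strand permK; congr strand; lra.
- by move=> i s s01; rewrite perm1 strand0.
Qed.

Lemma mul_Vpath a : homotopic (mul_path (inv_path a) a) one_path.
Proof.
apply: homotopic_trans (mul_pathV (inv_path a)); apply: homotopic_mul.
  exact: homotopic_refl.
by apply: homotopic_eq => i s s01; rewrite /= /inv_strand /= invgK permK; congr strand; lra.
Qed.

Definition homotopyb a b : bool := `[< homotopic a b >].

Lemma homotopyb_refl : reflexive homotopyb.
Proof. by move=> a; apply/asboolP; exact: homotopic_refl. Qed.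

Lemma homotopyb_sym : symmetric homotopyb.
Proof. by move=> a b; apply/asboolP/asboolP; exact: homotopic_sym. Qed.

Lemma homotopyb_trans : transitive homotopyb.
Proof.
by move=> b a c /asboolP ab /asboolP bc; apply/asboolP; exact: homotopic_trans bc.
Qed.

Canonical homotopy_equiv := EquivRel homotopyb homotopyb_refl homotopyb_sym homotopyb_trans.

Local Open Scope quotient_scope.

Definition braid_group := {eq_quot homotopy_equiv}.

HB.instance Definition _ := EqQuotient.on braid_group.
HB.instance Definition _ := Choice.on braid_group.

Implicit Types (u v w : braid_group).

Definition braid_class (a : braid_path G x) : braid_group := \pi_braid_group a.

Lemma braid_classP a b : braid_class a = braid_class b <-> homotopic a b.
Proof. by split=> [/eqmodP/asboolP|ab] //; apply/eqmodP/asboolP. Qed.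

Lemma braid_classK u : braid_class (repr u) = u.
Proof. exact: reprK. Qed.

Lemma braid_repr a : homotopic (repr (braid_class a)) a.
Proof. by apply/braid_classP; rewrite braid_classK. Qed.

Definition mul_braid u v : braid_group := braid_class (mul_path (repr u) (repr v)).
Definition one_braid : braid_group := braid_class one_path.
Definition inv_braid u : braid_group := braid_class (inv_path (repr u)).

Lemma mul_braidE a b :
  mul_braid (braid_class a) (braid_class b) = braid_class (mul_path a b).
Proof. by apply/braid_classP/homotopic_mul; exact: braid_repr. Qed.

Lemma inv_braidE a : inv_braid (braid_class a) = braid_class (inv_path a).
Proof. by apply/braid_classP/homotopic_inv; exact: braid_repr. Qed.

Lemma mul_braidA : associative mul_braid.
Proof.
move=> u v w; rewrite -(braid_classK u) -(braid_classK v) -(braid_classK w).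
by rewrite !mul_braidE; apply/braid_classP/mul_pathA.
Qed.

Lemma mul_1braid : left_id one_braid mul_braid.
Proof. by move=> u; rewrite -(braid_classK u) mul_braidE; apply/braid_classP/mul_1path. Qed.

Lemma mul_braid1 : right_id one_braid mul_braid.
Proof. by move=> u; rewrite -(braid_classK u) mul_braidE; apply/braid_classP/mul_path1. Qed.

Lemma mul_Vbraid : left_inverse one_braid inv_braid mul_braid.
Proof.
by move=> u; rewrite -(braid_classK u) inv_braidE mul_braidE; apply/braid_classP/mul_Vpath.
Qed.

Lemma mul_braidV : right_inverse one_braid inv_braid mul_braid.
Proof.
by move=> u; rewrite -(braid_classK u) inv_braidE mul_braidE; apply/braid_classP/mul_pathV.
Qed.

HB.instance Definition _ := isGroup.Build braid_group
  mul_braidA mul_1braid mul_braid1 mul_Vbraid mul_braidV.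

Definition braid_perm u : 'S_n := end_perm (repr u).

End BraidGroup.

Arguments braid_group {R n} G x.

Section Artin.
Variables (R : realType) (n : nat).

Lemma incl_conf (G : sgraph n) (z : 'I_n -> Cplx R) :
  conf_space R (complete_graph n) z -> conf_space R G z.
Proof.
move=> zF j k jk; apply: zF; rewrite /=; apply: contraTneq jk => ->.
by rewrite adj_irr.
Qed.

(* Elements of the Artin braid group B_n. *)
Definition artin_group (x : base_point R n) := braid_group (complete_graph n) x.

Definition incl_path (G : sgraph n) (x : base_point R n)
    (a : braid_path (complete_graph n) x) (aG : end_perm a \in graph_aut G) :
    braid_path G x :=
  BraidPath aG (strand_cont a) (fun s s01 => incl_conf (strand_conf a s01))
    (strand0 a) (strand1 a).

(* The map i_* induced by the inclusion of F(C, n) in F(C, G).  Its domain is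
   the subgroup of the u with braid_perm u \in graph_aut G; the value outside
   of it is irrelevant. *)
Definition i_star (G : sgraph n) (x : base_point R n) (u : artin_group x) :
    braid_group G x :=
  if pselect (braid_perm u \in graph_aut G) is left uG
  then braid_class (incl_path uG) else 1%g.

(* A base point x_1 < ... < x_n on the real line. *)
Record line_point := LinePoint {
  line_pt :> 'I_n -> R;
  line_pt_inc : forall i j : 'I_n, (i < j)%N -> line_pt i < line_pt j }.

Lemma line_pt_conf (x : line_point) :
  conf_space R (complete_graph n) (fun i => embC (x i)).
Proof.
move=> i j ij; apply: contra_neq ij => /(@complexI R) eij; apply: val_inj => /=.
by case: (ltngtP i j) => // /(@line_pt_inc x); rewrite eij ltxx.
Qed.

Definition line_base (x : line_point) : base_point R n := BasePoint (@line_pt_conf x).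

(* The transposition of the positions i and i + 1, numbered from 1. *)
Definition adj_tperm (i : nat) : 'S_n :=
  match insub i.-1, insub i with
  | Some j, Some k => tperm j k
  | _, _ => 1%g
  end.

Lemma adj_tpermP i : adj_tperm i = 1%g \/
  exists j k : 'I_n, (k = j.+1 :> nat) /\ adj_tperm i = tperm j k.
Proof.
rewrite /adj_tperm; case: insubP => [j _ ej|_]; last by left.
case: insubP => [k _ ek|_]; last by left.
case: i => [|i] in ej ek *; last by right; exists j, k; rewrite ej ek.
by left; rewrite (_ : j = k) ?tperm1 //; apply: val_inj; rewrite ej ek.
Qed.

Lemma adj_tpermK i : involutive (adj_tperm i).
Proof.
by move=> l; case: (adj_tpermP i) => [->|[j [k [_ ->]]]]; rewrite ?perm1 ?tpermK.
Qed.

Variable x : line_point.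

(* The strings at positions i and i + 1 exchange their places by half a turn
   around their midpoint, counterclockwise if cw = false and clockwise if
   cw = true; the other strings are constant. *)
Definition twist_strand (cw : bool) (i : nat) (k : 'I_n) (s : R) : Cplx R :=
  let l := adj_tperm i k in
  embC ((x k + x l) / 2) + cis ((-1) ^+ cw * pi * s) * embC ((x k - x l) / 2).

Lemma twist_strand_cont cw i k : {within `[0, 1], continuous (twist_strand cw i k)}.
Proof.
apply: continuous_subspaceT; apply: continuous_add; first exact: cst_continuous.
apply: continuous_mul; last exact: cst_continuous.
apply: (continuous_comp_fun _ (@continuous_cis R)).
by apply: continuous_mul; [exact: cst_continuous|exact: continuous_id].
Qed.
Arguments twist_strand_cont : clear implicits.

Lemma twist_strandE cw i k s : twist_strand cw i k s =
  let l := adj_tperm i k in let t := (-1) ^+ cw * pi * s in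
  Complex ((x k + x l) / 2 + cos t * ((x k - x l) / 2))
    (sin t * ((x k - x l) / 2)) :> Cplx R.
Proof.
by rewrite /twist_strand /cis /embC /=; apply/eqP; rewrite eq_complex /=; apply/andP; split;
  apply/eqP; ring.
Qed.

Lemma twist_strand_conf cw i s : 0 <= s <= 1 ->
  conf_space R (complete_graph n) (fun k => twist_strand cw i k s).
Proof.
move=> _ k l /= kl; apply/eqP; rewrite !twist_strandE /=; set t := _ * s => -[].
have xltn (p q : 'I_n) : (p < q)%N -> x p < x q by exact: line_pt_inc.
have xneq (p q : 'I_n) : p != q -> x p < x q \/ x q < x p.
  by rewrite -val_eqE /=; case: ltngtP => // h _; [left|right]; exact: xltn.
have c1 := cos_le1 t; have c2 := cos_geN1 t; have cs := cos2Dsin2 t.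
case: (adj_tpermP i) => [->|[j [m [mj ->]]]].
  by rewrite !perm1; have [] := xneq k l kl; lra.
have xjm : x j < x m by apply: xltn; rewrite mj.
have far (p : 'I_n) : p <> j -> p <> m -> x p < x j \/ x m < x p.
  move=> /eqP pj /eqP pm; case: (ltngtP p j) => [/xltn|jp|/val_inj e].
  - by left.
  - right; apply: xltn; rewrite ltn_neqAle mj jp andbT -mj.
    by rewrite eq_sym; exact: pm.
  - by rewrite e eqxx in pj.
have half (u v : R) : u != v ->
    (u + v) / 2 + cos t * ((u - v) / 2) = (v + u) / 2 + cos t * ((v - u) / 2) ->
    sin t * ((u - v) / 2) = sin t * ((v - u) / 2) -> False.
  move=> uv e1 e2; have d0 : u - v != 0 by rewrite subr_eq0.
  have c0 : cos t = 0 by apply: (mulIf d0); rewrite mul0r; lra.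
  have s0 : sin t = 0 by apply: (mulIf d0); rewrite mul0r; lra.
  by move: cs; rewrite c0 s0 expr0n addr0 => /eqP; rewrite eq_sym oner_eq0.
move: kl; case: tpermP => [->|->|kj km]; case: tpermP => [->|->|lj lm];
  rewrite ?eqxx // => kl.
- by apply: half; rewrite lt_eqF.
- by have [] := far l lj lm; nra.
- by apply: half; rewrite gt_eqF.
- by have [] := far l lj lm; nra.
- by have [] := far k kj km; nra.
- by have [] := far k kj km; nra.
- by have [] := xneq k l kl; nra.
Qed.

Lemma twist_strand0 cw i k : twist_strand cw i k 0 = line_base x k.
Proof.
rewrite twist_strandE /= mulr0 cos0 sin0 mul0r mul1r; congr Complex; lra.
Qed.

Lemma twist_strand1 cw i k : twist_strand cw i k 1 = line_base x (adj_tperm i k).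
Proof.
rewrite twist_strandE /= mulr1.
have -> : cos ((-1) ^+ cw * pi) = -1 :> R.
  by case: cw; rewrite ?expr1 ?expr0 ?mulN1r ?mul1r ?cosN cospi.
have -> : sin ((-1) ^+ cw * pi) = 0 :> R.
  by case: cw; rewrite ?expr1 ?expr0 ?mulN1r ?mul1r ?sinN sinpi ?oppr0.
by rewrite mul0r; congr Complex; lra.
Qed.

Lemma complete_autT (s : 'S_n) : s \in graph_aut (complete_graph n).
Proof. by apply/graph_autP => j k /=; rewrite (inj_eq perm_inj). Qed.

Definition twist_path (cw : bool) (i : nat) : braid_path (complete_graph n) (line_base x) :=
  BraidPath (complete_autT (adj_tperm i)) (twist_strand_cont cw i)
    (@twist_strand_conf cw i) (twist_strand0 cw i) (twist_strand1 cw i).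

(* sigma_i for 1 <= i < n *)
Definition sigma (cw : bool) (i : nat) : artin_group (line_base x) :=
  braid_class (twist_path cw i).

Local Open Scope group_scope.

(* a_{i,j} = sigma_{j-1} ... sigma_i *)
Definition a_elt (cw : bool) (i j : nat) : artin_group (line_base x) :=
  \prod_(k <- rev (iota i (j - i))) sigma cw k.

Definition s_elt (cw : bool) (i j : nat) : artin_group (line_base x) :=
  (\prod_(k <- rev (iota i.+1 (j - i.+1))) sigma cw k) * sigma cw i ^+ 2
  * (\prod_(k <- iota i.+1 (j - i.+1)) (sigma cw k)^-1).

Definition e_elt (cw : bool) (k l : nat) : artin_group (line_base x) :=
  a_elt cw k l * (a_elt cw k.+1 l)^-1.

End Artin.

Section PermMorph.
Variables (R : realType) (n : nat) (G : sgraph n) (x : base_point R n).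
Local Open Scope group_scope.

Lemma braid_permE (a : braid_path G x) : braid_perm (braid_class a) = end_perm a.
Proof. exact: homotopic_perm (braid_repr a). Qed.

Lemma braid_permM (u v : braid_group G x) :
  braid_perm (u * v) = braid_perm u * braid_perm v.
Proof. exact: braid_permE. Qed.

Lemma braid_perm1 : braid_perm (1 : braid_group G x) = 1.
Proof. exact: braid_permE. Qed.

Lemma braid_permV (u : braid_group G x) : braid_perm u^-1 = (braid_perm u)^-1.
Proof. exact: braid_permE. Qed.

Lemma braid_perm_prod (I : Type) (r : seq I) (F : I -> braid_group G x) :
  braid_perm (\prod_(i <- r) F i) = \prod_(i <- r) braid_perm (F i).
Proof. by elim/big_rec2: _ => [|i u v _ <-]; rewrite ?braid_perm1 ?braid_permM. Qed.

End PermMorph.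

Section IStar.
Variables (R : realType) (n : nat) (G : sgraph n) (x : base_point R n).
Local Open Scope group_scope.

Lemma i_star_class (a : braid_path (complete_graph n) x) (aG : end_perm a \in graph_aut G) :
  i_star G (braid_class a) = braid_class (incl_path aG).
Proof.
rewrite /i_star; case: pselect => [uG|nG].
  2: by case: nG; rewrite braid_permE.
apply/braid_classP; have [h [hc h01 he hF]] := braid_repr a.
by exists h; split=> // s t s01 t01; apply: incl_conf; exact: hF.
Qed.

Lemma i_starM (u v : artin_group x) :
  braid_perm u \in graph_aut G -> braid_perm v \in graph_aut G ->
  i_star G (u * v) = i_star G u * i_star G v.
Proof.
rewrite -(braid_classK u) -(braid_classK v) !braid_permE => uG vG.
have -> : braid_class (repr u) * braid_class (repr v) =
  braid_class (mul_path (repr u) (repr v)) by exact: mul_braidE.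
have uvG : end_perm (mul_path (repr u) (repr v)) \in graph_aut G by exact: groupM.
rewrite !i_star_class [RHS]mul_braidE.
by apply/braid_classP/homotopic_eq.
Qed.

End IStar.

(* Words over I: (i, false) is the letter i and (i, true) its inverse. *)
Definition word (I : Type) := seq (I * bool).

Definition word_inv (I : Type) (w : word I) : word I :=
  rev [seq (l.1, ~~ l.2) | l <- w].

Definition word_eval (I : Type) (H : groupType) (f : I -> H) (w : word I) : H :=
  (\prod_(l <- w) (if l.2 then (f l.1)^-1 else f l.1))%g.

(* Equality of words in the group with generators I and relations rel. *)
Inductive word_cong (I : Type) (rel : word I -> word I -> Prop) :
    word I -> word I -> Prop :=
| WordRefl u : word_cong rel u u
| WordSym u v : word_cong rel u v -> word_cong rel v u
| WordTrans u v w : word_cong rel u v -> word_cong rel v w -> word_cong rel u w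
| WordCat u u' v v' :
    word_cong rel u u' -> word_cong rel v v' -> word_cong rel (u ++ v) (u' ++ v')
| WordCancel i e : word_cong rel [:: (i, e); (i, ~~ e)] [::]
| WordRel u v : rel u v -> word_cong rel u v.

Definition is_presentation (I : Type) (rel : word I -> word I -> Prop)
    (H : groupType) (f : I -> H) : Prop :=
  (forall h : H, exists w : word I, word_eval f w = h) /\
  (forall u v : word I, word_eval f u = word_eval f v <-> word_cong rel u v).

(* The edges ij of C_n with i < j, on the vertex set {1, ..., n}. *)
Definition cycle_edge (n : nat) (ij : nat * nat) : bool :=
  [&& 0 < ij.1, ij.1 < ij.2, ij.2 <= n &
      (ij.2 == ij.1.+1) || (ij == (1, n))]%N.

(* The vertex k of {1, ..., n} is encoded as the ordinal of value k - 1. *)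
Definition cycle_adj n : rel 'I_n := fun i j =>
  cycle_edge n (i.+1, j.+1) || cycle_edge n (j.+1, i.+1).

Lemma cycle_adj_sym n : symmetric (@cycle_adj n).
Proof. by move=> i j; rewrite /cycle_adj orbC. Qed.

Lemma cycle_adj_irr n : irreflexive (@cycle_adj n).
Proof. by move=> i; rewrite /cycle_adj orbb /cycle_edge /= ltnn. Qed.

Definition cycle_graph n : sgraph n := SGraph (@cycle_adj_sym n) (@cycle_adj_irr n).

(* a = (1 2 ... n) and b = (2 n)(3 n-1)... on the labels 1, ..., n *)
Definition rot_a (n i : nat) : nat := if i == n then 1%N else i.+1.
Definition refl_b (n i : nat) : nat := if i == 1%N then 1%N else (n + 2 - i)%N.

(* The braids to which i_star is applied below lie in its domain, and those
   used for psi_a and psi_b have the permutations a and b. *)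
Section Domain.
Variables (R : realType) (n : nat) (x : line_point R n) (cw : bool).
Local Open Scope nat_scope.

Lemma perm_sigma i : braid_perm (sigma x cw i) = adj_tperm n i.
Proof. exact: braid_permE. Qed.

Lemma adj_lab i (k : 'I_n) : 0 < i < n -> (adj_tperm n i k).+1 =
  if k.+1 == i then i.+1 else if k.+1 == i.+1 then i else k.+1.
Proof.
move=> /andP[i0 i1]; rewrite /adj_tperm; case: insubP => [j _ ej|]; last by lia.
case: insubP => [m _ em|]; last by lia.
case: tpermP => [->|->|/eqP kj /eqP km].
- by rewrite em ej prednK // eqxx.
- by rewrite em ej prednK // gtn_eqF // eqxx.
have := kj; have := km; rewrite -!val_eqE /= em ej => ? ?.
by rewrite ifF ?ifF //; apply/eqP; lia.
Qed.

Definition alab i j p := if p == j then i else if i <= p < j then p.+1 else p.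

Lemma a_lab i j (k : 'I_n) : 0 < i <= j -> j <= n ->
  (braid_perm (a_elt x cw i j) k).+1 = alab i j k.+1.
Proof.
move=> /andP[i0 ij]; rewrite /a_elt -(subnKC ij) addKn; move: (j - i) => m {j ij}.
rewrite braid_perm_prod; elim: m k => [|m IH] k jn.
  by rewrite big_nil perm1 /alab; do ![case: ifP => //]; lia.
rewrite -[m.+1]addn1 iotaD rev_cat big_cons permM IH; last by lia.
rewrite perm_sigma adj_lab; last by lia.
rewrite /alab; do ![case: ifP => //]; try lia.
Qed.

Definition elab (k l p : nat) := if p == k then l else if p == l then k else p.

Lemma e_lab i j (k : 'I_n) : 0 < i < j -> j <= n ->
  (braid_perm (e_elt x cw i j) k).+1 = elab i j k.+1.
Proof.
move=> ij jn; rewrite /e_elt braid_permM braid_permV permM.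
set q := braid_perm (a_elt x cw i.+1 j).
set z := (_ k); have hz : z.+1 = alab i j k.+1 by rewrite a_lab //; lia.
set w := (q^-1)%g z; have hw : alab i.+1 j w.+1 = z.+1.
  by rewrite -a_lab ?permKV //; lia.
move: hw; rewrite hz /alab /elab; do ![case: ifP => //]; lia.
Qed.

Lemma s_dom i j : braid_perm (s_elt x cw i j) = 1%g.
Proof.
have pK : (braid_perm (sigma x cw i ^+ 2) = 1)%g.
  rewrite (braid_permM (sigma x cw i) (sigma x cw i)) perm_sigma.
  by apply/permP => k; rewrite permM adj_tpermK perm1.
rewrite /s_elt 2!braid_permM pK mulg1 !braid_perm_prod.
elim: (iota _ _) => [|k r IH]; first by rewrite !big_nil mulg1.
rewrite rev_cons -cats1 big_cat /= big_seq1 big_cons braid_permV.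
by rewrite mulgA mulgK.
Qed.

Lemma psi_a_lab (k : 'I_n) : (braid_perm (a_elt x cw 1 n) k).+1 = rot_a n k.+1.
Proof.
have kn := ltn_ord k; rewrite a_lab //; last by lia.
by rewrite /alab /rot_a; do ![case: ifP => //]; lia.
Qed.

Lemma psi_b_lab (k : 'I_n) : 3 < n ->
  (braid_perm (\prod_(2 <= k < (uphalf n).+1) e_elt x cw k (n + 2 - k))%g k).+1 =
  refl_b n k.+1.
Proof.
move=> n3; have kn := ltn_ord k; rewrite braid_perm_prod.
suff H m : 2 <= m <= (uphalf n).+1 ->
    ((\prod_(2 <= k < m) braid_perm (e_elt x cw k (n + 2 - k)))%g k).+1 =
    if (2 <= k.+1 < m) || (2 <= n + 2 - k.+1 < m) then n + 2 - k.+1 else k.+1.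
  rewrite H; last by lia.
  by rewrite /refl_b; do ![case: ifP => //]; lia.
elim: m => // m IH; have [m1|m1] := leqP m 1.
  by rewrite big_geq ?perm1; [case: ifP => //; lia|lia].
move=> mn; rewrite big_nat_recr //= permM e_lab; [|lia..].
rewrite IH; last by lia.
by rewrite /elab; do ![case: ifP => //]; lia.
Qed.

Lemma cyc_aut (p : 'S_n) (f : nat -> nat) : (forall k, (p k).+1 = f k.+1) ->
  (forall i j, 0 < i <= n -> 0 < j <= n ->
     cycle_edge n (f i, f j) || cycle_edge n (f j, f i) = 
     cycle_edge n (i, j) || cycle_edge n (j, i)) -> p \in graph_aut (cycle_graph n).
Proof.
move=> pf h; apply/graph_autP => i j /=; rewrite /cycle_adj !pf.
by apply: h; rewrite ltn_ord.
Qed.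

Lemma psi_a_dom : 3 < n -> braid_perm (a_elt x cw 1 n) \in graph_aut (cycle_graph n).
Proof.
move=> n3; apply: (cyc_aut psi_a_lab) => i j hi hj.
rewrite /rot_a /cycle_edge !xpair_eqE /=; do ![case: ifP => //]; lia.
Qed.

Lemma psi_b_dom : 3 < n ->
  braid_perm (\prod_(2 <= k < (uphalf n).+1) e_elt x cw k (n + 2 - k))%g
    \in graph_aut (cycle_graph n).
Proof.
move=> n3; apply: (cyc_aut (fun k => psi_b_lab k n3)) => i j hi hj.
rewrite /refl_b /cycle_edge !xpair_eqE /=; do ![case: ifP => //]; lia.
Qed.
End Domain.

Inductive cycle_gen (n : nat) :=
| GenS of {ij : nat * nat | cycle_edge n ij}
| GenA
| GenB.

Section CycleGroup.
Variables (R : realType) (n : nat) (x : line_point R n) (cw : bool).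

Definition psi_a : braid_group (cycle_graph n) (line_base x) :=
  i_star (cycle_graph n) (a_elt x cw 1 n).

(* r(n) = uphalf n and s(n) = n + 2 - r(n) *)
Definition psi_b : braid_group (cycle_graph n) (line_base x) :=
  i_star (cycle_graph n) (\prod_(2 <= k < (uphalf n).+1) e_elt x cw k (n + 2 - k))%g.

Definition cycle_gen_val (g : cycle_gen n) : braid_group (cycle_graph n) (line_base x) :=
  match g with
  | GenS e => i_star (cycle_graph n) (s_elt x cw (val e).1 (val e).2)
  | GenA => psi_a
  | GenB => psi_b
  end.

End CycleGroup.

Section CycleRelations.
Variable n : nat.

Definition wA : word (cycle_gen n) := [:: (GenA n, false)].
Definition wB : word (cycle_gen n) := [:: (GenB n, false)].

(* The letter s_{i,j}.  When ij is not an edge of C_n this is the empty word;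
   for n > 3 this case does not occur in cycle_rel. *)
Definition wS (i j : nat) : word (cycle_gen n) :=
  if insub (i, j) is Some e then [:: (GenS e, false)] else [::].

Local Notation a := (rot_a n).
Local Notation b := (refl_b n).
Local Open Scope nat_scope.

Inductive cycle_rel : word (cycle_gen n) -> word (cycle_gen n) -> Prop :=
| R1 i j k l : cycle_edge n (i, j) -> cycle_edge n (k, l) ->
    cycle_rel (wS i j ++ wS k l) (wS k l ++ wS i j)
| R2a_succ i : 1 <= i < n - 1 ->
    cycle_rel (word_inv wA ++ wS i i.+1 ++ wA) (wS (a i) (a i.+1))
| R2a_1n :
    cycle_rel (word_inv wA ++ wS 1 n ++ wA) (wS (a n) (a 1))
| R2a_last :
    cycle_rel (word_inv wA ++ wS (n - 1) n ++ wA) (wS (a n) (a (n - 1)))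
| R2b_succ i : 1 < i <= n - 1 ->
    cycle_rel (word_inv wB ++ wS i i.+1 ++ wB) (wS (b i.+1) (b i))
| R2b_12 :
    cycle_rel (word_inv wB ++ wS 1 2 ++ wB) (wS (b 1) (b 2))
| R2b_1n :
    cycle_rel (word_inv wB ++ wS 1 n ++ wB) (wS (b 1) (b n))
| R3_a :
    cycle_rel (flatten (nseq n wA))
              (wS 1 n ++ flatten [seq wS i i.+1 | i <- rev (iota 1 (n - 1))])
| R3_b_even : ~~ odd n ->
    cycle_rel (wB ++ wB) [::]
| R3_b_odd : odd n ->
    cycle_rel (wB ++ wB) (wS ((n + 1) %/ 2) ((n + 3) %/ 2))
| R3_ba_even : ~~ odd n ->
    cycle_rel (wB ++ wA ++ wB ++ wA)
              (wS 1 2 ++ wS ((n + 2) %/ 2) ((n + 4) %/ 2))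
| R3_ba_odd : odd n ->
    cycle_rel (wB ++ wA ++ wB ++ wA)
              (wS 1 2 ++ wS ((n + 1) %/ 2) ((n + 3) %/ 2)
                      ++ wS ((n + 3) %/ 2) ((n + 5) %/ 2)).

End CycleRelations.

(* Main.v *)
(* An element of B(C_n) is determined by its permutation together with the
   number of half turns that strand j makes around strand k, for each edge jk
   of C_n.  These numbers form a crossed homomorphism, so the relations become
   identities in Z^n extended by the dihedral group, and every word can be
   rewritten as s * psi(a)^i * psi(b)^j with s a word in the s_{i,j}, i < n and
   j < 2.

   The point is injectivity: a pure braid with no turning along the edges is
   trivial.  Up to translation and scaling it is a loop of n - 1 nonzero numbers
   u_j with sum 1, each with a continuous argument y_j which is a loop at 0.
   At each time some cos y_j is positive, and the loop can be deformed to one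
   that depends on the arguments only, through a formula that makes sense as
   long as some cos y_j is positive.  So one has to contract a loop of R^(n-1)
   that avoids the translates by (2 pi Z)^(n-1) of the cube [pi/2, 3pi/2]^(n-1),
   and this is possible because n - 1 >= 3. *)

Require Import Defs.
From HB Require Import structures.
From mathcomp Require Import all_boot all_order all_algebra all_fingroup.
From mathcomp Require Import generic_quotient complex.
From mathcomp Require Import boolp classical_sets functions reals topology.
From mathcomp Require Import interval_inference sequences.
From mathcomp Require Import normedtype trigo.
From mathcomp Require Import zify ring lra.

Set Implicit Arguments.
Unset Strict Implicit.
Unset Printing Implicit Defensive.

Import Order.TTheory GRing.Theory Num.Theory numFieldNormedType.Exports.

Local Open Scope classical_set_scope.
Local Open Scope ring_scope.

(** Successive differences turn [F(C, C_n)] into independent data: a position, a nonzero scale [c]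
    and [n - 1] nonzero numbers of sum 1. The sum is the only obstacle to replacing these numbers by
    their arguments. What it leaves on the level of angles is that not all cosines are [<= 0], and
    conversely any angles with a positive cosine among them can be realised by numbers of sum 1 that
    depend continuously on the angles. The bound [n > 3] enters only through the space of such
    angles. For [n = 3] it is a plane with a lattice of square holes, whose fundamental group is
    free, in accordance with [B(C_3) = B_3], where the pure braids do not commute. With three angles
    there is room: at any time one angle can be tied to a multiple of [2 pi], and if it is the
    distinguished angle, two others remain that move in turn, so that one of them always rests at a
    multiple of [2 pi]. *)

Lemma lebesgue_number (R : realType) (T : pseudoMetricType R) (K : set T)
    (V : Type) (Q : V -> T -> Prop) :
    compact K -> (forall x, K x -> exists v, \forall y \near x, Q v y) ->
  exists N : nat, forall x, K x ->
    exists v, forall y, ball x (N.+1%:R^-1 : R) y -> Q v y.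
Proof.
move=> /compact_near_coveringP cK hQ.
have [] := cK nat \oo
  (fun N x => exists v, forall y, ball x (N.+1%:R^-1 : R) y -> Q v y) _.
  move=> x /hQ [v /nbhs_ballP [e /= e0 he]].
  (* One half of the radius [e] is spent on the distance from [x] to [y], the other half covers the
     ball around [y]. *)
  exists (ball x (e / 2), [set N | N.+1%:R^-1 < e / 2]).
    split; first exact/nbhsx_ballx/divr_gt0.
    have e20 : 0 < e / 2 by exact: divr_gt0.
    exact: (near_infty_natSinv_lt (PosNum e20)).
  move=> [y N] [/= yB Ne]; exists v => z zB; apply: he.
  by apply: (@ball_split _ _ y) => //; apply: le_ball zB; exact: ltW.
by move=> N _ /(_ N (leqnn N)) hN; exists N => x /hN.
Qed.

(** * Complex numbers up to positive factors *)

Section Complex.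
Variable R : realType.
Implicit Types (z w : Cplx R) (r s t : R).

Lemma embC0 : embC (0 : R) = 0. Proof. by []. Qed.
Lemma embC1 : embC (1 : R) = 1. Proof. by []. Qed.
Lemma embCD r s : embC (r + s) = embC r + embC s.
Proof. exact: (raddfD (real_complex R)). Qed.
Lemma embCB r s : embC (r - s) = embC r - embC s.
Proof. exact: (raddfB (real_complex R)). Qed.
Lemma embCM r s : embC (r * s) = embC r * embC s.
Proof. exact: (rmorphM (real_complex R)). Qed.
Lemma embCV r : embC r^-1 = (embC r)^-1.
Proof. exact: (fmorphV (real_complex R)). Qed.
Lemma embC_eq0 r : (embC r == 0) = (r == 0).
Proof. by rewrite /embC eq_complex /= eqxx andbT. Qed.
Lemma embC_sum (I : Type) (l : seq I) (P : pred I) (F : I -> R) :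
  embC (\sum_(i <- l | P i) F i) = \sum_(i <- l | P i) embC (F i).
Proof. exact: (raddf_sum (real_complex R)). Qed.

Definition cRe z : R := complex.Re z.
Definition cIm z : R := complex.Im z.

Lemma cplx_eqP z w : cRe z = cRe w -> cIm z = cIm w -> z = w.
Proof. by case: z w => a b [c d]; rewrite /cRe /cIm /= => -> ->. Qed.

Lemma cReD z w : cRe (z + w) = cRe z + cRe w. Proof. exact: raddfD. Qed.
Lemma cImD z w : cIm (z + w) = cIm z + cIm w. Proof. exact: raddfD. Qed.
Lemma cReN z : cRe (- z) = - cRe z. Proof. exact: raddfN. Qed.
Lemma cImN z : cIm (- z) = - cIm z. Proof. exact: raddfN. Qed.
Lemma cReM z w : cRe (z * w) = cRe z * cRe w - cIm z * cIm w.
Proof. by case: z w => a b [c d]. Qed.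
Lemma cImM z w : cIm (z * w) = cRe z * cIm w + cIm z * cRe w.
Proof. by case: z w => a b [c d]. Qed.
Lemma cRe_embC r : cRe (embC r) = r. Proof. by []. Qed.
Lemma cIm_embC r : cIm (embC r) = 0. Proof. by []. Qed.
Lemma cRe_cis t : cRe (cis t) = cos t. Proof. by []. Qed.
Lemma cIm_cis t : cIm (cis t) = sin t. Proof. by []. Qed.
Lemma cRe_sum (I : Type) (l : seq I) (P : pred I) (F : I -> Cplx R) :
  cRe (\sum_(i <- l | P i) F i) = \sum_(i <- l | P i) cRe (F i).
Proof. exact: raddf_sum. Qed.

Definition cplx_simp := (cReD, cImD, cReN, cImN, cReM, cImM, cRe_embC, cIm_embC,
  cRe_cis, cIm_cis).

Lemma cis0 : cis (0 : R) = 1.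
Proof. by rewrite /cis cos0 sin0. Qed.

Lemma cisD s t : cis (s + t) = cis s * cis t.
Proof. by apply: cplx_eqP; rewrite !cplx_simp ?cosD ?sinD //; ring. Qed.

Lemma cisN t : cis (- t) * cis t = 1.
Proof. by rewrite -cisD addNr cis0. Qed.

Lemma cis_neq0 t : cis t != 0.
Proof. by apply: contra_eq_neq (cisN t) => ->; rewrite mulr0 eq_sym oner_neq0. Qed.

Lemma continuous_cRe : continuous cRe.
Proof.
move=> z; apply/(@cvgrPdist_lt R R (Cplx R) (nbhs z) (nbhs_filter z)) => e e0.
near=> w.
apply: (@le_lt_trans _ _ (Num.sqrt (cRe (z - w) ^+ 2 + cIm (z - w) ^+ 2))).
  rewrite -cReN -cReD -[X in X <= _]sqrtr_sqr ler_sqrt.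
    by rewrite lerDl sqr_ge0.
  by rewrite addr_ge0 ?sqr_ge0.
rewrite -ltcR -normc_def; near: w.
apply: (@cvgr_dist_lt _ _ _ _ _ _ z); last by rewrite ltcR.
exact: cvg_id.
Unshelve. all: by end_near.
Qed.

Lemma continuous_cIm : continuous cIm.
Proof.
have -> : cIm = (fun z => cRe (- ('i%C : Cplx R) * z)).
  by apply/funext => -[a b]; rewrite !cplx_simp /cRe /cIm /=; ring.
apply: continuous_comp_fun continuous_cRe.
by apply: continuous_mul; [exact: cst_continuous|exact: continuous_id].
Qed.

(** Equality of arguments, expressed without choosing a branch of the logarithm. *)
Definition ray z w : Prop := exists2 r : R, 0 < r & z = embC r * w.

Lemma ray_refl z : ray z z.
Proof. by exists 1; rewrite ?embC1 ?mul1r. Qed.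

Lemma ray_sym z w : ray z w -> ray w z.
Proof.
move=> [r r0 ->]; exists r^-1; first by rewrite invr_gt0.
by rewrite mulrA -embCM mulVf ?gt_eqF // mul1r.
Qed.

Lemma ray_trans z w v : ray z w -> ray w v -> ray z v.
Proof.
move=> [r r0 ->] [s s0 ->]; exists (r * s); first exact: mulr_gt0.
by rewrite embCM mulrA.
Qed.

Lemma rayM z w z' w' : ray z w -> ray z' w' -> ray (z * z') (w * w').
Proof.
move=> [r r0 ->] [s s0 ->]; exists (r * s); first exact: mulr_gt0.
by rewrite embCM mulrACA.
Qed.

Lemma ray_cancel z w v : v != 0 -> ray (v * z) (v * w) -> ray z w.
Proof.
move=> v0 [r r0 e]; exists r => //; apply: (mulfI v0); rewrite e; ring.
Qed.

Lemma ray_cis s t : ray (cis s) (cis t) -> cos (s - t) = 1.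
Proof.
move=> [r r0 e]; have e1 := congr1 cRe e; have e2 := congr1 cIm e.
move: e1 e2; rewrite !cplx_simp !mul0r subr0 addr0 => e1 e2.
have cs := cos2Dsin2 s; have ct := cos2Dsin2 t.
rewrite cosB e1 e2; suff -> : r = 1 by rewrite !mul1r -!expr2.
(* Both sides have modulus 1, hence [r ^+ 2 = 1]. *)
have : (r - 1) * (r + 1) = 0 by rewrite e1 e2 in cs; nra.
by move/eqP; rewrite mulf_eq0 => /orP [] /eqP; lra.
Qed.

(** The principal argument on the open right half plane, where it is also continuous. *)
Definition arg z : R := atan (cIm z / cRe z).

Lemma ray_arg z : 0 < cRe z -> ray z (cis (arg z)).
Proof.
move=> z0; set t := arg z.
have ct : 0 < cos t by apply: cos_gt0_pihalf; rewrite atan_gtNpi2 atan_ltpi2.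
exists (cRe z / cos t); first exact: divr_gt0.
have tt : sin t / cos t = cIm z / cRe z by rewrite -[LHS]/(tan t) atanK.
apply: cplx_eqP; rewrite !cplx_simp !mul0r ?subr0 ?addr0 ?divfK ?gt_eqF //.
by rewrite mulrAC -mulrA tt mulrC divfK ?gt_eqF.
Qed.

Lemma arg_real z : cIm z = 0 -> arg z = 0.
Proof. by rewrite /arg => ->; rewrite mul0r atan0. Qed.

Lemma continuous_arg z : 0 < cRe z -> {for z, continuous arg}.
Proof.
move=> z0; apply: (@continuous_comp _ _ _ (fun z => cIm z / cRe z) (@atan R)).
  by apply: (cvgM (@continuous_cIm z)); apply: (cvgV _ (@continuous_cRe z)); rewrite gt_eqF.
exact: continuous_atan.
Qed.

(** The sector has opening [pi / 2], so the arguments of two of its points differ by less than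
    [pi / 2]. *)
Lemma cplx_div_sector z w : `|cIm z| < cRe z -> `|cIm w| < cRe w -> 0 < cRe (z / w).
Proof.
move=> hz hw; have w0 : w != 0.
  by apply: contraTneq hw => ->; rewrite /= normr0 ltxx.
have := divfK w0 z; set q := z / w => e.
move: hz; rewrite -e !cplx_simp.
set a := cRe q; set b := cIm q; set c := cRe w in hw *; set d := cIm w in hw *.
rewrite !ltr_norml in hw * => /andP[h1 h2]; move/andP: hw => [h3 h4].
nra.
Qed.

End Complex.

(** * Continuous arguments *)

Section Lift.
Variable R : realType.
Implicit Types (f g : R -> Cplx R) (w : R) (th : R -> R).

Lemma continuous_sum (K : numFieldType) (T : topologicalType) (I : Type)
    (l : seq I) (P : pred I) (F : I -> T -> K) :
  (forall i, P i -> continuous (F i)) ->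
  continuous (fun x => \sum_(i <- l | P i) F i x).
Proof.
move=> cF; elim: l => [|i l IH].
  under eq_fun do rewrite big_nil; exact: cst_continuous.
case Pi: (P i); under eq_fun do rewrite big_cons Pi; last by [].
by apply: continuous_add; [exact: cF|].
Qed.

Lemma continuous_div (K : numFieldType) (T : topologicalType) (f g : T -> K) :
  continuous f -> continuous g -> (forall x, g x != 0) ->
  continuous (fun x => f x / g x).
Proof. by move=> cf cg g0 x; apply: (cvgM (cf x)); exact: (cvgV (g0 x) (cg x)). Qed.

Lemma continuous_norm_fun (T : topologicalType) (f : T -> R) :
  continuous f -> continuous (fun x => `|f x|).
Proof. by move=> cf; exact: (continuous_comp_fun cf (@norm_continuous R R^o)). Qed.

Lemma square_clamp2 (p : R * R) : square R (clamp2 p).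
Proof. by split; exact: clamp_in. Qed.

Lemma clamp2_id (p : R * R) : square R p -> clamp2 p = p.
Proof. by case: p => s t [/= ]; rewrite !in_itv /= => hs ht; rewrite /clamp2 /= !clamp_id. Qed.

Lemma near_same_sector (T : topologicalType) (g : T -> Cplx R) (p : T) :
  continuous g -> g p != 0 ->
  \forall q \near p, `|cIm (g q / g p)| < cRe (g q / g p).
Proof.
move=> cg g0; pose phi q := cRe (g q / g p) - `|cIm (g q / g p)|.
have cq : continuous (fun q => g q / g p).
  by apply: continuous_mul; [exact: cg|exact: cst_continuous].
have cphi : continuous phi.
  apply: continuous_add; first exact: (continuous_comp_fun cq (@continuous_cRe R)).
  apply: continuous_opp; apply: continuous_norm_fun.
  exact: (continuous_comp_fun cq (@continuous_cIm R)).
have p1 : 0 < phi p.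
  by rewrite /phi divff // -embC1 cRe_embC cIm_embC normr0 subr0 ltr01.
near=> q; rewrite -subr_gt0; near: q.
exact: (cvgr_gt (phi p) (cphi p)).
Unshelve. all: by end_near.
Qed.

(* The argument of f p is the sum of the principal arguments of the ratios
   f ((k + 1) p / M) / f (k p / M), which lie in the right half plane for M
   large. *)
Lemma lift_square (f : R * R -> Cplx R) :
    {within square R, continuous f} -> (forall p, square R p -> f p != 0) ->
  exists2 th : R * R -> R, continuous th &
    forall p, square R p -> ray (f p) (f (0, 0) * cis (th p)).
Proof.
move=> /within_squareP cf f0; set g := f \o @clamp2 R.
have g0 p : g p != 0 by apply/f0/square_clamp2.
have cg : continuous g by [].
pose Q (v : Cplx R) (p : R * R) := `|cIm (g p / v)| < cRe (g p / v).
have ksq : compact (square R) by apply: compact_setX; exact: segment_compact.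
have nearQ (p : R * R) : \forall y \near p, Q (g p) y by exact: near_same_sector.
have [|N hN] := @lebesgue_number R _ (square R) _ Q ksq.
  by move=> p _; exists (g p); exact: nearQ.
(* The mesh [1 / M] is strictly below the radius [1 / N.+1], so [sc k.+1 p] lies in the open ball
   around [sc k p]. *)
pose M := N.+2; pose sc (k : nat) (p : R * R) := (k%:R / M%:R * p.1, k%:R / M%:R * p.2).
have M0 : 0 < M%:R :> R by rewrite ltr0n.
have sc1 k (x : R) : (k <= M)%N -> 0 <= x <= 1 -> 0 <= k%:R / M%:R * x <= 1.
  move=> kM x01; have : 0 <= (k%:R / M%:R : R) <= 1.
    by rewrite divr_ge0 //= ler_pdivrMr // mul1r ler_nat.
  by nra.
have scsq k p : (k <= M)%N -> square R p -> square R (sc k p).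
  by move=> kM [/=]; rewrite !in_itv /= => h1 h2; split; rewrite /= in_itv /= sc1.
have scS k (x : R) : 0 <= x <= 1 ->
    `|k%:R / M%:R * x - k.+1%:R / M%:R * x| < N.+1%:R^-1.
  move=> /andP[x0 x1].
  rewrite -mulrBl -mulrBl -natr1 opprD addrA subrr sub0r mulN1r mulNr normrN.
  rewrite ger0_norm ?mulr_ge0 ?invr_ge0 ?ler0n //.
  apply: (@le_lt_trans _ _ M%:R^-1); first by rewrite ler_piMr // invr_ge0 ler0n.
  by rewrite ltf_pV2 ?posrE ?ltr0n // ltr_nat.
have ratio k p : (k < M)%N -> square R p -> 0 < cRe (g (sc k.+1 p) / g (sc k p)).
  move=> kM pS; have [v hv] := hN _ (scsq k p (ltnW kM) pS).
  have hQ1 : Q v (sc k p) by apply: hv; exact: ballxx.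
  have hQ2 : Q v (sc k.+1 p).
    apply: hv; case: pS => /=; rewrite !in_itv /= => h1 h2.
    by split; rewrite /ball /=; exact: scS.
  have v0 : v != 0.
    by apply: contraTneq hQ1 => ->; rewrite /Q invr0 mulr0 -embC0 cRe_embC cIm_embC normr0 ltxx.
  have -> : g (sc k.+1 p) / g (sc k p) = (g (sc k.+1 p) / v) / (g (sc k p) / v).
    by rewrite invf_div mulrA divfK.
  exact: cplx_div_sector.
pose th p := \sum_(k < M) arg (g (sc k.+1 (clamp2 p)) / g (sc k (clamp2 p))).
have csc k : continuous (fun p => g (sc k (clamp2 p))).
  apply: (@continuous_comp_fun _ _ _ (fun p => sc k (clamp2 p)) g) => //.
  apply: (@continuous_comp_fun _ _ _ (@clamp2 R) (sc k)); first exact: continuous_clamp2.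
  apply: continuous_pair; apply: continuous_mul; try exact: cst_continuous.
    exact: continuous_fst.
  exact: continuous_snd.
exists th.
  apply: continuous_sum => k _ p.
  apply: (@continuous_comp _ _ _ (fun p => g (sc k.+1 (clamp2 p)) / g (sc k (clamp2 p))) (@arg R)).
    by apply: (continuous_div (csc k.+1) (csc k)).
  by apply: continuous_arg; apply: ratio => //; exact: square_clamp2.
move=> p pS; have cp := clamp2_id pS.
have H k : (k <= M)%N -> ray (g (sc k p))
    (g (sc 0 p) * cis (\sum_(0 <= j < k) arg (g (sc j.+1 p) / g (sc j p)))).
  elim: k => [|k IH] kM; first by rewrite big_geq // cis0 mulr1; exact: ray_refl.
  rewrite big_nat_recr //= cisD mulrA.
  rewrite -[X in ray X _](divfK (g0 (sc k p))) [X in ray X _]mulrC.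
  by apply: rayM; [exact/IH/ltnW|apply: ray_arg; exact: ratio].
have := H M (leqnn _); rewrite big_mkord.
have -> : sc 0 p = (0, 0) by rewrite /sc !mul0r.
have -> : sc M p = p by rewrite /sc divff ?gt_eqF // !mul1r; case: (p).
by rewrite /th cp /g /= cp clamp2_id // ; split; rewrite /= in_itv /= lexx ler01.
Qed.

(** If [d 1] were not 0, then [|d|] would take the value [min(|d 1|, pi)] by the intermediate value
    theorem; it lies in []0, pi]], where the cosine is less than 1. *)
Lemma cos1_const (d : R -> R) : continuous d ->
  (forall s, 0 <= s <= 1 -> cos (d s) = 1) -> d 0 = 0 -> d 1 = 0.
Proof.
move=> cd d1 d0; apply/eqP/negPn/negP => dn0.
pose e s := `|d s|; have ce : continuous e by exact: continuous_norm_fun.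
have e1 : 0 < e 1 by rewrite normr_gt0.
have pi0 := pi_gt0 R.
have cose s : 0 <= s <= 1 -> cos (e s) = 1.
  by move=> s01; rewrite /e; case: ger0P => _; rewrite ?cosN d1.
have [] := @IVT R e 0 1 (Num.min (e 1) pi) ler01.
- exact: continuous_subspaceT.
- have e0 : e 0 = 0 by rewrite /e d0 normr0.
  by rewrite e0 (min_l (ltW e1)) (max_r (ltW e1)) le_min ge_min lexx (ltW e1) (ltW pi0).
move=> s; rewrite in_itv /= => s01 es.
have := cose s s01; rewrite es -[RHS](@cos0 R) => /cos_inj.
rewrite !in_itv /= lexx ge_min lexx orbT le_min (ltW e1) (ltW pi0) => /(_ isT isT) h.
by have : 0 < Num.min (e 1) pi; [rewrite lt_min e1|rewrite h ltxx].
Qed.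

(** The total change of argument along [f]. It is a relation because existence requires [f] to be
    continuous without zeros on [[0, 1]]. *)
Definition turn f w := exists th,
  [/\ continuous th, th 0 = 0, th 1 = w &
      forall s, 0 <= s <= 1 -> ray (f s) (f 0 * cis (th s))].

Lemma turn_unique f w w' : f 0 != 0 -> turn f w -> turn f w' -> w = w'.
Proof.
move=> f0 [th [c0 t0 <- r]] [th' [c0' t0' <- r']]; apply/eqP; rewrite -subr_eq0; apply/eqP.
apply: (@cos1_const (fun s => th s - th' s)).
- by apply: continuous_add => //; exact: continuous_opp.
- move=> s s01; apply: ray_cis; apply: (ray_cancel f0).
  exact: ray_trans (ray_sym (r s s01)) (r' s s01).
- by rewrite t0 t0' subrr.
Qed.

Lemma ray_shift (z a b : Cplx R) (s t : R) : ray a (z * cis s) -> ray b (z * cis t) ->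
  ray a (b * cis (s - t)).
Proof.
move=> ra rb; apply: ray_trans ra _; have -> : z * cis s = z * cis t * cis (s - t).
  by rewrite -mulrA -cisD addrC subrK.
by apply: rayM; [exact: ray_sym|exact: ray_refl].
Qed.

Lemma turn_ex f : {within `[0, 1], continuous f} ->
  (forall s, 0 <= s <= 1 -> f s != 0) -> exists w, turn f w.
Proof.
move=> /within_itvP cf f0.
have [||th cth hth] := @lift_square (fun p => f p.1).
- apply/within_squareP.
  exact: (continuous_comp_fun (@continuous_fst _ _) cf).
- by move=> p [/= p0 _]; apply: f0; move: p0; rewrite in_itv.
have S0 s : 0 <= s <= 1 -> square R (s, 0) by split; rewrite /= in_itv /= ?lexx ?ler01.
exists (th (1, 0) - th (0, 0)), (fun s => th (s, 0) - th (0, 0)); split=> //.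
- apply: continuous_add; last exact: cst_continuous.
  apply: (@continuous_comp_fun _ _ _ (fun s => (s, 0)) th) => //.
  by apply: continuous_pair; [exact: continuous_id|exact: cst_continuous].
- by rewrite subrr.
- have i0 : 0 <= (0 : R) <= 1 by rewrite lexx ler01.
  move=> s s01; have /= := hth (0, 0) (S0 _ i0).
  by apply: ray_shift; exact: (hth (s, 0) (S0 _ s01)).
Qed.

(** A continuous argument on the square takes equal values at the two ends of a vertical side, by
    [turn_unique], since [h] is constant there. Hence it has the same increment along both
    horizontal sides. *)
Lemma turn_homotopy (h : R * R -> Cplx R) w :
    {within square R, continuous h} -> (forall p, square R p -> h p != 0) ->
    (forall t, 0 <= t <= 1 -> h (0, t) = h (0, 0)) ->
    (forall t, 0 <= t <= 1 -> h (1, t) = h (1, 0)) ->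
  turn (fun s => h (s, 0)) w -> turn (fun s => h (s, 1)) w.
Proof.
move=> ch h0 hl hr; have [th cth hth] := lift_square ch h0.
have sq s t : 0 <= s <= 1 -> 0 <= t <= 1 -> square R (s, t).
  by split; rewrite /= in_itv.
have i0 : 0 <= (0 : R) <= 1 by rewrite lexx ler01.
have i1 : 0 <= (1 : R) <= 1 by rewrite lexx ler01.
have cH t : continuous (fun s => th (s, t)).
  apply: (@continuous_comp_fun _ _ _ (fun s => (s, t)) th) => //.
  by apply: continuous_pair; [exact: continuous_id|exact: cst_continuous].
have cV s : continuous (fun t => th (s, t)).
  apply: (@continuous_comp_fun _ _ _ (fun t => (s, t)) th) => //.
  by apply: continuous_pair; [exact: cst_continuous|exact: continuous_id].
have turnH t : 0 <= t <= 1 -> turn (fun s => h (s, t)) (th (1, t) - th (0, t)).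
  move=> t01; exists (fun s => th (s, t) - th (0, t)); split=> //.
  - by apply: continuous_add; [exact: cH|exact: cst_continuous].
  - by rewrite subrr.
  - by move=> s s01; apply: ray_shift (hth _ (sq _ _ s01 t01)) (hth _ (sq _ _ i0 t01)).
have turnV s : 0 <= s <= 1 -> (forall t, 0 <= t <= 1 -> h (s, t) = h (s, 0)) ->
    th (s, 1) = th (s, 0).
  move=> s01 hs; apply/eqP; rewrite -subr_eq0; apply/eqP.
  apply: (@turn_unique (fun t => h (s, t))); first exact/h0/sq.
    exists (fun t => th (s, t) - th (s, 0)); split=> //.
    - by apply: continuous_add; [exact: cV|exact: cst_continuous].
    - by rewrite subrr.
    - by move=> t t01; apply: ray_shift (hth _ (sq _ _ s01 t01)) (hth _ (sq _ _ s01 i0)).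
  exists (fun=> 0); split=> //; first exact: cst_continuous.
  by move=> t t01; rewrite hs // cis0 mulr1; exact: ray_refl.
move=> /(turn_unique (h0 _ (sq _ _ i0 i0)) (turnH 0 i0)) <-.
by have := turnH 1 i1; rewrite !turnV.
Qed.

Lemma turn_cat f g w w' : f 1 = g 0 -> turn f w -> turn g w' ->
  turn (fun s => if s <= 2^-1 then f (2 * s) else g (2 * s - 1)) (w + w').
Proof.
move=> fg [th [c0 t0 t1 r]] [th' [c0' t0' t1' r']].
have cA (t : R -> R) (b : R) : continuous t -> continuous (fun s : R => t (clamp (2 * s + b))).
  move=> ct; apply: (@continuous_comp_fun _ _ _ (fun s : R => clamp (2 * s + b)) t) => //.
  exact: (continuous_comp_fun (@continuous_affine R 2 b) (@continuous_clamp R)).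
(* Clamping freezes [th'] at 0 during the first half and [th] at its final value during the second,
   so one formula serves on both. The summand 0 is there for the shape of [cA]. *)
exists (fun s => th (clamp (2 * s + 0)) + th' (clamp (2 * s + -1))); split.
- by apply: continuous_add; exact: cA.
- by rewrite !clamp_le0 ?t0 ?t0' ?addr0 //; lra.
- by rewrite !clamp_ge1 ?t1 ?t1' //; lra.
move=> s s01; rewrite mulr0; have h0 : (0 : R) <= 2^-1 by lra.
rewrite h0; case: ifP => s2.
  rewrite (@clamp_le0 _ (2 * s + -1)); last by lra.
  by rewrite t0' addr0 addr0 clamp_id; [apply: r|]; lra.
have s2' : 2^-1 < s by rewrite ltNge s2.
rewrite clamp_ge1; last by lra.
rewrite (@clamp_id _ (2 * s + -1)); last by lra.
rewrite cisD mulrA; apply: ray_trans (r' (2 * s - 1) _) _; first by lra.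
by apply: rayM; [rewrite -fg; apply: r; lra|exact: ray_refl].
Qed.

Lemma turn_eq f g w : (forall s, 0 <= s <= 1 -> f s = g s) -> turn f w -> turn g w.
Proof.
move=> fg [th [c0 t0 t1 r]]; exists th; split=> // s s01.
by rewrite -!fg ?lexx ?ler01 //; exact: r.
Qed.

Lemma turnN f w : turn f w -> turn (fun s => - f s) w.
Proof.
move=> [th [c0 t0 t1 r]]; exists th; split=> // s s01.
by have [k k0 e] := r s s01; exists k => //; rewrite e mulNr mulrN.
Qed.

(** The ratio [f s / f 0] stays in the right half plane, so its principal argument is a continuous
    argument; it vanishes at both ends, where the ratio is real. *)
Lemma turn_half_plane f (r : R) : {within `[0, 1], continuous f} -> r != 0 ->
  f 0 = embC r -> cIm (f 1) = 0 -> (forall s, 0 <= s <= 1 -> 0 < cRe (f s) * r) ->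
  turn f 0.
Proof.
move=> /within_itvP cf r0 f0 f1 fs.
have Re_div s : cRe (f s / f 0) = (cRe (f s) * r) / r ^+ 2.
  by rewrite f0 -embCV !cplx_simp mulr0 subr0; field.
have clR s : 0 < cRe (f (clamp s) / f 0).
  by rewrite Re_div divr_gt0 ?fs ?clamp_ge0 ?clamp_le1 // exprn_even_gt0.
exists (fun s => arg (f (clamp s) / f 0)); split.
- move=> s; apply: (@continuous_comp _ _ _ (fun s => f (clamp s) / f 0) (@arg R)).
    by apply: (cvgM (cf s)); exact: cvg_cst.
  exact: continuous_arg.
- rewrite clamp_le0 // divff ?arg_real //.
  by rewrite f0 embC_eq0.
- by rewrite clamp_ge1 // arg_real // f0 -embCV !cplx_simp f1 mulr0 mul0r addr0.
- move=> s s01; rewrite clamp_id // -[X in ray X _](divfK (_ : f 0 != 0)); last first.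
    by rewrite f0 embC_eq0.
  rewrite mulrC; apply: rayM; first exact: ray_refl.
  by apply: ray_arg; have := clR s; rewrite clamp_id.
Qed.

End Lift.

(** * Angles modulo 2 pi *)

Lemma cosD2pi_int (R : realType) (t : R) (z : int) : cos (t + (2 * pi) * z%:~R) = cos t.
Proof.
have pn (s : R) (m : nat) : cos (s + (2 * pi) * m%:R) = cos s.
  by rewrite mulr_natr mulr_natl periodicn //; exact: cosD2pi.
case: z => m; first exact: pn.
by rewrite NegzE mulrNz mulrN -[in RHS](subrK ((2 * pi) * m.+1%:R) t) pn.
Qed.

Lemma reduce_2pi (R : realType) (t : R) :
  exists z : int, `|t - (2 * pi) * z%:~R| <= pi.
Proof.
have pi0 := pi_gt0 R; have pi20 : 0 < 2 * pi :> R by exact: mulr_gt0.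
exists (Num.floor ((t + pi) / (2 * pi))); set z := Num.floor _.
have /andP[] := floor_itv ((t + pi) / (2 * pi)); rewrite -/z intrD.
rewrite ler_pdivlMr // ltr_pdivrMr // ler_norml => z1 z2.
by apply/andP; split; lra.
Qed.

Lemma cos_reduce_2pi (R : realType) (t : R) (z : int) :
  cos `|t - (2 * pi) * z%:~R| = cos t.
Proof.
have cosE (s : R) : cos `|s| = cos s by case: ger0P => _; rewrite ?cosN.
by rewrite cosE -mulrN -mulrNz cosD2pi_int.
Qed.

Lemma cos1_2pi_int (R : realType) (w : R) : cos w = 1 ->
  exists z : int, w = (2 * pi) * z%:~R.
Proof.
move=> cw; have pi0 := pi_gt0 R; have [z qpi] := reduce_2pi w; exists z.
have := cos_reduce_2pi w z; rewrite cw -[RHS](@cos0 R) => /cos_inj h.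
apply/eqP; rewrite -subr_eq0 -normr_eq0; apply/eqP; apply: h.
  by rewrite in_itv /= normr_ge0.
by rewrite in_itv /= lexx ltW.
Qed.

Lemma cos_gt0_2pi_int (R : realType) (w : R) : 0 < cos w ->
  exists z : int, `|w - (2 * pi) * z%:~R| < pi / 2.
Proof.
have pi0 := pi_gt0 R; have [z qpi] := reduce_2pi w.
rewrite -(cos_reduce_2pi w z) => cw; exists z; move: cw.
by rewrite -[X in X < _](@cos_pihalf R) ltr_cos // in_itv /= ?normr_ge0 //; lra.
Qed.

Lemma cos_gt0_near (R : realType) (w : R) (z : int) :
  `|w - (2 * pi) * z%:~R| < pi / 2 -> 0 < cos w.
Proof.
by rewrite -(cos_reduce_2pi w z) => h; apply: cos_gt0_pihalf; rewrite h andbT;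
   apply: lt_le_trans (normr_ge0 _); have := pi_gt0 R; lra.
Qed.

Lemma near_2pi_unique (R : realType) (w : R) (z z' : int) :
  `|w - (2 * pi) * z%:~R| < pi / 2 -> `|w - (2 * pi) * z'%:~R| < pi / 2 -> z = z'.
Proof.
have pi0 := pi_gt0 R; rewrite !ltr_norml => /andP[h1 h2] /andP[h3 h4].
have : `|(z - z')%:~R| < 1 :> R by rewrite ltr_norml intrB; apply/andP; split; nra.
rewrite -intr_norm ltrz1; lia.
Qed.

(** * Turning of one strand around another *)

Section Turning.
Variables (R : realType) (n : nat) (G : sgraph n) (x : base_point R n).
Implicit Types (a b : braid_path G x) (u v : braid_group G x) (j k : 'I_n).

Definition strand_diff a j k (s : R) : Cplx R := strand a j s - strand a k s.

Lemma strand_diff_neq0 a j k s : G j k -> 0 <= s <= 1 -> strand_diff a j k s != 0.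
Proof. by move=> jk s01; rewrite subr_eq0; exact: (strand_conf a s01). Qed.

Lemma strand_diff_cont a j k : {within `[0, 1], continuous (strand_diff a j k)}.
Proof.
apply/within_itvP; apply: continuous_add; first exact/within_itvP/strand_cont.
by apply: continuous_opp; exact/within_itvP/strand_cont.
Qed.

(** Measured in radians on a chosen representative. The value is meaningful for edges [jk], where
    any representative gives the same one; on other pairs the strands may meet. *)
Definition turning u j k : R := xget 0 [set w | turn (strand_diff (repr u) j k) w].

(** A homotopy keeps the strands of an edge apart and fixes their ends, so [turn_homotopy] applies
    to their difference. *)
Lemma turningP a j k : G j k -> turn (strand_diff a j k) (turning (braid_class a) j k).
Proof.
move=> jk; set b := repr (braid_class a).
have tb : turn (strand_diff b j k) (turning (braid_class a) j k).
  apply: (@xgetPex _ 0 [set w | turn (strand_diff b j k) w]).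
  apply: turn_ex; first exact: strand_diff_cont.
  by move=> s s01; exact: strand_diff_neq0.
have [h [hc h01 he hF]] := braid_repr a.
have i0 : 0 <= (0 : R) <= 1 by rewrite lexx ler01.
have i1 : 0 <= (1 : R) <= 1 by rewrite lexx ler01.
pose H p := h j p - h k p.
apply: (@turn_eq _ (fun s => H (s, 1))).
  move=> s s01; rewrite /H /strand_diff.
  by have [_ ->] := h01 j s s01; have [_ ->] := h01 k s s01.
apply: turn_homotopy.
- apply/within_squareP; apply: continuous_add; first exact/within_squareP.
  by apply: continuous_opp; exact/within_squareP.
- case=> s t [/= ]; rewrite !in_itv /= => s01 t01; rewrite subr_eq0.
  exact: hF.
- move=> t t01; rewrite /H.
  by have [-> _ _ _] := he j _ t01; have [-> _ _ _] := he k _ t01;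
     have [-> _ _ _] := he j _ i0; have [-> _ _ _] := he k _ i0.
- move=> t t01; rewrite /H.
  by have [_ _ -> _] := he j _ t01; have [_ _ -> _] := he k _ t01;
     have [_ _ -> _] := he j _ i0; have [_ _ -> _] := he k _ i0.
apply: turn_eq tb => s s01; rewrite /H /strand_diff.
by have [-> _] := h01 j s s01; have [-> _] := h01 k s s01.
Qed.

Lemma turningE a j k w : G j k -> turn (strand_diff a j k) w ->
  turning (braid_class a) j k = w.
Proof.
move=> jk; apply: turn_unique (turningP a jk).
by apply: strand_diff_neq0 => //; rewrite lexx ler01.
Qed.

Lemma adj_braid_perm u j k : G (braid_perm u j) (braid_perm u k) = G j k.
Proof. by move: (end_perm_aut (repr u)) => /graph_autP. Qed.

Lemma turningM u v j k : G j k ->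
  turning (u * v)%g j k = turning u j k + turning v (braid_perm u j) (braid_perm u k).
Proof.
move=> jk; rewrite -[in LHS](braid_classK u) -[in LHS](braid_classK v).
have -> : (braid_class (repr u) * braid_class (repr v))%g =
  braid_class (mul_path (repr u) (repr v)) by exact: mul_braidE.
apply: turningE => //.
have tu := turningP (repr u) jk; rewrite braid_classK in tu.
have jk' : G (braid_perm u j) (braid_perm u k) by rewrite adj_braid_perm.
have tv := turningP (repr v) jk'; rewrite braid_classK in tv.
apply: turn_eq (turn_cat _ tu tv).
  by move=> s s01; rewrite /strand_diff /= /mul_strand; case: ifP.
by rewrite /strand_diff !strand1 !strand0.
Qed.

Lemma turning1 j k : G j k -> turning 1%g j k = 0.
Proof.
move=> jk; apply: (addrI (turning 1%g j k)).
by have := turningM 1%g 1%g jk; rewrite braid_perm1 !perm1 mulg1 addr0.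
Qed.

Lemma turningV u j k : G j k ->
  turning u^-1%g j k =
  - turning u ((braid_perm u)^-1%g j) ((braid_perm u)^-1%g k).
Proof.
move=> jk; apply/eqP; rewrite -addr_eq0 -braid_permV -turningM //.
by rewrite mulVg turning1.
Qed.

Lemma turning_sym u j k : G j k -> turning u j k = turning u k j.
Proof.
move=> jk; have kj : G k j by rewrite adj_sym.
rewrite -(braid_classK u); apply: turningE => //.
apply: turn_eq (turnN (turningP (repr u) kj)) => s _.
by rewrite /strand_diff opprB.
Qed.

Lemma turning_pure u j k : G j k -> braid_perm u = 1%g ->
  exists z : int, turning u j k = (2 * pi) * z%:~R.
Proof.
move=> jk u1; have := turningP (repr u) jk; rewrite braid_classK.
set w := turning u j k => -[th [_ _ tw r]].
have i1 : 0 <= (1 : R) <= 1 by rewrite lexx ler01.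
have ct : cos w = 1.
  rewrite -[w]subr0; apply: ray_cis.
  apply: (@ray_cancel _ _ _ (strand_diff (repr u) j k 0)).
    by apply: strand_diff_neq0 => //; rewrite lexx ler01.
  rewrite -tw; apply: ray_trans (ray_sym (r 1 i1)) _.
  rewrite cis0 mulr1 /strand_diff !strand1 !strand0 -[end_perm _]/(braid_perm u) u1 !perm1.
  exact: ray_refl.
exact: cos1_2pi_int.
Qed.

End Turning.

Lemma turning_i_star (R : realType) n (G : sgraph n) (x : base_point R n)
    (u : artin_group x) (j k : 'I_n) : G j k -> braid_perm u \in graph_aut G ->
  turning (i_star G u) j k = turning u j k.
Proof.
move=> jk; have jk' : complete_graph n j k.
  by apply: contraTneq jk => /= ->; rewrite adj_irr.
rewrite -(braid_classK u) braid_permE => uG; rewrite i_star_class.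
apply: turningE => //.
exact: (turningP (repr u) jk').
Qed.

Lemma braid_perm_i_star (R : realType) n (G : sgraph n) (x : base_point R n)
    (u : artin_group x) : braid_perm u \in graph_aut G ->
  braid_perm (i_star G u) = braid_perm u.
Proof. by rewrite -(braid_classK u) braid_permE => uG; rewrite i_star_class braid_permE. Qed.

(** * Pure braids without turning are trivial *)

Section Configuration.
Variables (R : realType) (m : nat).
Hypothesis m_gt1 : (1 < m)%N.
Implicit Types (o c : Cplx R) (u : 'I_m -> Cplx R).

(* The positions of the strands, recovered from the first one, the difference c
   between the last and the first one, and the ratios u of the successive
   differences to c. *)
Definition config o c u (i : 'I_m.+1) : Cplx R :=
  o + c * \sum_(j < m | (j < i)%N) u j.

Definition vtx (j : 'I_m) : 'I_m.+1 := widen_ord (leqnSn m) j.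

Lemma config_step o c u (j : 'I_m) :
  config o c u (lift ord0 j) - config o c u (vtx j) = c * u j.
Proof.
rewrite /config opprD addrACA subrr add0r -mulrBr; congr (_ * _).
rewrite (bigD1 j) /= ?lift0 // -addrA [X in _ + X](_ : _ = 0) ?addr0 //.
apply/eqP; rewrite subr_eq0; apply/eqP; apply: eq_bigl => k.
by rewrite /bump /= -val_eqE /=; lia.
Qed.

Lemma config_span o c u :
  config o c u ord_max - config o c u ord0 = c * \sum_j u j.
Proof.
rewrite /config opprD addrACA subrr add0r -mulrBr; congr (_ * _).
rewrite [X in _ - X]big_pred0 // subr0; apply: eq_bigl => k.
by rewrite /= ltn_ord.
Qed.

(** The sum being 1, the edge [{1, n}] constrains only [c], and every other edge constrains a single
    [u j]. *)
Lemma config_cycle o c u : c != 0 -> (forall j, u j != 0) -> \sum_j u j = 1 ->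
  conf_space R (cycle_graph m.+1) (config o c u).
Proof.
move=> c0 u0 u1.
suff H (i k : 'I_m.+1) : cycle_edge m.+1 (i.+1, k.+1) -> config o c u i != config o c u k.
  by move=> i k /orP [/H //|/H]; rewrite eq_sym.
rewrite /cycle_edge /= => /andP[ik /andP[kn /orP[/eqP[ek]|]]].
  have jm : (i < m)%N by have := ltn_ord k; lia.
  have -> : i = vtx (Ordinal jm) by apply: val_inj.
  have -> : k = lift ord0 (Ordinal jm) by apply: val_inj; rewrite /= /bump /= ek.
  by rewrite eq_sym -subr_eq0 config_step mulf_neq0.
rewrite xpair_eqE => /andP[/eqP[i0] /eqP[km]].
have -> : i = ord0 by apply: val_inj.
have -> : k = ord_max by apply: val_inj.
by rewrite eq_sym -subr_eq0 config_span u1 mulr1.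
Qed.

Lemma config_of_points (z : 'I_m.+1 -> Cplx R) c i : c != 0 ->
  config (z ord0) c (fun j => (z (lift ord0 j) - z (vtx j)) / c) i = z i.
Proof.
move=> c0; rewrite /config -mulr_suml mulrC divfK //.
pose Z k := z (inord k).
transitivity (z ord0 + \sum_(j < m | (j < i)%N) (Z j.+1 - Z j)).
  congr (_ + _); apply: eq_bigr => j _; congr (z _ - z _); apply: val_inj => /=.
    by rewrite inordK ?ltnS //= /bump.
  by rewrite inordK // ltnW // ltnS.
rewrite -(big_ord_widen _ (fun j => Z j.+1 - Z j)); last by rewrite -ltnS.
rewrite -(big_mkord xpredT (fun j => Z j.+1 - Z j)) telescope_sumr //.
have -> : Z i = z i by rewrite /Z inord_val.
have -> : Z 0%N = z ord0 by rewrite /Z; congr z; apply: val_inj; rewrite /= inordK.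
by rewrite addrC subrK.
Qed.

Lemma sum_steps (z : 'I_m.+1 -> Cplx R) : z ord_max - z ord0 != 0 ->
  \sum_j ((z (lift ord0 j) - z (vtx j)) / (z ord_max - z ord0)) = 1.
Proof.
set c := z ord_max - z ord0 => c0; apply: (mulfI c0); rewrite mulr1.
by rewrite -(config_span (z ord0)) !config_of_points.
Qed.

Lemma continuous_config (T : topologicalType) (o c : T -> Cplx R)
    (u : 'I_m -> T -> Cplx R) i :
  continuous o -> continuous c -> (forall j, continuous (u j)) ->
  continuous (fun p => config (o p) (c p) (fun j => u j p) i).
Proof.
move=> cz cc cu; apply: continuous_add; first exact: cz.
apply: continuous_mul; first exact: cc.
by apply: continuous_sum => j _; exact: cu.
Qed.

Lemma continuous_normalize (T : topologicalType) (u : 'I_m -> T -> Cplx R) j :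
  (forall j, continuous (u j)) -> (forall p, \sum_k u k p != 0) ->
  continuous (fun p => u j p / \sum_k u k p).
Proof.
move=> cu u0; apply: continuous_div; [exact: cu| |exact: u0].
by apply: continuous_sum => k _; exact: cu.
Qed.

Lemma sum_normalize u : \sum_k u k != 0 -> \sum_j (u j / \sum_k u k) = 1.
Proof. by move=> u0; rewrite -mulr_suml divff. Qed.

End Configuration.

(** * Standard braids attached to loops of angles *)

Section Standard.
Variables (R : realType) (m : nat) (x : line_point R m.+1).
Hypothesis m_gt2 : (2 < m)%N.
Implicit Types (v : 'I_m -> R) (y : 'I_m -> R -> R).
Let base := line_base x.
Let c0 : R := x ord_max - x ord0.
Let C0 : Cplx R := embC c0.
Let X0 : Cplx R := embC (x ord0).

Definition base_step (j : 'I_m) : R := (x (lift ord0 j) - x (vtx j)) / c0.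

Lemma c0_gt0 : 0 < c0.
Proof. by rewrite subr_gt0; apply: line_pt_inc => /=; lia. Qed.

Lemma C0_neq0 : C0 != 0.
Proof. by rewrite embC_eq0 gt_eqF // c0_gt0. Qed.

Lemma base_step_gt0 j : 0 < base_step j.
Proof.
apply: divr_gt0 c0_gt0; rewrite subr_gt0; apply: line_pt_inc.
by rewrite /= /bump /=; lia.
Qed.

Lemma embC_base_step j : embC (base_step j) = (base (lift ord0 j) - base (vtx j)) / C0.
Proof. by rewrite /base_step embCM embCV embCB. Qed.

Lemma base_step_sum : \sum_j base_step j = 1.
Proof.
have e : C0 = base ord_max - base ord0 by exact: embCB.
have h := C0_neq0; rewrite e in h.
apply: (@complexI R); rewrite -[LHS]/(embC _) embC_sum; apply: etrans (sum_steps h).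
by apply: eq_bigr => j _; rewrite embC_base_step e.
Qed.

Lemma config_base i : config X0 C0 (fun j => embC (base_step j)) i = base i.
Proof.
rewrite -(config_of_points base i C0_neq0); congr (_ + _ * _).
by apply: eq_bigr => j _; rewrite embC_base_step.
Qed.

Definition cos_pos (t : R) : R := Num.max 0 (cos t).
Definition cos_mass v : R := \sum_j base_step j * cos_pos (v j).
(* The second term only moves the steps with 0 < cos (v j), and the first one
   has total real part at least - cos_mass v / 2: no step vanishes, nor does
   their sum. *)
Definition model v j : Cplx R :=
  embC (base_step j * cos_mass v / 2) * cis (v j) + embC (base_step j * cos_pos (v j)).
Definition norm_model v j : Cplx R := model v j / \sum_k model v k.

Lemma cos_pos_ge0 t : 0 <= cos_pos t. Proof. by rewrite le_max lexx. Qed.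

Lemma cos_pos_gt0 t : 0 < cos_pos t -> 0 < cos t.
Proof. by rewrite lt_max ltxx. Qed.

Lemma cos_mass_gt0 v : (exists k, 0 < cos (v k)) -> 0 < cos_mass v.
Proof.
case=> k ck; rewrite /cos_mass (bigD1 k) //= ltr_pwDl //.
  by rewrite mulr_gt0 ?base_step_gt0 // lt_max ck orbT.
by apply: sumr_ge0 => j _; rewrite mulr_ge0 ?cos_pos_ge0 // ltW ?base_step_gt0.
Qed.

(** A zero would force [sin t = 0] and [A * cos t = - B]. This contradicts [0 < cos t] if [0 < B],
    and gives [sin t = cos t = 0] if [B = 0]. Both [model] and its segments to the actual
    differences have this form. *)
Lemma embC_cis_neq0 (A B t : R) : 0 < A -> 0 <= B -> (0 < B -> 0 < cos t) ->
  embC A * cis t + embC B != 0.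
Proof.
move=> A0 B0 Bt; apply/eqP => e; have e1 := congr1 (@cRe R) e; have e2 := congr1 (@cIm R) e.
move: e1 e2; rewrite -embC0 !cplx_simp !mul0r subr0 !addr0 => e1 e2.
have st : sin t = 0 by move/eqP: e2; rewrite mulf_eq0 gt_eqF //= => /eqP.
have cs := cos2Dsin2 t; rewrite st expr0n addr0 in cs.
case: (ltrP 0 B) => B1; first by have := Bt B1; nra.
have B2 : B = 0 by lra.
rewrite B2 addr0 in e1; move/eqP: e1; rewrite mulf_eq0 gt_eqF //= => /eqP ct.
by move: cs; rewrite ct expr0n /= => /eqP; rewrite eq_sym oner_eq0.
Qed.

Lemma model_sum_Re v : 0 < cos_mass v -> 0 < cRe (\sum_k model v k).
Proof.
move=> Q0; rewrite cRe_sum.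
have stdRe k : cRe (model v k) = cos_mass v / 2 * (base_step k * cos (v k)) + base_step k * cos_pos (v k).
  by rewrite /model !cplx_simp; ring.
under eq_bigr do rewrite stdRe.
rewrite big_split /= -mulr_sumr -[X in _ + X]/(cos_mass v).
have : -1 <= \sum_k base_step k * cos (v k).
  rewrite -base_step_sum -sumrN; apply: ler_sum => k _.
  by have := cos_geN1 (v k); have := base_step_gt0 k; nra.
nra.
Qed.

(** At zero angles the mass is 1, so the two terms contribute [1 / 2] and 1. The common factor
    [3 / 2] disappears on normalizing, which yields the base point. *)
Lemma model0 v j : (forall k, v k = 0) -> model v j = embC (3 / 2 * base_step j).
Proof.
move=> v0; rewrite /model /cos_mass v0 cis0 mulr1 -embCD; congr embC.
have -> : \sum_k base_step k * cos_pos (v k) = 1.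
  by rewrite -base_step_sum; apply: eq_bigr => k _; rewrite v0 /cos_pos cos0 max_r ?mulr1.
by rewrite /cos_pos cos0 max_r //; lra.
Qed.

Lemma continuous_model (T : topologicalType) (v : T -> 'I_m -> R) j :
  (forall k, continuous (fun p => v p k)) -> continuous (fun p => model (v p) j).
Proof.
move=> cv.
have ccos k : continuous (fun p => cos_pos (v p k)).
  move=> p; apply: continuous_max; first exact: cst_continuous.
  exact: (continuous_comp_fun (cv k) (@continuous_cos R)).
have cmass : continuous (fun p => cos_mass (v p)).
  apply: continuous_sum => k _; apply: continuous_mul; first exact: cst_continuous.
  exact: ccos.
apply: continuous_add.
  apply: continuous_mul.
    apply: (@continuous_comp_fun _ _ _ (fun p => base_step j * cos_mass (v p) / 2) (@embC R)); last exact: continuous_embC.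
    apply: continuous_mul; last exact: cst_continuous.
    by apply: continuous_mul; [exact: cst_continuous|exact: cmass].
  exact: (continuous_comp_fun (cv j) (@continuous_cis R)).
apply: (@continuous_comp_fun _ _ _ (fun p => base_step j * cos_pos (v p j)) (@embC R)); last exact: continuous_embC.
by apply: continuous_mul; [exact: cst_continuous|exact: ccos].
Qed.

Lemma norm_model0 v j : (forall k, v k = 0) -> norm_model v j = embC (base_step j).
Proof.
move=> v0; rewrite /norm_model; under eq_bigr do rewrite model0 //.
rewrite model0 // -embC_sum -mulr_sumr base_step_sum mulr1 -embCV -embCM; congr embC.
lra.
Qed.

Lemma model_neq0 v j : 0 < cos_mass v -> model v j != 0.
Proof.
move=> Q0; apply: embC_cis_neq0; have w0 := base_step_gt0 j; have c := cos_pos_ge0 (v j).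
- by rewrite divr_gt0 // mulr_gt0.
- by rewrite mulr_ge0 // ltW.
- by rewrite pmulr_rgt0 // => /cos_pos_gt0.
Qed.

Lemma Re_neq0 (z : Cplx R) : 0 < cRe z -> z != 0.
Proof. by apply: contraTneq => ->; rewrite -embC0 cRe_embC ltxx. Qed.

Lemma norm_model_conf v : (exists k, 0 < cos (v k)) ->
  conf_space R (cycle_graph m.+1) (config X0 C0 (norm_model v)).
Proof.
move=> /cos_mass_gt0 Q0; have S0 := Re_neq0 (model_sum_Re Q0).
apply: config_cycle; [lia|exact: C0_neq0| |exact: sum_normalize].
by move=> j; rewrite mulf_neq0 ?invr_eq0 ?model_neq0.
Qed.

Lemma continuous_norm_model (T : topologicalType) (v : T -> 'I_m -> R) j :
  (forall k, continuous (fun p => v p k)) -> (forall p, exists k, 0 < cos (v p k)) ->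
  continuous (fun p => norm_model (v p) j).
Proof.
move=> cv cp; apply: (@continuous_normalize R m T (fun j p => model (v p) j)).
  by move=> k; exact: continuous_model.
by move=> p; apply/Re_neq0/model_sum_Re/cos_mass_gt0.
Qed.

Definition angle_loop y : Prop :=
  [/\ forall k, continuous (y k), forall k, y k 0 = 0, forall k, y k 1 = 0 &
      forall s, 0 <= s <= 1 -> exists k, 0 < cos (y k s)].

Definition realizes (b : braid_path (cycle_graph m.+1) base) y : Prop :=
  forall i s, 0 <= s <= 1 -> strand b i s = config X0 C0 (norm_model (y^~ s)) i.

Lemma angle_loop_realized y : angle_loop y -> exists b, realizes b y.
Proof.
case=> cy y0 y1 yg.
pose st i (s : R) := config X0 C0 (norm_model (y^~ s)) i.
have stc i : {within `[0, 1], continuous (st i)}.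
  apply/within_itvP; apply: continuous_config; try exact: cst_continuous.
  move=> j; apply: continuous_norm_model => [k|s].
    exact: (continuous_comp_fun (@continuous_clamp R) (cy k)).
  by apply: yg; rewrite clamp_ge0 clamp_le1.
have stF (s : R) : 0 <= s <= 1 -> conf_space R (cycle_graph m.+1) (fun i => st i s).
  by move=> /yg /norm_model_conf.
have stE i (s : R) : (forall k, y k s = 0) -> st i s = base i.
  move=> ys; rewrite -config_base; congr (_ + _ * _); apply: eq_bigr => j _.
  exact: norm_model0.
have st1 i : st i 1 = base ((1%g : 'S_m.+1) i) by rewrite perm1 stE.
exists (BraidPath (group1 (graph_aut_group (cycle_graph m.+1))) stc stF
  (fun i => stE i 0 y0) st1).
by move=> i s _.
Qed.

(** The homotopy follows straight lines in the space of angles. It stays off the cubes because, at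
    each time [s], one coordinate keeps a positive cosine along the whole line. *)
Lemma angle_loop_homotopic y y' b b' : angle_loop y -> angle_loop y' ->
    (forall s, 0 <= s <= 1 -> exists k, forall t, 0 <= t <= 1 ->
       0 < cos ((1 - t) * y k s + t * y' k s)) ->
  realizes b y -> realizes b' y' -> homotopic b b'.
Proof.
move=> [cy y0 y1 _] [cy' y0' y1' _] yy' by_ by'.
pose v (p : R * R) k := (1 - p.2) * y k p.1 + p.2 * y' k p.1.
pose h i p := config X0 C0 (norm_model (v p)) i.
have hE i s t : (forall k, y k s = 0) -> (forall k, y' k s = 0) -> h i (s, t) = base i.
  move=> ys ys'; rewrite -config_base; congr (_ + _ * _); apply: eq_bigr => j _.
  by apply: norm_model0 => k; rewrite /v /= ys ys' !mulr0 addr0.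
apply: (@homotopic_mk _ _ _ _ _ _ h).
- move=> i; apply/within_squareP; apply: continuous_config; try exact: cst_continuous.
  move=> j; apply: continuous_norm_model => [k|[s t]].
    have c1 (f : R -> R) : continuous f -> continuous (fun p : R * R => f (clamp2 p).1).
      move=> cf; apply: (@continuous_comp_fun _ _ _ (fun p : R * R => clamp p.1) f); last exact: cf.
      exact: (continuous_comp_fun (@continuous_fst _ _) (@continuous_clamp R)).
    have c2 : continuous (fun p : R * R => (clamp2 p).2).
      exact: (continuous_comp_fun (@continuous_snd _ _) (@continuous_clamp R)).
    apply: continuous_add; apply: continuous_mul; try exact: c1; try exact: c2.
    by apply: continuous_add; [exact: cst_continuous|exact: continuous_opp].
  have [|k hk] := yy' (clamp s); first by rewrite clamp_ge0 clamp_le1.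
  by exists k; rewrite /v /=; apply: hk; rewrite clamp_ge0 clamp_le1.
- move=> i s s01; rewrite by_ // /h; congr (config _ _ (norm_model _) i); apply/funext => k.
  by rewrite /v /= subr0 mul1r mul0r addr0.
- move=> i s s01; rewrite by' // /h; congr (config _ _ (norm_model _) i); apply/funext => k.
  by rewrite /v /= subrr mul1r mul0r add0r.
- by move=> i t _; exact: hE.
- by move=> i t _; rewrite !hE.
- move=> s t s01 t01; apply: norm_model_conf; have [k hk] := yy' s s01.
  by exists k; exact: hk.
Qed.

End Standard.

(** * Contraction of a loop of angles *)

Section Contraction.
Variables (R : realType) (m : nat) (x : line_point R m.+1).
Hypothesis m_gt2 : (2 < m)%N.
Implicit Types (y : 'I_m -> R -> R).

Lemma subdivision (M : nat) (s : R) : (0 < M)%N -> 0 <= s <= 1 ->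
  exists r, (r < M)%N /\ r%:R <= s * M%:R <= r.+1%:R.
Proof.
move=> M0 /andP[s0 s1]; have M0' : 0 < M%:R :> R by rewrite ltr0n.
move: s1; rewrite le_eqVlt => /orP[/eqP ->|s1].
  by exists M.-1; rewrite ltn_predL M0 mul1r prednK // lexx ler_nat leq_pred.
have sM : 0 <= s * M%:R by rewrite mulr_ge0 // ltW.
have /andP[t1 t2] := truncn_itv sM.
exists (Num.truncn (s * M%:R)); rewrite t1 ltW //; split=> //.
rewrite -(ltr_nat R); apply: le_lt_trans t1 _.
by rewrite gtr_pMl.
Qed.

(** The open sets on which a given angle is within [pi / 2] of a given multiple of [2 pi] cover
    [[0, 1]], and [own r] names one that contains the whole closed interval [r]. As the intervals
    are closed, two neighbours can be compared at their common node. *)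
Lemma angle_loop_sheets y : angle_loop y -> exists M : nat, (0 < M)%N /\
  exists own : nat -> 'I_m * int, forall r s, (r < M)%N -> r%:R <= s * M%:R <= r.+1%:R ->
    `|y (own r).1 s - (2 * pi) * (own r).2%:~R| < pi / 2.
Proof.
move=> [cy y0 y1 yg].
pose Q (kz : 'I_m * int) (s : R) := `|y kz.1 s - (2 * pi) * kz.2%:~R| < pi / 2.
have [|N hN] := @lebesgue_number R R^o (`[0, 1]) _ Q (@segment_compact R 0 1).
  move=> s; rewrite /= in_itv /= => /yg [k /cos_gt0_2pi_int [z hz]]; exists (k, z).
  have cd : continuous (fun s : R => `|y k s - (2 * pi) * z%:~R|).
    apply: continuous_norm_fun; apply: continuous_add; first exact: cy.
    exact: cst_continuous.
  exact: (cvgr_lt _ (cd s) _ hz).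
exists N.+2; split=> //.
have N0 : 0 < N.+2%:R :> R by rewrite ltr0n.
have /choice [own hown] (r : nat) : exists kz, (r < N.+2)%N ->
    forall s, r%:R <= s * N.+2%:R <= r.+1%:R -> Q kz s.
  case: (ltnP r N.+2) => rN; last by exists (Ordinal (ltnW (ltnW m_gt2)), 0).
  have [|kz hkz] := hN (r%:R / N.+2%:R).
    by rewrite /= in_itv /= divr_ge0 //= ler_pdivrMr // mul1r ler_nat ltnW.
  exists kz => _ s /andP[s1 s2]; apply: hkz; rewrite /ball /=.
  have h1 : r%:R / N.+2%:R <= s by rewrite ler_pdivrMr.
  have h2 : s <= r.+1%:R / N.+2%:R by rewrite ler_pdivlMr.
  rewrite ler0_norm ?subr_le0 // opprB.
  apply: (@le_lt_trans _ _ N.+2%:R^-1).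
    by rewrite lerBlDl; apply: le_trans h2 _; rewrite -natr1 mulrDl mul1r.
  by rewrite ltf_pV2 ?posrE ?ltr0n // ltr_nat.
by exists own => r s rN; exact: hown.
Qed.

Lemma cosMz (z : int) : cos ((2 * pi) * z%:~R) = 1 :> R.
Proof. by rewrite -[_ * _]add0r cosD2pi_int cos0. Qed.

(* On the r-th interval of a subdivision the angle of index (own r).1 stays near
   a multiple of 2 pi.  The loop y' goes through multiples of 2 pi at the nodes,
   the angle p moving in the second half of each interval and the others in the
   first half; hence at each time an angle of index <> c is a multiple of 2 pi,
   and angle c can be set to 0, and then all the other ones. *)
Lemma angle_loop_null y b : angle_loop y -> @realizes R m x b y -> homotopic b (one_path _ _).
Proof.
move=> gy by_; have [cy y0 y1 _] := gy.
have [M [M0 [own ownP]]] := angle_loop_sheets gy.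
have pi0 := pi_gt0 R; have MR : 0 < M%:R :> R by rewrite ltr0n.
pose c : 'I_m := Ordinal (ltnW (ltnW m_gt2)).
pose p : 'I_m := Ordinal (ltnW m_gt2).
pose q : 'I_m := Ordinal m_gt2.
(* The multiple of [2 pi] prescribed for angle [k] at node [r]. When both adjacent intervals own
   [k], their values agree, since both are near the angle at the node; when neither does, the value
   0 is arbitrary, but 0 is what both ends of the loop require. *)
pose zz (r : nat) (k : 'I_m) : int :=
  if (r < M)%N && (k == (own r).1) then (own r).2 else
  if (0 < r)%N && (k == (own r.-1).1) then (own r.-1).2 else 0.
have zz_own r : (r < M)%N -> zz r (own r).1 = (own r).2.
  by move=> rM; rewrite /zz rM eqxx.
have zz_ownS r : (r < M)%N -> zz r.+1 (own r).1 = (own r).2.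
  move=> rM; rewrite /zz /= eqxx; case: ifP => // /andP[rM' /eqP e].
  apply: (@near_2pi_unique _ (y (own r).1 (r.+1%:R / M%:R))).
    by rewrite e; apply: ownP => //; rewrite divfK ?gt_eqF // lexx ler_nat /=.
  by apply: ownP => //; rewrite divfK ?gt_eqF // lexx ler_nat leqnSn.
have zz0 k : zz 0%N k = 0.
  rewrite /zz M0 /=; case: eqP => // _.
  apply: (@near_2pi_unique _ (y (own 0).1 0)).
    by apply: ownP => //; rewrite mul0r lexx ler0n.
  by rewrite y0 mulr0 subr0 normr0 divr_gt0.
have zzM k : zz M k = 0.
  rewrite /zz ltnn /= M0 /=; case: eqP => // _.
  apply: (@near_2pi_unique _ (y (own M.-1).1 1)).
    by apply: ownP; rewrite ?ltn_predL // mul1r prednK // lexx ler_nat leq_pred.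
  by rewrite y1 mulr0 subr0 normr0 divr_gt0.
pose dl (k : 'I_m) (r : nat) (s : R) : R := clamp (2 * (s * M%:R - r%:R) - (k == p)%:R).
(* A sum of ramps is clearly continuous. On interval [r] the earlier ramps are complete, so they
   telescope, and the later ones have not begun. *)
pose y' (k : 'I_m) (s : R) : R :=
  \sum_(0 <= r < M) (2 * pi) * (zz r.+1 k - zz r k)%:~R * dl k r s.
have y'E k s r : (r < M)%N -> r%:R <= s * M%:R <= r.+1%:R ->
    y' k s = (2 * pi) * ((zz r k)%:~R + (zz r.+1 k - zz r k)%:~R * dl k r s).
  move=> rM /andP[r1 r2]; have bp : 0 <= ((k == p)%:R : R) <= 1 by case: (k == p) => /=; lra.
  rewrite /y' (@big_cat_nat _ _ _ r) //=; last exact: ltnW.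
  rewrite [X in _ + X]big_ltn // [X in _ + (_ + X)]big1_seq ?addr0; last first.
    move=> j; rewrite mem_index_iota => /andP[_ /andP[rj _]].
    have : r.+1%:R <= j%:R :> R by rewrite ler_nat.
    by move=> rj'; rewrite /dl clamp_le0 ?mulr0 //; lra.
  rewrite [RHS]mulrDr [X in _ = _ + X]mulrA; congr (_ + _).
  rewrite (eq_big_nat _ _ (F2 := fun j => (2 * pi) * (zz j.+1 k)%:~R - (2 * pi) * (zz j k)%:~R)).
    by rewrite telescope_sumr // zz0 mulr0 subr0.
  move=> j /andP[_ jr]; have : j.+1%:R <= r%:R :> R by rewrite ler_nat.
  rewrite -natr1 => jr'; rewrite /dl clamp_ge1 ?mulr1 ?intrB ?mulrBr //; lra.
have dl01 k r s : 0 <= dl k r s <= 1 by rewrite clamp_ge0 clamp_le1.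
have y'own s r : (r < M)%N -> r%:R <= s * M%:R <= r.+1%:R ->
    y' (own r).1 s = (2 * pi) * (own r).2%:~R.
  by move=> rM rs; rewrite (y'E _ _ _ rM rs) zz_own // zz_ownS // subrr mul0r addr0.
have cy' k : continuous (y' k).
  apply: continuous_sum => r _; apply: continuous_mul; first exact: cst_continuous.
  apply: (@continuous_comp_fun _ _ _ (fun s : R => 2 * (s * M%:R - r%:R) - (k == p)%:R) (@clamp R)); last exact: continuous_clamp.
  apply: continuous_add; last exact: cst_continuous.
  apply: continuous_mul; first exact: cst_continuous.
  apply: continuous_add; last exact: cst_continuous.
  by apply: continuous_mul; [exact: continuous_id|exact: cst_continuous].
have y'0 k : y' k 0 = 0.
  rewrite (y'E _ _ 0%N) // ?mul0r ?lexx ?ler0n // zz0.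
  by rewrite /dl clamp_le0 ?mulr0 ?addr0 ?mulr0 // mul0r subrr mulr0 sub0r oppr_le0.
have y'1 k : y' k 1 = 0.
  have e : 1 * M%:R = M.-1%:R + 1 :> R by rewrite mul1r natr1 prednK.
  rewrite (y'E _ _ M.-1) ?ltn_predL //; last by rewrite mul1r prednK // lexx ler_nat leq_pred.
  rewrite prednK // /dl clamp_ge1; last by rewrite e; case: (k == p) => /=; lra.
  by rewrite mulr1 -intrD addrC subrK zzM mulr0.
have y'g s : 0 <= s <= 1 -> exists2 k, k != c & cos (y' k s) = 1.
  move=> /(subdivision M0) [r [rM rs]].
  case: (eqVneq (own r).1 c) => [ec|]; last first.
    by move=> nc; exists (own r).1 => //; rewrite (y'own _ _ rM rs) cosMz.
  (* In the first half of the interval [p] still rests at its old node value; in the second half [q]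
     has already reached its new one. *)
  case: (lerP (2 * (s * M%:R - r%:R)) 1) => h.
    exists p => //; rewrite (y'E _ _ _ rM rs) /dl eqxx clamp_le0 ?mulr0 ?addr0 ?cosMz //.
    by rewrite /=; lra.
  exists q => //; rewrite (y'E _ _ _ rM rs) /dl clamp_ge1 ?mulr1; last first.
    by rewrite /=; lra.
  by rewrite -intrD addrC subrK cosMz.
pose y'' (k : 'I_m) (s : R) : R := if k == c then 0 else y' k s.
have cy'' k : continuous (y'' k).
  by rewrite /y''; case: (k == c); [exact: cst_continuous|exact: cy'].
have gy' : angle_loop y'.
  by split=> // s /y'g [k _ ck]; exists k; rewrite ck.
have gy'' : angle_loop y''.
  split=> //; try by move=> k; rewrite /y''; case: ifP.
  by move=> s _; exists c; rewrite /y'' eqxx cos0.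
pose o (k : 'I_m) (s : R) : R := 0.
have go : angle_loop o.
  split=> //; first by move=> k; exact: cst_continuous.
  by move=> s _; exists c; rewrite cos0.
have [b1 m1] := angle_loop_realized x m_gt2 gy'.
have [b2 m2] := angle_loop_realized x m_gt2 gy''.
have mo : @realizes R m x (one_path _ _) o.
  move=> i s _; apply: etrans (esym (config_base x m_gt2 i)) _; congr (_ + _ * _); apply: eq_bigr => j _.
  by rewrite (norm_model0 x m_gt2).
(* Three straight lines. The angle with positive cosine is the owner of the interval from [y] to
   [y'], some index other than [c] from [y'] to [y''], and [c] itself from [y''] to 0. *)
apply: (homotopic_trans (angle_loop_homotopic m_gt2 gy gy' _ by_ m1)).
  move=> s /(subdivision M0) [r [rM rs]]; exists (own r).1 => t t01.
  rewrite (y'own _ _ rM rs); apply: (@cos_gt0_near _ _ (own r).2).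
  have -> : (1 - t) * y (own r).1 s + t * (2 * pi * (own r).2%:~R) - 2 * pi * (own r).2%:~R
     = (1 - t) * (y (own r).1 s - 2 * pi * (own r).2%:~R) by ring.
  rewrite normrM; apply: le_lt_trans (ownP _ _ rM rs).
  by apply: ler_piMl => //; rewrite ger0_norm; lra.
apply: (homotopic_trans (angle_loop_homotopic m_gt2 gy' gy'' _ m1 m2)).
  move=> s /y'g [k kc ck]; exists k => t t01; rewrite /y'' (negbTE kc).
  by rewrite -mulrDl subrK mul1r ck.
apply: (angle_loop_homotopic m_gt2 gy'' go _ m2 mo).
by move=> s _; exists c => t _; rewrite /y'' /o eqxx !mulr0 addr0 cos0.
Qed.

End Contraction.

(** * Deformation of a pure braid onto a standard one *)

Section Trivial.
Variables (R : realType) (m : nat) (x : line_point R m.+1).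
Hypothesis m_gt2 : (2 < m)%N.
Let base := line_base x.
Let G := cycle_graph m.+1.

Lemma cycle_adj_step (j : 'I_m) : G (lift ord0 j) (vtx j).
Proof.
by rewrite /G /= /cycle_adj /cycle_edge /= /bump /= !xpair_eqE; have := ltn_ord j; lia.
Qed.

Lemma cycle_adj_span : G ord_max ord0.
Proof. by rewrite /G /= /cycle_adj /cycle_edge /= !xpair_eqE; lia. Qed.

(** The normalized differences [U] and the numbers [model] have compatible arguments [y], so the
    segment between them is admissible after division by its sum. The scale [C] is deformed
    separately: as it does not turn, it can be unwound to the constant [C0]. *)
Lemma pure_angle_loop (a : braid_path G base) :
    end_perm a = 1%g ->
    (forall j k, G j k -> turn (strand_diff a j k) 0) ->
  exists y, angle_loop y /\ forall b, realizes b y -> homotopic a b.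
Proof.
move=> a1 at0.
have i0 : 0 <= (0 : R) <= 1 by rewrite lexx ler01.
have i1 : 0 <= (1 : R) <= 1 by rewrite lexx ler01.
pose c0 : R := x ord_max - x ord0; pose C0 : Cplx R := embC c0; pose X0 : Cplx R := embC (x ord0).
have c0_0 : 0 < c0 by exact: (@c0_gt0 R m x m_gt2).
have C00 : C0 != 0 := C0_neq0 x m_gt2.
have s0E i : strand a i 0 = base i by exact: strand0.
have s1E i : strand a i 1 = base i by rewrite strand1 a1 perm1.
have [thC [cC C_0 C_1 rC]] := at0 _ _ cycle_adj_span.
have /choice [th thP] (j : 'I_m) : exists t : R -> R, [/\ continuous t, t 0 = 0, t 1 = 0 &
    forall s, 0 <= s <= 1 -> ray (strand_diff a (lift ord0 j) (vtx j) s)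
      (strand_diff a (lift ord0 j) (vtx j) 0 * cis (t s))].
  by have [t ht] := at0 _ _ (cycle_adj_step j); exists t.
pose z i (s : R) := strand a i (clamp s).
have cz i : continuous (z i) by exact/within_itvP/strand_cont.
pose C s := z ord_max s - z ord0 s.
have C_neq0 s : C s != 0.
  apply: (strand_diff_neq0 a (cycle_adj_span)).
  by rewrite clamp_ge0 clamp_le1.
have cC' : continuous C.
  by apply: continuous_add; [exact: cz|apply: continuous_opp; exact: cz].
pose U j s := (z (lift ord0 j) s - z (vtx j) s) / C s.
have cU j : continuous (U j).
  apply: continuous_div; [|exact: cC'|exact: C_neq0].
  by apply: continuous_add; [exact: cz|apply: continuous_opp; exact: cz].
have U1 s : \sum_j U j s = 1 by apply: (@sum_steps R m (fun i => z i s)); exact: C_neq0.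
pose y (j : 'I_m) s := th j s - thC s.
have rayC s : 0 <= s <= 1 -> ray (C s) (C0 * cis (thC s)).
  by move=> s01; have := rC s s01; rewrite /strand_diff !s0E -embCB /C /z clamp_id.
have rayU j s : 0 <= s <= 1 -> ray (U j s) (cis (y j s)).
  move=> s01; apply: (@ray_cancel _ _ _ (C s)) => //.
  rewrite {1}/U mulrC divfK //.
  have [_ _ _ /(_ s s01)] := thP j; rewrite /strand_diff !s0E -embCB => r.
  rewrite /z clamp_id //; apply: ray_trans r _.
  have -> : th j s = thC s + y j s by rewrite /y addrC subrK.
  rewrite cisD mulrA; apply: rayM; last exact: ray_refl.
  apply: ray_trans (ray_sym (rayC s s01)); apply: rayM; last exact: ray_refl.
  exists (base_step x j); first exact: base_step_gt0.
  by rewrite -embCM divfK // gt_eqF.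
have gy : angle_loop y.
  split.
  - move=> j; have [ct _ _ _] := thP j.
    by apply: continuous_add; [exact: ct|apply: continuous_opp; exact: cC].
  - by move=> j; have [_ t0 _ _] := thP j; rewrite /y t0 C_0 subrr.
  - by move=> j; have [_ _ t1 _] := thP j; rewrite /y t1 C_1 subrr.
  (* If all cosines were [<= 0], so would be the real part of [\sum_j U j s], which is 1. *)
  move=> s s01; apply: contrapT => /forallNP hn.
  have : cRe (\sum_j U j s) <= 0.
    rewrite cRe_sum; apply: sumr_le0 => j _.
    have [r r0 ->] := rayU j s s01; rewrite !cplx_simp mul0r subr0.
    by rewrite pmulr_rle0 // leNgt; apply/negP; exact: hn.
  by rewrite U1 -embC1 cRe_embC ler10.
have [cy y0 y1 yg] := gy.
exists y; split=> // b by_.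
(* By [rayU] each [W p j] has the form [A cis(y_j) + B] of [embC_cis_neq0]. The sum has positive
   real part, because [U] sums to 1 and the sum of [model] has positive real part. *)
pose W (p : R * R) (j : 'I_m) : Cplx R :=
  embC (1 - p.2) * U j p.1 + embC p.2 * model x (y^~ p.1) j.
have SW p : \sum_j W p j =
    embC (1 - p.2) + embC p.2 * \sum_j model x (y^~ p.1) j.
  by rewrite big_split /= -!mulr_sumr U1 mulr1.
have massy s : 0 <= s <= 1 -> 0 < cos_mass x (y^~ s).
  by move=> /yg; apply: cos_mass_gt0.
have SW0 s t : 0 <= s <= 1 -> 0 <= t <= 1 -> \sum_j W (s, t) j != 0.
  move=> s01 t01; apply: Re_neq0; rewrite SW !cplx_simp mul0r subr0.
  have := model_sum_Re m_gt2 (massy s s01); move: (cRe _) => r r0 /=.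
  nra.
have W0 s t j : 0 <= s <= 1 -> 0 <= t <= 1 -> W (s, t) j != 0.
  move=> s01 t01; rewrite /W /= /model; have [r r0 ->] := rayU j s s01.
  set Q := cos_mass _ _; have Q0 : 0 < Q := massy s s01; have w0 := base_step_gt0 x m_gt2 j.
  have cp := cos_pos_ge0 (y j s).
  have -> : embC (1 - t) * (embC r * cis (y j s)) + embC t *
     (embC (base_step x j * Q / 2) * cis (y j s) + embC (base_step x j * cos_pos (y j s))) =
     embC ((1 - t) * r + t * (base_step x j * Q / 2)) * cis (y j s) +
     embC (t * (base_step x j * cos_pos (y j s))).
    by rewrite (embCD ((1 - t) * r)) !embCM; ring.
  have wQ : 0 < base_step x j * Q by exact: mulr_gt0.
  apply: embC_cis_neq0.
  - move: wQ; move: (base_step x j * Q) => A A0; have /andP[t0 t1] := t01.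
    have A2 : 0 < A / 2 by exact: divr_gt0.
    case: (ltrP 0 t) => t2.
      have h1 : 0 <= (1 - t) * r by rewrite mulr_ge0 ?subr_ge0 // ltW.
      have h2 : 0 < t * (A / 2) by exact: mulr_gt0.
      by rewrite (le_lt_trans h1) // ltrDl.
    have -> : t = 0 by apply/eqP; rewrite eq_le t2 t0.
    by rewrite subr0 mul1r mul0r addr0.
  - have /andP[t0 _] := t01.
    by apply: mulr_ge0 => //; apply: mulr_ge0 => //; exact: ltW.
  - case: (ltrP 0 (cos_pos (y j s))) => [/cos_pos_gt0 //|h].
    have -> : cos_pos (y j s) = 0 by lra.
    by rewrite !mulr0 ltxx.
(* The first factor goes from [C] to [C0 cis(thC)] along a common ray, hence avoids 0; the second
   one undoes the rotation progressively, so that [cc] ends at [C0]. *)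
pose cc (p : R * R) : Cplx R :=
  (embC (1 - p.2) * C p.1 + embC p.2 * (C0 * cis (thC p.1))) * cis (- (p.2 * thC p.1)).
have cc0 s t : 0 <= s <= 1 -> 0 <= t <= 1 -> cc (s, t) != 0.
  move=> s01 t01; rewrite /cc /= mulf_neq0 ?cis_neq0 //.
  have [r r0 ->] := rayC s s01.
  rewrite !mulrA -mulrDl -!embCM -embCD mulf_neq0 ?cis_neq0 // embC_eq0 gt_eqF //.
  by rewrite -mulrDl mulr_gt0 //; nra.
pose zz (p : R * R) : Cplx R := embC (1 - p.2) * z ord0 p.1 + embC p.2 * X0.
pose h i (p : R * R) := config (zz p) (cc p) (fun j => W p j / \sum_k W p k) i.
(* Applied at both ends of the braid: there [W] is [(1 - t) + t * (3 / 2)] times the base steps, and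
   normalization removes the factor, so the homotopy fixes the end points. *)
have hE i s t : 0 <= s <= 1 -> 0 <= t <= 1 -> (forall i, strand a i s = base i) ->
    (forall j, y j s = 0) -> thC s = 0 -> h i (s, t) = base i.
  move=> s01 t01 sE ys tC; rewrite -[RHS](config_base x m_gt2) /h.
  have zE k : z k s = base k by rewrite /z clamp_id.
  have CE : C s = C0 by rewrite /C !zE -embCB.
  have WE j : W (s, t) j = embC (((1 - t) + t * (3 / 2)) * base_step x j).
    rewrite /W /= /U !zE CE -(embC_base_step x) model0 //.
    by rewrite -!embCM -embCD; congr embC; ring.
  have k0 : (1 - t) + t * (3 / 2) != 0 by rewrite gt_eqF //; lra.
  congr (_ + _ * _).
  - by rewrite /zz /= zE -mulrDl -embCD subrK embC1 mul1r.
  - by rewrite /cc /= CE tC mulr0 oppr0 cis0 !mulr1 -mulrDl -embCD subrK embC1 mul1r.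
  - apply: eq_bigr => j _; rewrite WE; under eq_bigr do rewrite WE.
    rewrite -embC_sum -mulr_sumr base_step_sum // mulr1 -embCV -embCM; congr embC.
    by rewrite mulrAC divff // mul1r.
apply: (@homotopic_mk _ _ _ _ _ _ h).
- move=> i; apply/within_squareP.
  have c1 (T : topologicalType) (f : R -> T) : continuous f ->
      continuous (fun p : R * R => f (clamp2 p).1).
    move=> cf; apply: (@continuous_comp_fun _ _ _ (fun p : R * R => clamp p.1) f); last exact: cf.
    exact: (continuous_comp_fun (@continuous_fst _ _) (@continuous_clamp R)).
  have c2 : continuous (fun p : R * R => (clamp2 p).2).
    exact: (continuous_comp_fun (@continuous_snd _ _) (@continuous_clamp R)).
  have ct : continuous (fun p : R * R => embC (clamp2 p).2).
    exact: (continuous_comp_fun c2 (@continuous_embC R)).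
  have c1t : continuous (fun p : R * R => embC (1 - (clamp2 p).2)).
    apply: (@continuous_comp_fun _ _ _ (fun p : R * R => 1 - (clamp2 p).2) (@embC R)); last exact: continuous_embC.
    by apply: continuous_add; [exact: cst_continuous|apply: continuous_opp; exact: c2].
  apply: continuous_config.
  + apply: continuous_add; apply: continuous_mul.
    * exact: c1t.
    * exact: (c1 _ _ (cz ord0)).
    * exact: ct.
    * exact: cst_continuous.
  + apply: continuous_mul.
      apply: continuous_add; apply: continuous_mul.
      * exact: c1t.
      * exact: (c1 _ _ cC').
      * exact: ct.
      apply: continuous_mul; first exact: cst_continuous.
      exact: (continuous_comp_fun (c1 _ _ cC) (@continuous_cis R)).
    apply: (@continuous_comp_fun _ _ _ (fun p : R * R => - ((clamp2 p).2 * thC (clamp2 p).1)) (@cis R)); last exact: continuous_cis.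
    apply: continuous_opp; apply: continuous_mul; first exact: c2.
    exact: (c1 _ _ cC).
  + move=> j; apply: (@continuous_normalize R m _ (fun j p => W (clamp2 p) j)).
      move=> k; apply: continuous_add; apply: continuous_mul.
      * exact: c1t.
      * exact: (c1 _ _ (cU k)).
      * exact: ct.
      * apply: (@continuous_model R m x _ (fun p : R * R => y^~ (clamp2 p).1)) => l.
        exact: (c1 _ _ (cy l)).
    by move=> p; apply: SW0; rewrite clamp_ge0 clamp_le1.
- move=> i s s01; rewrite /h /zz /cc /= subr0 embC1 embC0 !mul1r !mul0r !addr0 oppr0 cis0 mulr1.
  rewrite -[RHS](_ : z i s = _); last by rewrite /z clamp_id.
  rewrite -[RHS](config_of_points (fun i => z i s) i (C_neq0 s)); congr (_ + _ * _).
  apply: eq_bigr => j _; rewrite SW /W /= subr0 embC1 embC0 mul1r !mul0r !addr0.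
  by rewrite divr1.
- move=> i s s01; rewrite by_ // /h /zz /cc /= subrr embC1 embC0 !mul1r !mul0r !add0r.
  rewrite -mulrA [cis _ * _]mulrC cisN mulr1; congr (_ + _ * _).
  apply: eq_bigr => j _; rewrite SW /W /= subrr embC1 embC0 !mul1r !mul0r !add0r.
  by [].
- by move=> i t t01; apply: hE.
- by move=> i t t01; rewrite !hE.
- move=> s t s01 t01; apply: config_cycle; first exact: ltnW.
  + exact: cc0.
  + by move=> j; rewrite mulf_neq0 ?invr_eq0 ?W0 ?SW0.
  + by apply: sum_normalize; exact: SW0.
Qed.

End Trivial.

Lemma turning_eq0 (R : realType) (n : nat) (x : line_point R n)
    (u : braid_group (cycle_graph n) (line_base x)) : (3 < n)%N ->
  braid_perm u = 1%g -> (forall j k, cycle_graph n j k -> turning u j k = 0) -> u = 1%g.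
Proof.
case: n => // m in x u * => m_gt2 u1 ut.
have tu j k : cycle_graph m.+1 j k -> turn (strand_diff (repr u) j k) 0.
  by move=> jk; have := turningP (repr u) jk; rewrite braid_classK ut.
have [y [gy hy]] := pure_angle_loop m_gt2 u1 tu.
have [b mb] := angle_loop_realized x m_gt2 gy.
rewrite -(braid_classK u); apply/braid_classP.
exact: homotopic_trans (hy b mb) (angle_loop_null m_gt2 gy mb).
Qed.

(** * Turning of the generators *)

Section Values.
Variables (R : realType) (n : nat) (x : line_point R n) (cw : bool).
Let base := line_base x.
Implicit Types (u v : artin_group base) (N : nat -> nat -> int) (f : nat -> nat).

(** The angle of one crossing. It carries the sign convention, so the integer counts below are the
    same for both values of [cw]. *)
Definition halfturn : R := (-1) ^+ cw * pi.

Definition half_turns u N : Prop := forall j k : 'I_n, j != k ->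
  turning u j k = halfturn * (N j.+1 k.+1)%:~R.

Definition label_action u f : Prop := forall k : 'I_n, (braid_perm u k).+1 = f k.+1.

Lemma half_turns_ext u N N' : (forall p q, 0 < p <= n -> 0 < q <= n -> p != q -> N p q = N' p q)%N ->
  half_turns u N -> half_turns u N'.
Proof. by move=> NN h j k jk; rewrite h // NN // ?ltn_ord // eqSS. Qed.

Lemma half_turnsM u v f N N' : label_action u f -> half_turns u N -> half_turns v N' ->
  half_turns (u * v)%g (fun p q => N p q + N' (f p) (f q)).
Proof.
move=> uf uN vN j k jk; rewrite turningM // uN // vN; last by rewrite (inj_eq perm_inj).
by rewrite !uf -mulrDr intrD.
Qed.

(** The crossed homomorphism rule is applied to [(u * v^-1) * v = u], which avoids describing the
    permutation of [v^-1]. *)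
Lemma half_turns_divr u v f N N' : label_action (u * v^-1)%g f -> half_turns u N -> half_turns v N' ->
  half_turns (u * v^-1)%g (fun p q => N p q - N' (f p) (f q)).
Proof.
move=> uf uN vN j k jk; have := turningM (u * v^-1)%g v (jk : complete_graph n j k).
rewrite mulgKV uN // vN ?(inj_eq perm_inj) // !uf => e.
by rewrite intrB mulrBr e addrK.
Qed.

Lemma half_turns1 : half_turns 1%g (fun _ _ => 0).
Proof. by move=> j k jk; rewrite turning1 // mulr0. Qed.

Definition n_sigma (i p q : nat) : int :=
  if ((p == i) && (q == i.+1)) || ((q == i) && (p == i.+1)) then 1 else 0.

Lemma label_action_sigma i : (0 < i < n)%N ->
  label_action (sigma x cw i) (fun p => if p == i then i.+1 else if p == i.+1 then i else p).
Proof. by move=> i0 k; rewrite perm_sigma adj_lab. Qed.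

(** The crossing pair rotates rigidly about its midpoint. Any other pair keeps its left-right order
    throughout, so it does not turn. *)
Lemma half_turns_sigma i : (0 < i < n)%N -> half_turns (sigma x cw i) (n_sigma i).
Proof.
move=> i0.
have wlt (j k : 'I_n) : (j < k)%N ->
    turning (sigma x cw i) j k = halfturn * (n_sigma i j.+1 k.+1)%:~R.
  move=> jk; have jk' : complete_graph n j k by rewrite /= -val_eqE neq_ltn jk.
  have aj := adj_lab j i0; have ak := adj_lab k i0.
  have dE s : strand_diff (twist_path x cw i) j k s =
      embC ((x j + x (adj_tperm n i j)) / 2 - (x k + x (adj_tperm n i k)) / 2)
    + cis (halfturn * s) * embC ((x j - x (adj_tperm n i j)) / 2 - (x k - x (adj_tperm n i k)) / 2).
    rewrite /strand_diff /= /twist_strand -/halfturn !embCB; ring.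
  apply: turningE => //; case e : (((j.+1 == i) && (k.+1 == i.+1))).
    have [aj' ak'] : adj_tperm n i j = k /\ adj_tperm n i k = j.
      have /andP[/eqP ej /eqP ek] := e; rewrite ej eqxx in aj.
      rewrite ek eqxx gtn_eqF // in ak.
      by split; apply: val_inj => /=; lia.
    have dE' s : strand_diff (twist_path x cw i) j k s = embC (x j - x k) * cis (halfturn * s).
      rewrite dE aj' ak' [X in embC X + _](_ : _ = 0) ?embC0 ?add0r 1?mulrC; last by lra.
      by congr (embC _ * _); lra.
    exists (fun s => halfturn * s); split.
    - by apply: continuous_mul; [exact: cst_continuous|exact: continuous_id].
    - by rewrite mulr0.
    - by rewrite /n_sigma e /=.
    - move=> s s01; rewrite !dE' mulr0 cis0 mulr1; exact: ray_refl.
  have -> : n_sigma i j.+1 k.+1 = 0 by rewrite /n_sigma e ifF //; lia.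
  rewrite mulr0.
  have xjk : x j < x k by exact: line_pt_inc.
  have xjk' : x (adj_tperm n i j) < x (adj_tperm n i k).
    apply: line_pt_inc; rewrite -ltnS aj ak; move: e; do ![case: ifP => //]; lia.
  (* With [c] the cosine at time [s], the real part is the average of the initial and final
     differences with weights [(1 + c) / 2] and [(1 - c) / 2]; both differences are negative. *)
  apply: (@turn_half_plane _ _ (x j - x k)).
  - exact: strand_diff_cont.
  - by rewrite subr_eq0 lt_eqF.
  - by rewrite /strand_diff !strand0 -embCB.
  - by rewrite /strand_diff !strand1 -embCB.
  move=> s s01; rewrite dE !cplx_simp mulr0 subr0.
  have c1 := cos_le1 (halfturn * s); have c2 := cos_geN1 (halfturn * s).
  move: (cos _) c1 c2 => c c1 c2; rewrite -mulrNN pmulr_lgt0; last by lra.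
  move: (x j) (x k) (x (adj_tperm n i j)) (x (adj_tperm n i k)) xjk xjk' => X Y X' Y' h h'.
  have h1 : 0 <= (1 + c) * (Y - X) by apply: mulr_ge0; lra.
  have h2 : 0 <= (1 - c) * (Y' - X') by apply: mulr_ge0; lra.
  case: (lerP 0 c) => c0.
    have : 0 < (1 + c) * (Y - X) by apply: mulr_gt0; lra.
    lra.
  have : 0 < (1 - c) * (Y' - X') by apply: mulr_gt0; lra.
  lra.
move=> j k; rewrite -val_eqE neq_ltn => /orP[jk|kj]; first exact: wlt.
rewrite turning_sym; last by rewrite /= -val_eqE neq_ltn kj orbT.
rewrite wlt // /n_sigma; congr (_ * _%:~R).
by do ![case: ifP => //]; lia.
Qed.

Definition n_a (i j p q : nat) : int :=
  if (((p == j) && (i <= q < j)) || ((q == j) && (i <= p < j)))%N then 1 else 0.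

Lemma a_elt_recl i j : (i <= j)%N -> a_elt x cw i j.+1 = (sigma x cw j * a_elt x cw i j)%g.
Proof.
move=> ij; rewrite /a_elt subSn // -[(j - i).+1]addn1 iotaD rev_cat big_cat /= big_seq1.
by rewrite subnKC.
Qed.

Lemma label_action_a i j : (0 < i <= j)%N -> (j <= n)%N -> label_action (a_elt x cw i j) (alab i j).
Proof. by move=> ij jn k; rewrite a_lab. Qed.

Lemma half_turns_a i j : (0 < i <= j)%N -> (j <= n)%N -> half_turns (a_elt x cw i j) (n_a i j).
Proof.
move=> /andP[i0 ij]; rewrite -(subnKC ij); move: (j - i)%N => m {j ij}.
elim: m => [|m IH] mn.
  rewrite addn0 /a_elt subnn big_nil; apply: half_turns_ext half_turns1 => p q _ _ pq.
  by rewrite /n_a ifF //; lia.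
rewrite addnS a_elt_recl ?leq_addr //.
have sm : (0 < i + m < n)%N by lia.
apply: half_turns_ext (half_turnsM (label_action_sigma sm) (half_turns_sigma sm) (IH ltac:(lia))).
move=> p q hp hq pq; rewrite /n_a /n_sigma.
by do ![case: ifP => //]; lia.
Qed.

(** In [a_{k,l}] the string [l] crosses all of [k, ..., l - 1]; then the inverse of [a_{k+1,l}]
    takes the string [k] across those strictly between, with the opposite sign. *)
Definition n_e (k l p q : nat) : int :=
  if (((p == l) && (k <= q < l)) || ((q == l) && (k <= p < l)))%N then 1 else
  if (((p == k) && (k < q < l)) || ((q == k) && (k < p < l)))%N then -1 else 0.

Lemma label_action_e k l : (0 < k < l)%N -> (l <= n)%N -> label_action (e_elt x cw k l) (elab k l).
Proof. by move=> kl ln i; rewrite e_lab. Qed.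

Lemma half_turns_e k l : (0 < k < l)%N -> (l <= n)%N -> half_turns (e_elt x cw k l) (n_e k l).
Proof.
move=> kl ln; apply: half_turns_ext (half_turns_divr (label_action_e kl ln) (half_turns_a _ ln) (half_turns_a _ ln)); try lia.
move=> p q hp hq pq; rewrite /n_a /n_e /elab.
by do ![case: ifP => //]; lia.
Qed.

Definition n_s (i j p q : nat) : int :=
  if ((p == i) && (q == j)) || ((p == j) && (q == i)) then 2 else 0.

(** From [s * c = c * sigma_i^2] with [c = a_{i+1,j}]: since [s] is pure, the turns of [c] cancel,
    and those of [sigma_i^2] remain, read at the labels moved by [c]. *)
Lemma half_turns_s i j : (0 < i < j)%N -> (j <= n)%N -> half_turns (s_elt x cw i j) (n_s i j).
Proof.
move=> ij jn p q pq; have s1 := s_dom x cw i j.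
have kl : (0 < i.+1 <= j)%N by lia.
set c := a_elt x cw i.+1 j; set g := sigma x cw i.
have sE : (s_elt x cw i j * c = c * (g * g))%g.
  rewrite /s_elt -/(a_elt x cw i.+1 j) -/c -/g expgS expg1 -mulgA -[RHS]mulg1.
  congr (_ * _)%g; rewrite /c /a_elt.
  elim: (iota _ _) => [|k l IH]; first by rewrite !big_nil mulg1.
  rewrite rev_cons -cats1 big_cat /= big_seq1 big_cons.
  by rewrite mulgA -[(_^-1 * _ * _)%g]mulgA IH mulg1 mulVg.
have i0 : (0 < i < n)%N by lia.
have := half_turnsM (label_action_a kl jn) (half_turns_a kl jn)
  (half_turnsM (label_action_sigma i0) (half_turns_sigma i0) (half_turns_sigma i0)) pq.
rewrite -/c -/g -sE turningM // s1 !perm1 (half_turns_a kl jn) // => e.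
apply: (addIr (halfturn * (n_a i.+1 j p.+1 q.+1)%:~R)); rewrite e -mulrDr -intrD.
congr (_ * _%:~R); rewrite /n_s /n_sigma /n_a /alab.
have := ltn_ord p; have := ltn_ord q; move: pq; rewrite -val_eqE /=.
by do ![case: ifP => //]; lia.
Qed.

End Values.

(** * Normal forms and presented groups *)

Section NormalForm.
Variables (H : groupType) (n : nat) (S : nat -> H) (a b : H) (fa fb : nat -> nat).
Local Open Scope group_scope.

Hypothesis n_gt0 : (0 < n)%N.
Hypothesis commS : forall i j, commute (S i) (S j).
Hypothesis conjSa : forall e, (0 < e <= n)%N -> S e ^ a = S (fa e).
Hypothesis conjSb : forall e, (0 < e <= n)%N -> S e ^ b = S (fb e).
Hypothesis fa_onto : forall e, (0 < e <= n)%N -> exists2 d, (0 < d <= n)%N & fa d = e.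
Hypothesis fb_onto : forall e, (0 < e <= n)%N -> exists2 d, (0 < d <= n)%N & fb d = e.

Definition monom (p : nat -> nat) : H := \prod_(1 <= e < n.+1) S e ^+ p e.

(** A monomial with integer exponents, written as a quotient of two with natural exponents. *)
Definition edgy (h : H) : Prop := exists p q, h = monom p * (monom q)^-1.

Lemma commute_monom p q : commute (monom p) (monom q).
Proof.
apply: commute_sym; apply: commute_prod => i _; apply: commute_sym.
by apply: commute_prod => j _; apply: commuteX2; exact: commS.
Qed.

Lemma monomD p q : monom (fun e => p e + q e)%N = monom p * monom q.
Proof.
rewrite /monom -prodgM_commute; last by move=> i j _ _; apply: commuteX2; exact: commS.
by apply: eq_bigr => i _; rewrite expgnDr.
Qed.

Lemma edgy1 : edgy 1.
Proof. by exists (fun=> 0%N), (fun=> 0%N); rewrite mulgV. Qed.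

Lemma edgyM g h : edgy g -> edgy h -> edgy (g * h).
Proof.
move=> [p [q ->]] [p' [q' ->]]; exists (fun e => p e + p' e)%N, (fun e => q e + q' e)%N.
rewrite !monomD (commute_monom q q') invMg -!mulgA; congr (_ * _).
rewrite !mulgA; congr (_ * _); apply: commute_sym; apply: commuteV.
exact: commute_monom.
Qed.

Lemma edgyV g : edgy g -> edgy g^-1.
Proof. by move=> [p [q ->]]; exists q, p; rewrite invMg invgK. Qed.

Lemma edgyX g k : edgy g -> edgy (g ^+ k).
Proof. by move=> gE; elim: k => [|k IH]; [exact: edgy1|rewrite expgS; exact: edgyM]. Qed.

Lemma edgy_prod (I : Type) (r : seq I) (P : pred I) (F : I -> H) :
  (forall i, P i -> edgy (F i)) -> edgy (\prod_(i <- r | P i) F i).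
Proof. by move=> hF; elim/big_ind: _ => //; [exact: edgy1|exact: edgyM]. Qed.

Lemma edgyS e : (0 < e <= n)%N -> edgy (S e).
Proof.
move=> e0; exists (fun d => (d == e) : nat), (fun=> 0%N).
rewrite {2}/monom [X in _ * X^-1]big1 // invg1 mulg1 /monom.
rewrite (@big_cat_nat _ _ _ e) /=; [|lia|lia].
rewrite [X in _ * X]big_ltn; last by lia.
rewrite eqxx expg1 !big1_seq ?mul1g ?mulg1 // => i; rewrite mem_index_iota => /andP[_ ih];
  by rewrite (_ : (i == e) = false) //; lia.
Qed.

Lemma edgyJ g h : (forall e, (0 < e <= n)%N -> edgy (S e ^ g)) -> edgy h -> edgy (h ^ g).
Proof.
move=> hg [p [q ->]].
have mono r : edgy (monom r ^ g).
  rewrite conjg_prod big_nat_cond; apply: edgy_prod => i /andP[ih _].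
  by rewrite conjXg; apply/edgyX/hg; lia.
by rewrite conjMg conjVg; apply: edgyM => //; exact: edgyV.
Qed.

(** Since [fa] is onto, each [S e] is a conjugate [S d ^ a], so conjugation by [a^-1] also sends
    generators to generators. *)
Lemma edgyJaV h : edgy h -> edgy (h ^ a^-1).
Proof.
apply: edgyJ => e he; have [d hd <-] := fa_onto he.
by rewrite -conjSa // conjgK; exact: edgyS.
Qed.

Lemma edgyJbV h : edgy h -> edgy (h ^ b^-1).
Proof.
apply: edgyJ => e he; have [d hd <-] := fb_onto he.
by rewrite -conjSb // conjgK; exact: edgyS.
Qed.

Hypothesis edgy_an : edgy (a ^+ n).
Hypothesis edgy_bb : edgy (b * b).
Hypothesis edgy_ba : edgy (b * a * b * a).

Definition standard (h : H) : Prop := exists s i j, edgy s /\ h = s * a ^+ i * b ^+ j.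

Lemma standard_edgy s h : edgy s -> standard h -> standard (s * h).
Proof.
move=> es [t [i [j [et ->]]]]; exists (s * t), i, j; split; first exact: edgyM.
by rewrite !mulgA.
Qed.

Lemma standard_a h : standard h -> standard (a * h).
Proof.
move=> [t [i [j [et ->]]]]; exists (t ^ a^-1), i.+1, j; split; first exact: edgyJaV.
by rewrite expgS !mulgA (conjgCV a t).
Qed.

Lemma standard_aV h : standard h -> standard (a^-1 * h).
Proof.
move=> sh; have -> : a^-1 * h = (a ^+ n)^-1 * (a ^+ n.-1 * h).
  by rewrite -{1}(prednK n_gt0) expgSr invMg -mulgA mulKg.
apply: standard_edgy; first exact: edgyV.
by elim: (n.-1) => [|k IH]; rewrite ?mul1g // expgS -mulgA; exact: standard_a.
Qed.

Lemma standard_b h : standard h -> standard (b * h).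
Proof.
move=> [t [i [j [et ->]]]].
have -> : b * (t * a ^+ i * b ^+ j) = t ^ b^-1 * (b * (a ^+ i * b ^+ j)).
  by rewrite !mulgA -conjgCV.
apply: standard_edgy; first exact: edgyJbV.
elim: i => [|i IH].
  exists 1, 0%N, j.+1; split; first exact: edgy1.
  by rewrite expgS !mul1g.
(* This is [b a = (b a b a) a^-1 (b b)^-1 b]: it moves [b] past one [a] at the cost of edge elements
   and of [a^-1], which are handled already. *)
have -> : b * (a ^+ i.+1 * b ^+ j) =
    (b * a * b * a) * (a^-1 * ((b * b)^-1 * (b * (a ^+ i * b ^+ j)))).
  by rewrite expgS invMg -!mulgA mulVKg mulKg !mulVKg.
apply: standard_edgy => //; apply: standard_aV; apply: standard_edgy => //.
exact: edgyV.
Qed.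

Lemma standard_bV h : standard h -> standard (b^-1 * h).
Proof.
move=> sh; have -> : b^-1 * h = (b * b)^-1 * (b * h) by rewrite invMg -mulgA mulKg.
by apply: standard_edgy; [exact: edgyV|exact: standard_b].
Qed.

Lemma standard_reduce h : standard h -> exists s i j,
  [/\ edgy s, (i < n)%N, (j < 2)%N & h = s * a ^+ i * b ^+ j].
Proof.
move=> [s [i [j [es ->]]]].
have eJa k t : edgy t -> edgy (t ^ (a ^+ k)^-1).
  elim: k t => [|k IH] t et; first by rewrite invg1 conjg1.
  by rewrite expgS invMg conjgM; apply: edgyJaV; exact: IH.
exists (s * (a ^+ n) ^+ (i %/ n) * ((b * b) ^+ (j %/ 2)) ^ (a ^+ (i %% n))^-1), (i %% n)%N, (j %% 2)%N.
split; rewrite ?ltn_mod //.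
  by apply: edgyM; [apply: edgyM => //; exact: edgyX|apply/eJa/edgyX].
rewrite -[in LHS](_ : a ^+ (i %/ n * n) * a ^+ (i %% n) = a ^+ i); last first.
  by rewrite -expgnDr -divn_eq.
rewrite -[in LHS](_ : b ^+ (j %/ 2 * 2) * b ^+ (j %% 2) = b ^+ j); last first.
  by rewrite -expgnDr -divn_eq.
rewrite [(_ * n)%N]mulnC [(_ * 2)%N]mulnC !expgnA expg2.
set X := a ^+ n ^+ _; set T := (b * b) ^+ _; set r := a ^+ (i %% n).
by rewrite -(mulgA (s * X) (T ^ r^-1) r) -conjgCV !mulgA.
Qed.

End NormalForm.

(** * The group presented by generators and relations *)

Section Presented.
Variables (I : Type) (rel : word I -> word I -> Prop).
Local Notation cong := (word_cong rel).

Lemma word_invK (w : word I) : word_inv (word_inv w) = w.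
Proof.
rewrite /word_inv map_rev revK.
by elim: w => [|[i e] w IH] //=; rewrite negbK IH.
Qed.

Lemma word_cong_mulV (w : word I) : cong (w ++ word_inv w) [::].
Proof.
elim: w => [|[i e] w IH]; first exact: WordRefl.
have -> : ((i, e) :: w) ++ word_inv ((i, e) :: w) =
    [:: (i, e)] ++ ((w ++ word_inv w) ++ [:: (i, ~~ e)]).
  by rewrite /word_inv /= rev_cons -cats1 catA.
apply: WordTrans (WordCancel rel i e).
apply: (WordCat (v' := [::] ++ [:: (i, ~~ e)]) (WordRefl rel [:: (i, e)])).
by apply: WordCat => //; exact: WordRefl.
Qed.

Lemma word_cong_Vmul (w : word I) : cong (word_inv w ++ w) [::].
Proof. by rewrite -{2}(word_invK w); exact: word_cong_mulV. Qed.

Lemma word_cong_inv u v : cong u v -> cong (word_inv u) (word_inv v).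
Proof.
move=> uv; apply: (@WordTrans _ _ _ (word_inv u ++ (v ++ word_inv v))).
  rewrite -{1}[word_inv u]cats0; apply: WordCat; first exact: WordRefl.
  by apply: WordSym; exact: word_cong_mulV.
rewrite catA -[X in cong _ X]cat0s; apply: WordCat; last exact: WordRefl.
apply: WordTrans (word_cong_Vmul u); apply: WordCat; first exact: WordRefl.
exact: WordSym.
Qed.

(** A name to which the classical equality and choice structures are attached, as the letters come
    without any. *)
Definition pres_word : Type := word I.
HB.instance Definition _ := gen_eqMixin pres_word.
HB.instance Definition _ := gen_choiceMixin pres_word.

Definition congb (u v : pres_word) : bool := `[< cong u v >].

Lemma congb_refl : reflexive congb.
Proof. by move=> u; apply/asboolP; exact: WordRefl. Qed.

Lemma congb_sym : symmetric congb.
Proof. by move=> u v; apply/asboolP/asboolP; exact: WordSym. Qed.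

Lemma congb_trans : transitive congb.
Proof. by move=> v u w /asboolP uv /asboolP vw; apply/asboolP; exact: WordTrans vw. Qed.

Canonical cong_equiv := EquivRel congb congb_refl congb_sym congb_trans.

Local Open Scope quotient_scope.

Definition pres_group := {eq_quot cong_equiv}.
HB.instance Definition _ := EqQuotient.on pres_group.
HB.instance Definition _ := Choice.on pres_group.

Definition word_class (w : word I) : pres_group := \pi_pres_group (w : pres_word).

Lemma word_classP u v : word_class u = word_class v <-> cong u v.
Proof. by split=> [/eqmodP/asboolP|uv] //; apply/eqmodP/asboolP. Qed.

Lemma word_classK (g : pres_group) : word_class (repr g) = g.
Proof. exact: reprK. Qed.

Definition pres_mul (g h : pres_group) : pres_group := word_class ((repr g : word I) ++ repr h).
Definition pres_one : pres_group := word_class [::].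
Definition pres_inv (g : pres_group) : pres_group := word_class (word_inv (repr g)).

Lemma pres_mulE u v : pres_mul (word_class u) (word_class v) = word_class (u ++ v).
Proof. by apply/word_classP; apply: WordCat; apply/word_classP/word_classK. Qed.

Lemma pres_invE u : pres_inv (word_class u) = word_class (word_inv u).
Proof. by apply/word_classP/word_cong_inv/word_classP/word_classK. Qed.

Lemma pres_mulA : associative pres_mul.
Proof.
move=> f g h; rewrite -(word_classK f) -(word_classK g) -(word_classK h).
by rewrite !pres_mulE catA.
Qed.

Lemma pres_mul1 : left_id pres_one pres_mul.
Proof. by move=> g; rewrite -(word_classK g) pres_mulE. Qed.

Lemma pres_mulr1 : right_id pres_one pres_mul.
Proof. by move=> g; rewrite -(word_classK g) pres_mulE cats0. Qed.

Lemma pres_mulV : left_inverse pres_one pres_inv pres_mul.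
Proof.
move=> g; rewrite -(word_classK g) pres_invE pres_mulE.
exact/word_classP/word_cong_Vmul.
Qed.

Lemma pres_mulrV : right_inverse pres_one pres_inv pres_mul.
Proof.
move=> g; rewrite -(word_classK g) pres_invE pres_mulE.
exact/word_classP/word_cong_mulV.
Qed.

HB.instance Definition _ := isGroup.Build pres_group
  pres_mulA pres_mul1 pres_mulr1 pres_mulV pres_mulrV.

Definition pres_gen (i : I) : pres_group := word_class [:: (i, false)].

Lemma word_eval_pres w : word_eval pres_gen w = word_class w.
Proof.
elim: w => [|[i e] w IH]; first by rewrite /word_eval big_nil.
rewrite /word_eval big_cons -/(word_eval pres_gen w) IH -cat1s -pres_mulE.
congr pres_mul; case: e => //=.
by rewrite -[LHS]/(pres_inv _) pres_invE.
Qed.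

End Presented.

(** * Evaluation of words in a group *)

Section WordEval.
Variables (I : Type) (H : groupType) (f : I -> H).
Local Open Scope group_scope.

Lemma word_eval_cat u v : word_eval f (u ++ v) = word_eval f u * word_eval f v.
Proof. by rewrite /word_eval big_cat. Qed.

Lemma word_eval1 i : word_eval f [:: (i, false)] = f i.
Proof. by rewrite /word_eval big_seq1. Qed.

Lemma word_eval_inv u : word_eval f (word_inv u) = (word_eval f u)^-1.
Proof.
elim: u => [|[i e] u IH]; first by rewrite /word_eval !big_nil invg1.
rewrite /word_inv /= rev_cons -cats1 -/(word_inv u) word_eval_cat IH.
rewrite -(cat1s (i, e) u) word_eval_cat invMg /word_eval !big_seq1 /=.
by case: e; rewrite //= invgK.
Qed.

Lemma word_eval_cong (rel : word I -> word I -> Prop) u v :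
  (forall u v, rel u v -> word_eval f u = word_eval f v) ->
  word_cong rel u v -> word_eval f u = word_eval f v.
Proof.
move=> fr; elim=> //.
- by move=> {}u {}v w _ -> _ ->.
- by move=> {}u u' {}v v' _ e _ e'; rewrite !word_eval_cat e e'.
- by move=> i e; rewrite /word_eval big_cons big_seq1 big_nil; case: e; rewrite ?mulgV ?mulVg.
Qed.

End WordEval.

(* The edges of C_n are numbered by e_p = {p, p + 1} for p < n and e_n = {1, n}. *)
Definition eidx (n p q : nat) : nat :=
  if q == p.+1 then p else if p == q.+1 then q else n.

Lemma eidxP n p q : (q = p.+1 /\ eidx n p q = p) \/ (q <> p.+1 /\ p = q.+1 /\ eidx n p q = q)
  \/ (q <> p.+1 /\ p <> q.+1 /\ eidx n p q = n).
Proof. by rewrite /eidx; do ![case: ifPn => /eqP]; intuition. Qed.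

Lemma rot_aP n p : (p = n /\ rot_a n p = 1%N) \/ (p <> n /\ rot_a n p = p.+1).
Proof. by rewrite /rot_a; case: eqP; intuition. Qed.

Lemma refl_bP n p : (p = 1%N /\ refl_b n p = 1%N) \/ (p <> 1%N /\ refl_b n p = (n + 2 - p)%N).
Proof. by rewrite /refl_b; case: eqP; intuition. Qed.

(** * The presentation *)

Section CycleValues.
Variables (R : realType) (n : nat) (n_gt3 : (3 < n)%N) (x : line_point R n) (cw : bool).
Let G := cycle_graph n.
Let B := braid_group G (line_base x).
Implicit Types (u v : B) (f g : nat -> nat) (F : nat -> int).
Local Notation ht := (halfturn R cw).

Lemma halfturn_neq0 : ht != 0.
Proof. by rewrite /halfturn mulf_neq0 ?expf_neq0 ?oppr_eq0 ?oner_eq0 // gt_eqF // pi_gt0. Qed.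

Lemma cycle_cases (j k : 'I_n) : G j k ->
  [\/ (k = j.+1 :> nat), (j = k.+1 :> nat), (j = 0 :> nat /\ k.+1 = n) | (k = 0 :> nat /\ j.+1 = n)].
Proof.
rewrite /G /= /cycle_adj /cycle_edge /= !xpair_eqE => h.
case: (eqVneq (k : nat) j.+1) => [->|h1]; first by constructor 1.
case: (eqVneq (j : nat) k.+1) => [->|h2]; first by constructor 2.
case: (ltnP j k) => jk; [constructor 3|constructor 4]; lia.
Qed.

Lemma cycle_neq (j k : 'I_n) : G j k -> j != k.
Proof. by apply: contraTneq => ->; rewrite adj_irr. Qed.

(* The permutation f of a braid on labels, its action g on edges, and its
   number F of half turns around each edge. *)
Definition profile u f g F : Prop :=
  [/\ forall k : 'I_n, (braid_perm u k).+1 = f k.+1,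
      forall j k : 'I_n, G j k -> eidx n (f j.+1) (f k.+1) = g (eidx n j.+1 k.+1) &
      forall j k : 'I_n, G j k -> turning u j k = ht * (F (eidx n j.+1 k.+1))%:~R].

Lemma eidx_range (j k : 'I_n) : G j k -> (0 < eidx n j.+1 k.+1 <= n)%N.
Proof.
move=> jk; have := ltn_ord j; have := ltn_ord k; rewrite /eidx.
by case: (cycle_cases jk) => [||[]|[]]; do ![case: ifP => //]; lia.
Qed.

Lemma profile1 : profile 1%g id id (fun=> 0).
Proof.
split=> // [k|j k jk]; first by rewrite braid_perm1 perm1.
by rewrite turning1 // mulr0.
Qed.

Lemma profileM u v f g F f' g' F' : profile u f g F -> profile v f' g' F' ->
  profile (u * v)%g (f' \o f) (g' \o g) (fun e => F e + F' (g e)).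
Proof.
move=> [p1 p2 p3] [q1 q2 q3]; split=> [k|j k jk|j k jk] /=.
- by rewrite braid_permM permM q1 p1.
- have jk' : G (braid_perm u j) (braid_perm u k) by rewrite adj_braid_perm.
  by rewrite -!p1 q2 // !p1 p2.
- have jk' : G (braid_perm u j) (braid_perm u k) by rewrite adj_braid_perm.
  by rewrite turningM // p3 // q3 // !p1 p2 // -mulrDr intrD.
Qed.

(** The braid [u * v^-1] is pure, and comparing turns in [(u * v^-1) * v = u] shows that it has none
    along the edges; [turning_eq0] concludes. Every relation between braids is verified through this
    lemma. *)
Lemma profile_inj u v f g F f' g' F' : profile u f g F -> profile v f' g' F' ->
  (forall p, 0 < p <= n -> f p = f' p)%N ->
  (forall e, (0 < e <= n)%N -> F e = F' e) -> u = v.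
Proof.
move=> [p1 _ p3] [q1 _ q3] ff FF.
have uv : braid_perm u = braid_perm v.
  by apply/permP => k; apply: val_inj; apply: succn_inj; rewrite p1 q1 ff //= ltn_ord.
have w1 : braid_perm (u * v^-1)%g = 1%g by rewrite braid_permM braid_permV uv mulgV.
suff : (u * v^-1)%g = 1%g by move/(canRL (mulgKV v)); rewrite mul1g.
apply: turning_eq0 => // j k jk.
have := turningM (u * v^-1)%g v jk; rewrite mulgKV w1 !perm1 p3 // q3 // FF ?eidx_range //.
by move/eqP; rewrite -[X in X == _]add0r (inj_eq (addIr _)) eq_sym => /eqP.
Qed.

Lemma half_turns_i_star (u : artin_group (line_base x)) N (j k : 'I_n) :
  braid_perm u \in graph_aut G -> half_turns cw u N -> G j k ->
  turning (i_star G u) j k = ht * (N j.+1 k.+1)%:~R.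
Proof. by move=> uG uN jk; rewrite turning_i_star // uN ?cycle_neq. Qed.

Definition F_s (d e : nat) : int := if e == d then 2 else 0.
(** In [a_{1,n}] the string [n] crosses each other string once, and the edges at the vertex [n] are
    those numbered [n - 1] and [n]. *)
Definition F_a (e : nat) : int := if (n.-1 <= e)%N then 1 else 0.
(** Edges 1 and [n] contain the vertex 1, which takes no part in [psi(b)]. The signs at [e] and
    [n + 1 - e] are opposite except at the middle edge [2 e = n + 1], present for odd [n] only;
    counted twice it produces the [s] in [psi(b)^2]. *)
Definition F_b (e : nat) : int :=
  if (e == 1%N) || (e == n) then 0 else if (e.*2 < n.+1)%N then -1 else 1.

Lemma profile_s i j : cycle_edge n (i, j) ->
  profile (i_star G (s_elt x cw i j)) id id (F_s (eidx n i j)).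
Proof.
move=> ij; have s1 := s_dom x cw i j.
have sG : braid_perm (s_elt x cw i j) \in graph_aut G by rewrite s1 group1.
have [ij1 jn] : (0 < i < j)%N /\ (j <= n)%N by move: ij; rewrite /cycle_edge /=; lia.
split=> // [k|p q pq]; first by rewrite braid_perm_i_star // s1 perm1.
rewrite (half_turns_i_star sG (half_turns_s x cw ij1 jn)) //; congr (_ * _%:~R).
move: ij; rewrite /cycle_edge /= xpair_eqE /n_s /F_s /eidx => ij.
have := ltn_ord p; have := ltn_ord q; move: (cycle_cases pq).
by case=> [||[]|[]]; do ![case: ifP => //]; lia.
Qed.

Lemma profile_a : profile (psi_a x cw) (rot_a n) (rot_a n) F_a.
Proof.
have aG := psi_a_dom x cw n_gt3; split=> [k|j k jk|j k jk].
- by rewrite braid_perm_i_star // psi_a_lab.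
- have := ltn_ord j; have := ltn_ord k; have := cycle_cases jk.
  have := rot_aP n j.+1; have := rot_aP n k.+1; have := rot_aP n (eidx n j.+1 k.+1).
  have := eidxP n j.+1 k.+1; have := eidxP n (rot_a n j.+1) (rot_a n k.+1).
  by move=> h1 h2 h3 h4 h5 [||[]|[]] *; lia.
rewrite (half_turns_i_star aG (@half_turns_a _ _ x cw 1 n _ _)) //; last by lia.
congr (_ * _%:~R); rewrite /n_a /F_a /eidx.
have := ltn_ord j; have := ltn_ord k; move: (cycle_cases jk).
by case=> [||[]|[]]; do ![case: ifP => //]; lia.
Qed.

Definition b_partial (m p : nat) : nat :=
  if ((2 <= p < m) || (2 <= n + 2 - p < m))%N then (n + 2 - p)%N else p.

Definition F_b_partial (m e : nat) : int :=
  if ((e == 1) || (e == n))%N then 0 else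
  if ((e < m) && (e.*2 < n.+1))%N then -1 else
  if ((n.+1 - e < m) && (n < e.*2))%N then 1 else 0.

(** The contribution of the factor [e_{m, n+2-m}]. The earlier factors have left the ends of the
    edges [m] and [n + 1 - m] in place and moved the outer ones outside, so only these two edges
    count; they coincide in the last factor for odd [n]. *)
Definition F_b_step (m e : nat) : int :=
  if ((e == 1) || (e == n))%N then 0 else
  if (e == m)%N then (if (e.*2 < n.+1)%N then -1 else 1) else
  if (e == n.+1 - m)%N then 1 else 0.

Lemma F_b_partialS m e : (1 < m < n + 2 - m)%N -> (0 < e <= n)%N ->
  F_b_partial m.+1 e = F_b_partial m e + F_b_step m e.
Proof.
move=> hm he; rewrite /F_b_partial /F_b_step.
case: ifP => // h1; case: (ltngtP e.*2 n.+1) => h2; rewrite /= ?andbT ?andbF;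
  by do ![case: ifP => ?]; lia.
Qed.

Lemma b_partialP m p : (1 < m < n + 2 - m)%N -> (0 < p <= n)%N ->
  [\/ (m <= p <= n + 2 - m /\ b_partial m p = p)%N, p = 1%N /\ b_partial m p = 1%N,
      (1 < p < m /\ b_partial m p = n + 2 - p)%N |
      (n + 2 - m < p /\ b_partial m p = n + 2 - p)%N].
Proof.
rewrite /b_partial => hm hp; case: (ltnP p m) => pm.
  case: (eqVneq p 1%N) => p1.
    by constructor 2; rewrite ifF //; lia.
  by constructor 3; rewrite ifT //; lia.
case: (ltnP (n + 2 - m) p) => pl; [constructor 4; rewrite ifT //; lia|].
by constructor 1; rewrite ifF //; lia.
Qed.

Lemma n_eC k l p q : n_e k l p q = n_e k l q p.
Proof. by rewrite /n_e [X in if X then 1 else _]orbC [X in if X then -1 else _]orbC. Qed.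

Lemma n_e_step m e : (1 < m < n + 2 - m)%N -> (0 < e < n)%N ->
  n_e m (n + 2 - m) (b_partial m e) (b_partial m e.+1) = F_b_step m e.
Proof.
move=> hm he; have [||||] := @b_partialP m e hm; first lia;
  move=> [hp ->]; have [||||] := @b_partialP m e.+1 hm; try lia;
  move=> [hq ->]; try lia; rewrite /n_e /F_b_step;
  by do ![case: ifP => ?]; lia.
Qed.

Lemma n_e_step_n m : (1 < m < n + 2 - m)%N ->
  n_e m (n + 2 - m) (b_partial m 1) (b_partial m n) = F_b_step m n.
Proof.
move=> hm; have [||||] := @b_partialP m 1 hm; first lia;
  move=> [hp ->]; try lia; have [||||] := @b_partialP m n hm; try lia;
  move=> [hq ->]; try lia; rewrite /n_e /F_b_step eqxx orbT;
  by do ![case: ifP => ?]; lia.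
Qed.

Definition b_prod (m : nat) : artin_group (line_base x) :=
  (\prod_(2 <= k < m) e_elt x cw k (n + 2 - k))%g.

Lemma b_prod_spec m : (2 <= m <= (uphalf n).+1)%N ->
  (forall k : 'I_n, (braid_perm (b_prod m) k).+1 = b_partial m k.+1) /\
  forall j k : 'I_n, G j k -> turning (b_prod m) j k = ht * (F_b_partial m (eidx n j.+1 k.+1))%:~R.
Proof.
elim: m => // m IH; have [m1 _|m1 mn] := leqP m 1.
  rewrite /b_prod big_geq //; split=> [k|j k jk].
    by rewrite braid_perm1 perm1 /b_partial; case: ifP => //; lia.
  have jk0 : complete_graph n j k := cycle_neq jk.
  rewrite turning1 // (_ : F_b_partial _ _ = 0) ?mulr0 //.
  rewrite /F_b_partial; have := eidx_range jk; move: (eidx _ _ _) => e he.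
  by do ![case: ifP => //]; lia.
have [IH1 IH2] := IH ltac:(lia).
have ml : (0 < m < n + 2 - m)%N by lia.
have ln : (n + 2 - m <= n)%N by lia.
rewrite /b_prod big_nat_recr // -/(b_prod m); split=> [k|j k jk].
  rewrite braid_permM permM e_lab // IH1 /elab /b_partial.
  have := ltn_ord k; do ![case: ifP => //]; lia.
have jk0 : complete_graph n j k := cycle_neq jk.
rewrite turningM // IH2 // (half_turns_e x cw ml ln) ?(inj_eq perm_inj) // !IH1 -mulrDr -intrD.
have hm : (1 < m < n + 2 - m)%N by lia.
rewrite F_b_partialS //; last exact: eidx_range.
congr (_ * (_ + _)%:~R); have := ltn_ord j; have := ltn_ord k.
have := eidxP n j.+1 k.+1; case: (cycle_cases jk) => [ek|ej|[ej ek]|[ek ej]].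
- by rewrite ek => [[[_ ->]|]] ? ?; [rewrite n_e_step //|]; lia.
- by rewrite ej => [[|[[_ [_ ->]]|]]] ? ?; [|rewrite n_eC n_e_step //|]; lia.
- by rewrite ej ek => [[|[|[_ [_ ->]]]]] ? ?; [| |rewrite n_e_step_n]; lia.
- by rewrite ej ek => [[|[|[_ [_ ->]]]]] ? ?; [| |rewrite n_eC n_e_step_n]; lia.
Qed.

Lemma profile_b : profile (psi_b x cw) (refl_b n) (fun e => (n.+1 - e)%N) F_b.
Proof.
have bG := psi_b_dom x cw n_gt3; split=> [k|j k jk|j k jk].
- by rewrite braid_perm_i_star // psi_b_lab.
- have := ltn_ord j; have := ltn_ord k; have := cycle_cases jk.
  have := refl_bP n j.+1; have := refl_bP n k.+1.
  have := eidxP n j.+1 k.+1; have := eidxP n (refl_b n j.+1) (refl_b n k.+1).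
  by move=> h1 h2 h3 h4 [||[]|[]] *; lia.
have [|_ hb] := @b_prod_spec (uphalf n).+1; first lia.
rewrite turning_i_star // hb //; congr (_ * _%:~R); rewrite /F_b /F_b_partial.
have := eidx_range jk; move: (eidx _ _ _) => e he.
by do ![case: ifP => //]; lia.
Qed.

End CycleValues.

(** * Words in the letters of the edges *)

Section Letters.
Variables (n : nat) (n_gt3 : (3 < n)%N) (H : groupType) (f : cycle_gen n -> H).
Local Open Scope group_scope.

(** For [e] outside [1, ..., n] this is the empty word, so that the letters commute for all
    indices. *)
Definition edge_word (e : nat) : word (cycle_gen n) := if e == n then wS n 1 n else wS n e e.+1.

Lemma wS_edge_word i j : cycle_edge n (i, j) -> wS n i j = edge_word (eidx n i j).
Proof.
rewrite /cycle_edge /= xpair_eqE /edge_word => ij; have := eidxP n i j.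
case: eqP => [->|h] h'; last by congr wS; lia.
by have [-> ->] : i = 1%N /\ j = n by lia.
Qed.

Lemma eval_wS i j (ij : cycle_edge n (i, j)) :
  word_eval f (wS n i j) = f (GenS (exist _ (i, j) ij)).
Proof. by rewrite /wS insubT word_eval1. Qed.

Lemma edge_word_nil e : ~~ (0 < e <= n)%N -> edge_word e = [::].
Proof.
move=> he; rewrite /edge_word ifF; last by lia.
by rewrite /wS insubN // /cycle_edge /= xpair_eqE; lia.
Qed.

Lemma cycle_edge_succ e : (0 < e < n)%N -> cycle_edge n (e, e.+1).
Proof. by rewrite /cycle_edge /= eqxx; lia. Qed.

Lemma cycle_edge_1n : cycle_edge n (1%N, n).
Proof. by rewrite /cycle_edge /= eqxx orbT; lia. Qed.

Lemma eidx_succ e : eidx n e e.+1 = e.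
Proof. by rewrite /eidx eqxx. Qed.

Lemma eidx_1n : eidx n 1 n = n.
Proof. by have := eidxP n 1 n; lia. Qed.

Definition monom_word (p : nat -> nat) : word (cycle_gen n) :=
  flatten [seq flatten (nseq (p e) (edge_word e)) | e <- index_iota 1 n.+1].

Lemma eval_nseq k w : word_eval f (flatten (nseq k w)) = word_eval f w ^+ k.
Proof.
elim: k => [|k IH]; first by rewrite /word_eval big_nil.
by rewrite /= word_eval_cat IH expgS.
Qed.

Lemma eval_flatten (I : Type) (s : seq I) (F : I -> word (cycle_gen n)) :
  word_eval f (flatten [seq F i | i <- s]) = \prod_(i <- s) word_eval f (F i).
Proof.
elim: s => [|i s IH]; first by rewrite /word_eval !big_nil.
by rewrite /= word_eval_cat IH big_cons.
Qed.

Lemma eval_monom_word p : word_eval f (monom_word p) = monom n (fun e => word_eval f (edge_word e)) p.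
Proof. by rewrite eval_flatten; apply: eq_bigr => e _; rewrite eval_nseq. Qed.

End Letters.

(** * The relations hold for braids *)

Section Relations.
Variables (R : realType) (n : nat) (n_gt3 : (3 < n)%N) (x : line_point R n) (cw : bool).
Let f := @cycle_gen_val R n x cw.
Local Open Scope group_scope.
Local Notation prof := (@profile R n x cw).

Lemma profile_ext u l l' g g' (F F' : nat -> int) : prof u l g F ->
  (forall p, 0 < p <= n -> l p = l' p)%N -> (forall e, 0 < e <= n -> g e = g' e)%N ->
  (forall e, (0 < e <= n)%N -> F e = F' e) -> prof u l' g' F'.
Proof.
move=> [h1 h2 h3] ll gg FF; split=> [k|j k jk|j k jk].
- by rewrite h1 ll //= ltn_ord.
- by rewrite -!ll ?ltn_ord // h2 // gg // eidx_range.
- by rewrite h3 // FF // eidx_range.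
Qed.

Lemma profile_wS i j : cycle_edge n (i, j) ->
  prof (word_eval f (wS n i j)) id id (F_s (eidx n i j)).
Proof. by move=> ij; rewrite (eval_wS _ ij); exact: profile_s. Qed.

Lemma profile_edge_word e : prof (word_eval f (edge_word n e)) id id (F_s e).
Proof.
case: (boolP (0 < e <= n)%N) => he.
  rewrite /edge_word; case: eqP => [->|ne].
    by have := profile_wS (cycle_edge_1n n_gt3); rewrite (eidx_1n n_gt3).
  have es : cycle_edge n (e, e.+1) by apply: cycle_edge_succ; lia.
  by have := profile_wS es; rewrite eidx_succ.
rewrite edge_word_nil // /word_eval big_nil; apply: (profile_ext (profile1 x cw)) => // d hd.
by rewrite /F_s ifF //; lia.
Qed.

Lemma profile_wA : prof (word_eval f (wA n)) (rot_a n) (rot_a n) (F_a n).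
Proof. by rewrite word_eval1; exact: profile_a. Qed.

Lemma profile_wB : prof (word_eval f (wB n)) (refl_b n) (fun e => (n.+1 - e)%N) (F_b n).
Proof. by rewrite word_eval1; exact: profile_b. Qed.

(** Clearing the inverse leaves two products, whose profiles follow from [profileM]. *)
Lemma eval_conj (w s s' : word (cycle_gen n)) :
  word_eval f s * word_eval f w = word_eval f w * word_eval f s' ->
  word_eval f (word_inv w ++ s ++ w) = word_eval f s'.
Proof. by rewrite !word_eval_cat word_eval_inv => ->; rewrite mulKg. Qed.

Lemma rel_a i j i' j' : cycle_edge n (i, j) -> cycle_edge n (i', j') ->
  rot_a n (eidx n i j) = eidx n i' j' ->
  word_eval f (word_inv (wA n) ++ wS n i j ++ wA n) = word_eval f (wS n i' j').
Proof.
move=> ij ij' e; apply: eval_conj.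
apply: (profile_inj n_gt3 (profileM (profile_wS ij) profile_wA)
  (profileM profile_wA (profile_wS ij'))) => // d hd.
rewrite addrC /=; congr (_ + _)%R; rewrite -e /F_s.
have he : (0 < eidx n i j <= n)%N.
  by have := eidxP n i j; move: ij; rewrite /cycle_edge /= xpair_eqE; lia.
by have := rot_aP n d; have := rot_aP n (eidx n i j); do ![case: ifP => ?]; lia.
Qed.

Lemma rel_b i j i' j' : cycle_edge n (i, j) -> cycle_edge n (i', j') ->
  (n.+1 - eidx n i j)%N = eidx n i' j' ->
  word_eval f (word_inv (wB n) ++ wS n i j ++ wB n) = word_eval f (wS n i' j').
Proof.
move=> ij ij' e; apply: eval_conj.
apply: (profile_inj n_gt3 (profileM (profile_wS ij) profile_wB)
  (profileM profile_wB (profile_wS ij'))) => // d hd.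
rewrite addrC /=; congr (_ + _)%R; rewrite -e /F_s.
have he : (0 < eidx n i j <= n)%N.
  by have := eidxP n i j; move: ij; rewrite /cycle_edge /= xpair_eqE; lia.
by do ![case: ifP => ?]; lia.
Qed.

Definition rot_pow (r p : nat) : nat := if (p + r <= n)%N then (p + r)%N else (p + r - n)%N.
(** The edge successively occupies [e, ..., e + r - 1] modulo [n], and [F_a] counts its visits to
    [n - 1] and [n]. For [r <= n] these are the values [n - 1], [n] and [2 n - 1] of the unreduced
    index, the last one only for [e = r = n]. *)
Definition F_rot_pow (r e : nat) : int :=
  ((if (e <= n.-1 < e + r)%N then 1 else 0) + (if (n < e + r)%N then 1 else 0)
  + (if (n.-1 + n < e + r)%N then 1 else 0))%R.

Lemma profile_aX r : (r <= n)%N -> prof (psi_a x cw ^+ r) (rot_pow r) (rot_pow r) (F_rot_pow r).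
Proof.
elim: r => [_|r IH rn].
  rewrite expg0; apply: (profile_ext (profile1 x cw)) => e he; rewrite /rot_pow /F_rot_pow ?addn0.
  - by case: ifP; lia.
  - by case: ifP; lia.
  - by do ![case: ifP => ?]; lia.
rewrite expgSr; apply: (profile_ext (profileM (IH (ltnW rn)) (profile_a n_gt3 x cw))) => e he /=.
- by have := rot_aP n (rot_pow r e); rewrite /rot_pow; do ![case: ifP => ?]; lia.
- by have := rot_aP n (rot_pow r e); rewrite /rot_pow; do ![case: ifP => ?]; lia.
rewrite /F_rot_pow /F_a /rot_pow; case: (ltnP n (e + r)) => h1; case: (ltnP n (e + r.+1)) => h2;
  do ![case: ifP => ?]; lia.
Qed.

Lemma profile_succs m : (m < n)%N ->
  prof (word_eval f (flatten [seq wS n i i.+1 | i <- rev (iota 1 m)])) id id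
    (fun e => if (0 < e <= m)%N then 2%R else 0%R).
Proof.
elim: m => [_|m IH mn].
  rewrite /word_eval big_nil; apply: (profile_ext (profile1 x cw)) => // e he.
  by case: ifP => //; lia.
rewrite -[m.+1]addn1 iotaD rev_cat map_cat flatten_cat /= cats0 word_eval_cat.
have em : cycle_edge n (1 + m, (1 + m).+1)%N by apply: cycle_edge_succ; lia.
apply: (profile_ext (profileM (profile_wS em) (IH (ltnW mn)))) => // e he /=.
by rewrite eidx_succ /F_s; do ![case: ifP => ?]; lia.
Qed.

(* The half turns of psi(b) psi(a) psi(b) psi(a) around the edge e. *)
Lemma F_ba e : (0 < e <= n)%N ->
  (F_b n e + (F_a n (n.+1 - e) + (F_b n (rot_a n (n.+1 - e)) +
     F_a n (n.+1 - rot_a n (n.+1 - e)))) =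
   if ((e == 1) || (n.+1 < e.*2 < n + 4) || (e.*2 == n.+1))%N then 2 else 0)%R.
Proof.
move=> he; have Fa d : (n.-1 <= d)%N -> F_a n d = 1%R by rewrite /F_a => ->.
have Fa0 d : (d < n.-1)%N -> F_a n d = 0%R by rewrite /F_a ltnNge => /negbTE ->.
have Fb0 d : (d == 1%N) || (d == n) -> F_b n d = 0%R by rewrite /F_b => ->.
have Fb d : (1 < d < n)%N -> F_b n d = (if (d.*2 < n.+1)%N then -1 else 1)%R.
  by move=> hd; rewrite /F_b ifF //; lia.
have := rot_aP n (n.+1 - e); move: (rot_a n _) => r hr.
(* Apart from [e = 1, 2, n], neither [e] nor [r] is 1 or [n], and both arguments of [F_a] are below
   [n - 1]. *)
case: (eqVneq e 1%N) => [e1|e1].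
  by rewrite e1 /= in hr *; rewrite !Fb0 ?Fa //; lia.
case: (eqVneq e 2) => [e2|e2].
  rewrite (Fb e) ?(Fb0 r) ?(Fa (n.+1 - e)%N) ?(Fa0 (n.+1 - r)%N); [|lia..].
  by do ![case: ifP => ?]; lia.
case: (eqVneq e n) => [en|en].
  rewrite (Fb0 e) ?(Fb r) ?(Fa0 (n.+1 - e)%N) ?(Fa (n.+1 - r)%N); [|lia..].
  by do ![case: ifP => ?]; lia.
rewrite (Fb e) ?(Fb r) ?(Fa0 (n.+1 - e)%N) ?(Fa0 (n.+1 - r)%N); [|lia..].
by do ![case: ifP => ?]; lia.
Qed.

Lemma braid_rel u v : cycle_rel u v -> word_eval f u = word_eval f v.
Proof.
have e1n := cycle_edge_1n n_gt3.
have esucc e : (0 < e < n)%N -> cycle_edge n (e, e.+1) by exact: cycle_edge_succ.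
case=> {u v}.
- move=> i j k l ij kl; rewrite !word_eval_cat.
  apply: (profile_inj n_gt3 (profileM (profile_wS ij) (profile_wS kl))
    (profileM (profile_wS kl) (profile_wS ij))) => // e _; exact: addrC.
- move=> i hi; have -> : rot_a n i = i.+1 by have := rot_aP n i; lia.
  have -> : rot_a n i.+1 = i.+2 by have := rot_aP n i.+1; lia.
  apply: rel_a; [apply: esucc; lia|apply: esucc; lia|].
  by rewrite !eidx_succ; have := rot_aP n i; lia.
- have -> : rot_a n n = 1%N by have := rot_aP n n; lia.
  have -> : rot_a n 1 = 2%N by have := rot_aP n 1; lia.
  apply: rel_a => //; first by apply: esucc; lia.
  by rewrite (eidx_1n n_gt3) eidx_succ; have := rot_aP n n; lia.
- have -> : rot_a n n = 1%N by have := rot_aP n n; lia.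
  have -> : rot_a n (n - 1) = n by have := rot_aP n (n - 1); lia.
  have h : cycle_edge n ((n - 1)%N, n) by rewrite /cycle_edge /=; lia.
  apply: rel_a => //.
  by rewrite (eidx_1n n_gt3); have := eidxP n (n - 1) n; have := rot_aP n (eidx n (n - 1) n); lia.
- move=> i hi; have -> : refl_b n i = (n.+1 - i).+1 by have := refl_bP n i; lia.
  have -> : refl_b n i.+1 = (n.+1 - i)%N by have := refl_bP n i.+1; lia.
  apply: rel_b; [apply: esucc; lia|apply: esucc; lia|].
  by rewrite !eidx_succ.
- have -> : refl_b n 1 = 1%N by [].
  have -> : refl_b n 2 = n by have := refl_bP n 2; lia.
  by apply: rel_b => //; rewrite ?(eidx_1n n_gt3) ?eidx_succ ?esucc //; lia.
- have -> : refl_b n 1 = 1%N by [].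
  have -> : refl_b n n = 2%N by have := refl_bP n n; lia.
  by apply: rel_b => //; rewrite ?(eidx_1n n_gt3) ?eidx_succ ?esucc //; lia.
- rewrite eval_nseq word_eval1 word_eval_cat.
  have n1 : (n - 1 < n)%N by lia.
  apply: (profile_inj n_gt3 (profile_aX (leqnn n))
     (profileM (profile_wS e1n) (profile_succs n1))) => e he /=.
    by rewrite /rot_pow; case: ifP => ?; lia.
  by rewrite (eidx_1n n_gt3) /F_rot_pow /F_s; do ![case: ifP => ?]; lia.
- move=> odn; rewrite word_eval_cat [RHS]big_nil.
  apply: (profile_inj n_gt3 (profileM profile_wB profile_wB) (profile1 x cw)) => e he /=.
    by have := refl_bP n e; have := refl_bP n (refl_b n e); lia.
  by rewrite /F_b; do ![case: ifP => ?]; lia.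
- move=> odn; rewrite word_eval_cat.
  have e0 : ((n + 3) %/ 2 = ((n + 1) %/ 2).+1)%N by lia.
  rewrite e0; have ed := esucc ((n + 1) %/ 2)%N ltac:(lia).
  apply: (profile_inj n_gt3 (profileM profile_wB profile_wB) (profile_wS ed)) => e he /=.
    by have := refl_bP n e; have := refl_bP n (refl_b n e); lia.
  by rewrite eidx_succ /F_b /F_s; do ![case: ifP => ?]; lia.
- move=> odn; rewrite !word_eval_cat.
  have e0 : ((n + 4) %/ 2 = ((n + 2) %/ 2).+1)%N by lia.
  rewrite e0; have ed := esucc ((n + 2) %/ 2)%N ltac:(lia); have e2 := esucc 1%N ltac:(lia).
  apply: (profile_inj n_gt3
     (profileM profile_wB (profileM profile_wA (profileM profile_wB profile_wA)))
     (profileM (profile_wS e2) (profile_wS ed))) => e he /=.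
    have := refl_bP n e; have := rot_aP n (refl_b n e).
    have := refl_bP n (rot_a n (refl_b n e)); have := rot_aP n (refl_b n (rot_a n (refl_b n e))).
    lia.
  rewrite !eidx_succ F_ba // /F_s; do ![case: ifP => ?]; lia.
- move=> odn; rewrite !word_eval_cat.
  have e0 : ((n + 3) %/ 2 = ((n + 1) %/ 2).+1)%N by lia.
  have e1 : ((n + 5) %/ 2 = ((n + 1) %/ 2).+2)%N by lia.
  rewrite e0 e1; have ed := esucc ((n + 1) %/ 2)%N ltac:(lia); have e2 := esucc 1%N ltac:(lia).
  have ed' := esucc ((n + 1) %/ 2).+1 ltac:(lia).
  apply: (profile_inj n_gt3
     (profileM profile_wB (profileM profile_wA (profileM profile_wB profile_wA)))
     (profileM (profile_wS e2) (profileM (profile_wS ed) (profile_wS ed')))) => e he /=.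
    have := refl_bP n e; have := rot_aP n (refl_b n e).
    have := refl_bP n (rot_a n (refl_b n e)); have := rot_aP n (refl_b n (rot_a n (refl_b n e))).
    lia.
  rewrite !eidx_succ F_ba // /F_s; do ![case: ifP => ?]; lia.
Qed.

End Relations.

(** * Standard form of a word *)

Section StandardWords.
Variables (n : nat) (n_gt3 : (3 < n)%N) (H : groupType) (f : cycle_gen n -> H).
Hypothesis f_rel : forall u v, cycle_rel u v -> word_eval f u = word_eval f v.
Local Open Scope group_scope.
Let S (e : nat) : H := word_eval f (edge_word n e).
Let a : H := f (GenA n).
Let b : H := f (GenB n).

Lemma S_wS i j : cycle_edge n (i, j) -> word_eval f (wS n i j) = S (eidx n i j).
Proof. by move=> ij; rewrite wS_edge_word. Qed.

Lemma S_comm i j : commute (S i) (S j).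
Proof.
have S1 e : ~~ (0 < e <= n)%N -> S e = 1.
  by move=> he; rewrite /S edge_word_nil // /word_eval big_nil.
case: (boolP (0 < i <= n)%N) => hi; last by rewrite (S1 i) //; exact/commute_sym/commute1.
case: (boolP (0 < j <= n)%N) => hj; last by rewrite (S1 j) //; exact/commute1.
have edge e : (0 < e <= n)%N -> exists p q, cycle_edge n (p, q) /\ edge_word n e = wS n p q.
  move=> he; rewrite /edge_word; case: eqP => [_|ne].
    by exists 1%N, n; split=> //; exact: cycle_edge_1n.
  by exists e, e.+1; split=> //; apply: cycle_edge_succ; lia.
have [p [q [pq ei]]] := edge i hi; have [k [l [kl ej]]] := edge j hj.
by rewrite /commute /S ei ej -!word_eval_cat; apply/f_rel/R1.
Qed.

Lemma eval_wJ w s : word_eval f (word_inv w ++ s ++ w) = word_eval f s ^ word_eval f w.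
Proof. by rewrite !word_eval_cat word_eval_inv. Qed.

Lemma S_conj_a e : (0 < e <= n)%N -> S e ^ a = S (rot_a n e).
Proof.
move=> he; have aE : a = word_eval f (wA n) by rewrite word_eval1.
have e1n := cycle_edge_1n n_gt3.
case: (ltnP e (n - 1)) => h1.
  rewrite aE /S {1}/edge_word ifF; last by lia.
  have h : (1 <= e < n - 1)%N by lia.
  rewrite -eval_wJ (f_rel (R2a_succ h)).
  have [[]|[_ ->]] := rot_aP n e; first lia.
  have [[]|[_ ->]] := rot_aP n e.+1; first lia.
  by rewrite S_wS ?eidx_succ //; apply: cycle_edge_succ; lia.
case: (eqVneq e n) => [->|en].
  rewrite aE /S {1}/edge_word eqxx -eval_wJ (f_rel (R2a_1n n)).
  have [[_ ->]|[]] := rot_aP n n; last lia.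
  have [[]|[_ ->]] := rot_aP n 1; first lia.
  by rewrite S_wS ?eidx_succ //; apply: cycle_edge_succ; lia.
have -> : e = (n - 1)%N by lia.
rewrite aE /S {1}/edge_word ifF; last by lia.
have -> : (n - 1).+1 = n by lia.
rewrite -eval_wJ (f_rel (R2a_last n)).
have [[_ ->]|[]] := rot_aP n n; last lia.
have [[]|[_ ->]] := rot_aP n (n - 1); first lia.
have -> : (n - 1).+1 = n by lia.
by rewrite S_wS ?eidx_1n.
Qed.

Lemma S_conj_b e : (0 < e <= n)%N -> S e ^ b = S (n.+1 - e)%N.
Proof.
move=> he; have bE : b = word_eval f (wB n) by rewrite word_eval1.
have e1n := cycle_edge_1n n_gt3.
have r1 : refl_b n 1 = 1%N by [].
case: (eqVneq e n) => [->|en].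
  rewrite bE /S {1}/edge_word eqxx -eval_wJ (f_rel (R2b_1n n)) r1.
  have [[]|[_ ->]] := refl_bP n n; first lia.
  have -> : (n + 2 - n = 2)%N by lia.
  by rewrite S_wS ?eidx_succ ?subSnn //; apply: cycle_edge_succ; lia.
case: (eqVneq e 1%N) => [->|e1].
  rewrite bE /S {1}/edge_word ifF; last by lia.
  rewrite -eval_wJ (f_rel (R2b_12 n)) r1.
  have [[]|[_ ->]] := refl_bP n 2; first lia.
  have -> : (n + 2 - 2 = n)%N by lia.
  by rewrite S_wS ?eidx_1n ?subn1.
rewrite bE /S {1}/edge_word ifF; last by lia.
have h : (1 < e <= n - 1)%N by lia.
rewrite -eval_wJ (f_rel (R2b_succ h)).
have [[]|[_ ->]] := refl_bP n e; first lia.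
have [[]|[_ ->]] := refl_bP n e.+1; first lia.
have -> : (n + 2 - e.+1 = n.+1 - e)%N by lia.
have -> : (n + 2 - e = (n.+1 - e).+1)%N by lia.
by rewrite S_wS ?eidx_succ //; apply: cycle_edge_succ; lia.
Qed.

Lemma rot_a_onto e : (0 < e <= n)%N -> exists2 d, (0 < d <= n)%N & rot_a n d = e.
Proof.
move=> he; case: (eqVneq e 1%N) => [->|e1].
  by exists n; [lia|have := rot_aP n n; lia].
by exists e.-1; [lia|have := rot_aP n e.-1; lia].
Qed.

Lemma edge_refl_onto e : (0 < e <= n)%N -> exists2 d, (0 < d <= n)%N & (n.+1 - d)%N = e.
Proof. by move=> he; exists (n.+1 - e)%N; lia. Qed.

Lemma edgy_wS i j : cycle_edge n (i, j) -> edgy n S (word_eval f (wS n i j)).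
Proof.
move=> ij; rewrite S_wS //; apply: edgyS; first lia.
by have := eidxP n i j; move: ij; rewrite /cycle_edge /= xpair_eqE; lia.
Qed.

Lemma edgy_an : edgy n S (a ^+ n).
Proof.
have -> : a ^+ n = word_eval f (flatten (nseq n (wA n))) by rewrite eval_nseq word_eval1.
rewrite (f_rel (R3_a n)) word_eval_cat eval_flatten; apply: edgyM => //.
- exact: S_comm.
- by apply: edgy_wS; exact: cycle_edge_1n.
rewrite big_seq; apply: edgy_prod; first exact: S_comm.
move=> i; rewrite mem_rev mem_iota => hi; apply/edgy_wS/cycle_edge_succ; lia.
Qed.

Lemma edgy_bb : edgy n S (b * b).
Proof.
have -> : b * b = word_eval f (wB n ++ wB n) by rewrite word_eval_cat !word_eval1.
case: (boolP (odd n)) => odn.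
  rewrite (f_rel (R3_b_odd odn)); apply: edgy_wS.
  by rewrite /cycle_edge /= ?xpair_eqE; lia.
by rewrite (f_rel (R3_b_even odn)) /word_eval big_nil; exact: edgy1.
Qed.

Lemma edgy_ba : edgy n S (b * a * b * a).
Proof.
have -> : b * a * b * a = word_eval f (wB n ++ wA n ++ wB n ++ wA n).
  by rewrite !word_eval_cat !word_eval1 !mulgA.
case: (boolP (odd n)) => odn.
  rewrite (f_rel (R3_ba_odd odn)) !word_eval_cat.
  do ![apply: edgyM; first exact: S_comm]; apply: edgy_wS;
    by rewrite /cycle_edge /= ?xpair_eqE; lia.
rewrite (f_rel (R3_ba_even odn)) !word_eval_cat.
apply: edgyM; first exact: S_comm; apply: edgy_wS;
  by rewrite /cycle_edge /= ?xpair_eqE; lia.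
Qed.

(** Here [f] is any solution of the relations in a group. Taken in the presented group, where
    equality is congruence, the lemma rewrites [w] by means of the relations. *)
Lemma word_standard w : exists p q i j, [/\ (i < n)%N, (j < 2)%N &
  word_eval f w = word_eval f (monom_word n p ++ word_inv (monom_word n q) ++
    flatten (nseq i (wA n)) ++ flatten (nseq j (wB n)))].
Proof.
have n0 : (0 < n)%N by lia.
have eS e : (0 < e <= n)%N -> edgy n S (S e) := @edgyS _ _ _ n0 e.
have st : standard n S a b (word_eval f w).
  elim: w => [|[g e] w IH].
    exists 1, 0%N, 0%N; split; first exact: edgy1.
    by rewrite /word_eval big_nil !mulg1.
  rewrite /word_eval big_cons -/(word_eval f w) /=.
  case: g => [[[i j] ij]||].
  - have ge : edgy n S (f (GenS (exist _ (i, j) ij))).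
      by rewrite -(eval_wS f ij); exact: edgy_wS.
    by apply: standard_edgy => //; [exact: S_comm|case: e => //; exact: edgyV].
  - case: e.
      by apply: (standard_aV n0 S_comm S_conj_a rot_a_onto edgy_an).
    by apply: (standard_a n0 S_comm S_conj_a rot_a_onto).
  - case: e.
      by apply: (standard_bV n0 S_comm S_conj_a S_conj_b rot_a_onto edge_refl_onto edgy_an edgy_bb edgy_ba).
    by apply: (standard_b n0 S_comm S_conj_a S_conj_b rot_a_onto edge_refl_onto edgy_an edgy_bb edgy_ba).
have [s [i [j [[p [q ->]] hi hj ->]]]] :=
  standard_reduce n0 S_comm S_conj_a rot_a_onto edgy_an edgy_bb st.
exists p, q, i, j; split=> //.
by rewrite !word_eval_cat word_eval_inv !eval_monom_word !eval_nseq !word_eval1 !mulgA.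
Qed.

End StandardWords.

(** * Faithfulness and generation *)

Section Presentation.
Variables (R : realType) (n : nat) (n_gt3 : (3 < n)%N) (x : line_point R n) (cw : bool).
Let f := @cycle_gen_val R n x cw.
Local Open Scope group_scope.
Local Notation prof := (@profile R n x cw).
Local Notation ht := (halfturn R cw).

Lemma profileX u (F : nat -> int) k : prof u id id F ->
  prof (u ^+ k) id id (fun e => F e *+ k)%R.
Proof.
move=> uF; elim: k => [|k IH]; first by rewrite expg0; exact: profile1.
rewrite expgS; apply: (profile_ext n_gt3 (profileM uF IH)) => // e _.
by rewrite mulrS.
Qed.

Lemma profileV u (F : nat -> int) : prof u id id F -> prof u^-1 id id (fun e => - F e)%R.
Proof.
move=> [h1 h2 h3]; have u1 : braid_perm u = 1.
  by apply/permP => k; apply: val_inj; apply: succn_inj; rewrite h1 perm1.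
split=> // [k|j k jk]; first by rewrite braid_permV u1 invg1 perm1.
by rewrite turningV // u1 invg1 !perm1 h3 // intrN mulrN.
Qed.

Lemma profile_monom_word p : prof (word_eval f (monom_word n p)) id id (fun e => (p e).*2%:Z)%R.
Proof.
rewrite eval_monom_word /monom.
have H m : (m <= n)%N -> prof (\prod_(1 <= e < m.+1) word_eval f (edge_word n e) ^+ p e) id id
    (fun e => if (0 < e <= m)%N then (p e).*2%:Z else 0)%R.
  elim: m => [_|m IH mn].
    by rewrite big_geq //; apply: (profile_ext n_gt3 (profile1 x cw)) => // e he; case: ifP => //; lia.
  rewrite big_nat_recr //=.
  apply: (profile_ext n_gt3 (profileM (IH (ltnW mn)) (profileX (p m.+1) (profile_edge_word n_gt3 x cw m.+1)))) => // e he /=.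
  rewrite /F_s; case: (eqVneq e m.+1) => [->|em]; last by do ![case: ifP => ?]; rewrite ?mul0rn; lia.
  by do ![case: ifP => ?]; lia.
by apply: (profile_ext n_gt3 (H n (leqnn n))) => // e he; rewrite he.
Qed.

Lemma profile_bX j : (j < 2)%N -> prof (psi_b x cw ^+ j)
  (if j == 1%N then refl_b n else id) (if j == 1%N then fun e => (n.+1 - e)%N else id)
  (if j == 1%N then F_b n else fun=> 0%R).
Proof.
case: j => [|[|]] // _; first exact: profile1.
by rewrite expg1; exact: profile_b.
Qed.

Lemma profile_standard p q i j : (i < n)%N -> (j < 2)%N ->
  prof (word_eval f (monom_word n p ++ word_inv (monom_word n q) ++
    flatten (nseq i (wA n)) ++ flatten (nseq j (wB n))))
  ((if j == 1%N then refl_b n else id) \o (rot_pow n i))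
  ((if j == 1%N then fun e => (n.+1 - e)%N else id) \o (rot_pow n i))
  (fun e => (p e).*2%:Z - (q e).*2%:Z + (F_rot_pow n i e + (if j == 1%N then F_b n else fun=> 0) (rot_pow n i e)))%R.
Proof.
move=> hi hj; rewrite !word_eval_cat word_eval_inv !eval_nseq !word_eval1.
rewrite -/psi_a -/psi_b.
have pr := profileM (profileM (profile_monom_word p) (profileV (profile_monom_word q)))
   (profileM (profile_aX n_gt3 x cw (ltnW hi)) (profile_bX hj)).
by rewrite -mulgA in pr.
Qed.

(** The standard word congruent to [w] also has trivial value as a braid. Its permutation forces
    [i = j = 0] and its turns force [p = q], after which it cancels in the presented group. *)
Lemma presentation_faithful w : word_eval f w = 1 -> word_cong (@cycle_rel n) w [::].
Proof.
move=> w1; set rel := @cycle_rel n; set g := @pres_gen _ rel.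
have g_rel u v : rel u v -> word_eval g u = word_eval g v.
  by move=> uv; rewrite !word_eval_pres; apply/word_classP; exact: WordRel.
have [p [q [i [j [hi hj]]]]] := word_standard n_gt3 g_rel w.
set w' := (X in _ = word_eval g X) => ww'.
have cong_ww' : word_cong rel w w' by apply/word_classP; rewrite -!word_eval_pres.
have w'1 : word_eval f w' = 1.
  by rewrite -w1; apply/esym/word_eval_cong; last exact: cong_ww'; exact: braid_rel.
have [h1 _ h3] := profile_standard p q hi hj.
rewrite -/w' w'1 in h1 h3.
have n0 : (0 < n)%N by lia.
have n1 : (1 < n)%N by lia.
(* The reflection fixes the label 1, which therefore detects [i]; then the label 2, sent to [n] by
   the reflection, detects [j]. *)
have i0 : i = 0%N.
  have := h1 (Ordinal n0); rewrite braid_perm1 perm1 /= /rot_pow.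
  have := refl_bP n (1 + i); case: (j == 1%N); case: ifP => ? /=; lia.
have j0 : j = 0%N.
  have := h1 (Ordinal n1); rewrite braid_perm1 perm1 /= i0 /rot_pow addn0 n1.
  by case: eqP => [_ /=|]; [have := refl_bP n 2|]; lia.
have pq e : (0 < e <= n)%N -> p e = q e.
  move=> he; have [k1 [k2 [kk ek]]] : exists k1 k2, cycle_graph n k1 k2 /\ eidx n k1.+1 k2.+1 = e.
    case: (eqVneq e n) => [->|en].
      have nn : (n.-1 < n)%N by lia.
      exists (Ordinal n0), (Ordinal nn); split.
        by rewrite /= /cycle_adj /cycle_edge /= ?xpair_eqE; lia.
      by have := eidxP n 1 n.-1.+1; rewrite /=; lia.
    have en1 : (e.-1 < n)%N by lia.
    have en2 : (e < n)%N by lia.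
    exists (Ordinal en1), (Ordinal en2); split.
      by rewrite /= /cycle_adj /cycle_edge /= ?xpair_eqE; lia.
    by have := eidxP n e.-1.+1 e.+1; rewrite /=; lia.
  have := h3 _ _ kk; rewrite turning1 // ek i0 j0 /= /F_rot_pow => /esym/eqP.
  rewrite mulf_eq0 (negbTE (halfturn_neq0 _ _)) /= intr_eq0 => /eqP.
  by do ![case: ifP => ?]; lia.
apply/word_classP; rewrite -!word_eval_pres ww' /w' i0 j0 /= !cats0 word_eval_cat word_eval_inv.
rewrite !eval_monom_word (_ : monom _ _ p = monom n (fun e => word_eval g (edge_word n e)) q) ?mulgV.
  by rewrite /word_eval big_nil.
by apply: eq_big_nat => e he; rewrite pq.
Qed.

Lemma eidx_inj (j k j' k' : 'I_n) : cycle_graph n j k -> cycle_graph n j' k' ->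
  eidx n j.+1 k.+1 = eidx n j'.+1 k'.+1 -> (j = j' /\ k = k') \/ (j = k' /\ k = j').
Proof.
move=> jk jk' e.
suff : (j = j' :> nat /\ k = k' :> nat) \/ (j = k' :> nat /\ k = j' :> nat).
  by case=> -[/val_inj -> /val_inj ->]; [left|right].
have := eidxP n j.+1 k.+1; have := eidxP n j'.+1 k'.+1.
have := ltn_ord j; have := ltn_ord k; have := ltn_ord j'; have := ltn_ord k'.
by case: (cycle_cases n_gt3 jk) => [||[]|[]]; case: (cycle_cases n_gt3 jk') => [||[]|[]] *; lia.
Qed.

Let spanned (h : braid_group (cycle_graph n) (line_base x)) := exists w, word_eval f w = h.

Lemma spannedM g h : spanned g -> spanned h -> spanned (g * h).
Proof. by move=> [u <-] [v <-]; exists (u ++ v); rewrite word_eval_cat. Qed.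

Lemma spannedV g : spanned g -> spanned g^-1.
Proof. by move=> [u <-]; exists (word_inv u); rewrite word_eval_inv. Qed.

Lemma spanned_cancel g h : spanned g -> spanned (h * g) -> spanned h.
Proof. by move=> sg shg; rewrite -(mulgK g h); apply: spannedM => //; exact: spannedV. Qed.

(** Whole turns around the edges can be prescribed freely by a word in the [s_{i,j}], and
    [profile_inj] identifies [h] with the word having the same turns. *)
Lemma pure_spanned h : braid_perm h = 1 -> spanned h.
Proof.
move=> h1.
have /choice [z hz] e : exists z : int, forall j k, cycle_graph n j k ->
    eidx n j.+1 k.+1 = e -> turning h j k = (ht * (2 * z)%:~R)%R.
  case: (pselect (exists j k : 'I_n, cycle_graph n j k /\ eidx n j.+1 k.+1 = e)).
    move=> [j [k [jk jke]]]; have [z hz] := turning_pure jk h1.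
    (* The integer [z] counts multiples of [2 pi], whereas [halfturn] includes the sign of the
       crossing convention. *)
    exists ((-1) ^+ cw * z)%R => j' k' jk' jke'.
    have -> : turning h j' k' = turning h j k.
      have [[-> ->]//|[-> ->]] := eidx_inj jk' jk (etrans jke' (esym jke)).
      by rewrite turning_sym // adj_sym.
    rewrite hz /halfturn; case: (cw); rewrite ?expr0 ?expr1 ?mulN1r ?mul1r ?mulrN ?mulNr ?intrN ?intrM; ring.
  by move=> nex; exists 0%R => j k jk jke; case: nex; exists j, k.
pose p e := if z e is Posz m then m else 0%N.
pose q e := if z e is Negz m then m.+1 else 0%N.
exists (monom_word n p ++ word_inv (monom_word n q)); rewrite word_eval_cat word_eval_inv.
have ph : prof h id id (fun e => 2 * z e)%R.
  split=> // [k|j k jk]; first by rewrite h1 perm1.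
  exact: hz.
apply: (profile_inj n_gt3 (profileM (profile_monom_word p) (profileV (profile_monom_word q))) ph) => // e _ /=.
by rewrite /p /q; case: (z e) => m; lia.
Qed.

(** By induction along the cycle: the next vertex is the neighbour of a fixed vertex other than its
    predecessor, which is fixed too. *)
Lemma fix12_id (s : 'S_n) (k0 k1 : 'I_n) : s \in graph_aut (cycle_graph n) ->
  k0 = 0%N :> nat -> k1 = 1%N :> nat -> s k0 = k0 -> s k1 = k1 -> s = 1.
Proof.
move=> /graph_autP sG e0 e1 s0 s1.
suff H m : forall k : 'I_n, (k <= m)%N -> s k = k.
  by apply/permP => k; rewrite perm1; exact: H (leqnn k).
elim: m => [|m IH] k km; first by rewrite (_ : k = k0) //; apply: val_inj => /=; lia.
case: (leqP k m) => [/IH //|mk].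
case: (eqVneq m 0%N) => [m0|m0]; first by rewrite (_ : k = k1) //; apply: val_inj => /=; lia.
have kn := ltn_ord k.
have m1n : (m.-1 < n)%N by lia.
have mn : (m < n)%N by lia.
have f1 := IH (Ordinal m1n) ltac:(rewrite /=; lia).
have f2 := IH (Ordinal mn) ltac:(rewrite /=; lia).
have adj : cycle_graph n (Ordinal mn) k.
  by rewrite /= /cycle_adj /cycle_edge /= ?xpair_eqE; lia.
have adj' : cycle_graph n (Ordinal mn) (s k) by rewrite -{1}f2 sG.
have ne : (s k != Ordinal m1n).
  apply/eqP; rewrite -{1}f1 => /perm_inj e.
  by move: mk; rewrite e /=; lia.
move: ne; rewrite -val_eqE /= => ne; apply: val_inj.
have := ltn_ord (s k).
by case: (cycle_cases n_gt3 adj') => [||[]|[]] /=; lia.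
Qed.

(** A power of [psi(a)] brings the label 1 home. The label 2 is then at 2 or at [n], and [psi(b)]
    corrects the second case; what remains is pure. *)
Lemma spanned_all h : spanned h.
Proof.
have n0 : (0 < n)%N by lia.
have n1 : (1 < n)%N by lia.
pose k0 := Ordinal n0; pose k1 := Ordinal n1.
have spa i : spanned (psi_a x cw ^+ i).
  by exists (flatten (nseq i (wA n))); rewrite eval_nseq word_eval1.
have spb : spanned (psi_b x cw) by exists (wB n); rewrite word_eval1.
(* The ordinal [v] stands for the label [v + 1], which [n - v] rotations carry to [n + 1], that is
   to 1. The value [i = n] occurs when [v = 0]. *)
pose i := (n - braid_perm h k0)%N.
have hi : (i <= n)%N by rewrite leq_subr.
apply: (spanned_cancel (spa i)); set h' := h * _.
have [ha _ _] := profile_aX n_gt3 x cw hi.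
have h'0 : braid_perm h' k0 = k0.
  apply: val_inj; apply: succn_inj; rewrite /= braid_permM permM ha /rot_pow /i /=.
  by have := ltn_ord (braid_perm h k0); case: ifP => ?; lia.
have h'G := end_perm_aut (repr h'); rewrite -/(braid_perm h') in h'G.
have adj01 : cycle_graph n k0 k1 by rewrite /= /cycle_adj /cycle_edge /= ?xpair_eqE; lia.
have adj' : cycle_graph n k0 (braid_perm h' k1).
  by rewrite -{1}h'0; move/graph_autP: h'G => ->.
case: (eqVneq (braid_perm h' k1) k1) => h'1.
  by apply: pure_spanned; exact: (fix12_id h'G _ _ h'0 h'1).
apply: (spanned_cancel spb); apply: pure_spanned.
have [hb _ _] := profile_b n_gt3 x cw.
have h''G := end_perm_aut (repr (h' * psi_b x cw)).
apply: (@fix12_id _ k0 k1 h''G) => //; apply: val_inj; apply: succn_inj;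
  rewrite -[end_perm _]/(braid_perm (h' * psi_b x cw)) braid_permM permM hb.
  by rewrite h'0.
have := refl_bP n (braid_perm h' k1).+1; move: h'1; rewrite -val_eqE /=.
have := ltn_ord (braid_perm h' k1).
by case: (cycle_cases n_gt3 adj') => [||[]|[]] /=; lia.
Qed.

End Presentation.

Theorem proposition3p1 (R : realType) (n : nat) (n_gt3 : (3 < n)%N)
    (x : line_point R n) (cw : bool) :
  is_presentation (@cycle_rel n) (@cycle_gen_val R n x cw).
Proof.
split=> [h|u v]; first exact: spanned_all.
split=> [uv|]; last by apply: word_eval_cong; exact: braid_rel.
have : word_cong (@cycle_rel n) (u ++ word_inv v) [::].
  by apply: (@presentation_faithful R n n_gt3 x cw); rewrite word_eval_cat word_eval_inv uv mulgV.
move=> h; apply: (@WordTrans _ _ _ (u ++ (word_inv v ++ v))).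
  rewrite -{1}[u]cats0; apply: WordCat; first exact: WordRefl.
  by apply: WordSym; exact: word_cong_Vmul.
rewrite catA -[X in word_cong _ _ X]cat0s; apply: WordCat => //; exact: WordRefl.
Qed.
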